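(* Let $D$ be the constraint database over the schema $(S,P)$ over $\mathbb{C}$ in which $S$ and $P$ are interpreted as the graphs of the sum and the product of complex numbers. For natural numbers $L,n$ let $\Phi_{L,n}(S,P)$ be the first-order formula of length $O((L+n)^2)$ constructed in the context, and let $\mathcal{P}$ be a branching-parsimonious procedure which evaluates the family of extended sample point queries associated to the formulas $\Phi_{L,n}(S,P)$. Then $\mathcal{P}$ requires sequential time $2^{\Omega(n)}$ in order to evaluate, on input the database $D$, the extended sample point query associated to the size $O(n^2)$ first-order formula $\Phi_{n,n}(S,P)$. In particular, extended sample point queries associated to first-order formulas with a fixed number of quantifier alternations cannot be evaluated by branching-parsimonious procedures in polynomial time.
   Context: **Circuits.** An essentially division-free, single-output arithmetic circuit with inputs $x_1,\dots,x_n$ and scalars $\theta_1,\dots,\theta_s$ in a field $K\supseteq\mathbb{Q}$ is a labeled directed acyclic graph. Its nodes of indegree zero are labeled by the variables $x_1,\dots,x_n$, by the scalars $\theta_1,\dots,\theta_s$, or by rational constants. Its internal nodes are labeled by arithmetic operations. No division involves an intermediate result depending on the variables, and no polynomial of positive degree in the variables is divided by a non-constant scalar. All elements of $K$ depending on parameters that are used by the circuit are listed among the scalars. Hence every node represents a polynomial in $\mathbb{Q}[\theta_1,\dots,\theta_s][x_1,\dots,x_n]$. The (total) size of a circuit is its number of arithmetic operations, each at unit cost. Its non-scalar size (over $K$) counts only the multiplications between intermediate results that actually involve variables; $K$-linear operations are free. Sequential time is measured by circuit size. In particular, the sequential time a procedure needs to produce an output circuit is at least the size of that circuit. **Rationally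 parameterized families and extended sample point queries.** Let $\pi:\mathbb{C}^{m+n+1}\to\mathbb{C}^m$ be the projection on the first $m$ coordinates. Let $A\subseteq\mathbb{C}^{m+n+1}$ be a non-empty constructible set such that for every $u\in\pi(A)$ the set $(\{u\}\times\mathbb{C}^{n+1})\cap A$ is the graph of a polynomial $f_u\in\mathbb{C}[x_1,\dots,x_n]$. Such a set is said to represent a rationally parameterized family of polynomial functions, with parameters $u_1,\dots,u_m$ and variables $x_1,\dots,x_n$. The extended sample point query associated to $A$ (or to a formula defining $A$) asks for a representation, with terms depending rationally on $u$, of a division-free arithmetic circuit evaluating $f_u$, for $u\in\pi(A)$. **Branching-free output representation.** Let $A\subseteq\mathbb{C}^{m+n+1}$ be a non-empty constructible set such that for every $u\in\pi(A)$ the set $(\{u\}\times\mathbb{C}^{n+1})\cap A$ is the graph of a polynomial $f_u\in\mathbb{C}[x_1,\dots,x_n]$, and suppose that $A$ has irreducible Zariski closure $B$. Let $V$ be the (irreducible) Zariski closure of $\pi(A)$ in $\mathbb{C}^m$, and let $K$ be the function field of $V$ over $\mathbb{C}$. Suppose moreover that $\pi(B)=V$ and that $B$ represents a rationally parameterized family of polynomial functions extending the one represented by $A$. The extended sample point query associated to $A$ admits a branching-free output representation if there is an essentially division-free, single-output arithmetic circuit $\beta$ with inputs $x_1,\dots,x_n$ and scalars $\theta_1,\dots,\theta_s\in K$ such that both of the following hold. (i) For every $u\in\pi(A)$ at which $\theta_1,\dots,\theta_s$ are defined, the circuit obtained from $\beta$ by specializing each $\theta_j$ to $\theta_j(u)$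 evaluates $f_u$. (ii) For every $u\in V$ and every place $\varphi:K\to\mathbb{C}\cup\{\infty\}$ whose valuation ring extends the local ring of $V$ at $u$ (i.e. contains this local ring, with maximal ideals compatible), the values $\varphi(\theta_1),\dots,\varphi(\theta_s)$ are finite and uniquely determined by $u$. Such a $\beta$ is called a branching-free representation of the output of the query. **Branching-parsimonious procedure.** A query evaluation procedure for extended sample point queries is branching-parsimonious if, whenever the given query admits a branching-free output representation, the procedure produces as its output such a branching-free representation $\beta$. **The formulas.** Let $L,n$ be natural numbers, $r:=(L+n+1)^2$ and $m:=4(L+n)^2+2$. For $f\in\mathbb{C}[x_1,\dots,x_n]$ let $L(f)$ be the minimal non-scalar size (over $\mathbb{C}$) of all division-free arithmetic circuits with inputs $x_1,\dots,x_n$ and scalars from $\mathbb{C}$ which evaluate $f$. Let $W_{L,n}:=\{f\in\mathbb{C}[x_1,\dots,x_n] : L(f)\le L\}$ and let $\overline{W_{L,n}}$ be its Zariski closure (all elements have degree at most $2^L$). Let $\mathcal{D}_{L,n}$ be a directed acyclic graph with $O((L+n)^2)$ internal nodes representing a generic division-free arithmetic circuit with input nodes $x_1,\dots,x_n$, output node $y$ and scalar nodes $z_1,\dots,z_r$, such that the polynomials computed by specializing $z_1,\dots,z_r$ to complex values are exactly the elements of $W_{L,n}$. Let $S(v_1,v_2,w)$ and $P(v_1,v_2,w)$ be ternary relation symbols. Let $\Psi_{L,n}(S,P,z_1,\dots,z_r,x_1,\dots,x_n,y)$ be the prenex, purely existential formula of length $O((L+n)^2)$ in the language $\mathrm{FO}(+,\times,0,1,=,S,P)$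 obtained by translating $\mathcal{D}_{L,n}$ into logic, with $S$ and $P$ playing the role of the graphs of addition and multiplication. When $S,P$ are interpreted as the graphs of complex addition and multiplication and $z$ is specialized to $\zeta\in\mathbb{C}^r$, the formula $\Psi_{L,n}$ describes the graph of the polynomial in $\mathbb{C}[x_1,\dots,x_n]$ computed by $\mathcal{D}_{L,n}$ with scalars $\zeta$. Let $\gamma_1,\dots,\gamma_m\in\mathbb{Q}^n$ be an identification sequence for $\overline{W_{L,n}}$: any $f,g\in\overline{W_{L,n}}$ with $f(\gamma_k)=g(\gamma_k)$ for all $1\le k\le m$ are equal. (Such a sequence exists.) Let $\Delta_{L,n}(S,P)$ be a closed formula saying that $S$ and $P$ are graphs of binary operations $\mathbb{C}^2\to\mathbb{C}$, that $\gamma_1,\dots,\gamma_m$ is an identification sequence for the class of maps $\mathbb{C}^n\to\mathbb{C}$ defined by $\Psi_{L,n}(S,P)$, and that this class is non-empty. It is valid on $D$. The formula $\Phi_{L,n}(S,P,u_1,\dots,u_m,x_1,\dots,x_n,y)$ is $$(\exists z_1)\cdots(\exists z_r)\Big(\Psi_{L,n}(S,P,z_1,\dots,z_r,x_1,\dots,x_n,y)\wedge\bigwedge_{1\le k\le m}\Psi_{L,n}(S,P,z_1,\dots,z_r,\gamma_k,u_k)\Big)\wedge\Delta_{L,n}(S,P).$$ As a standing assumption it is taken to be written as an equivalent prenex formula of length $O((L+n)^2)$ with a fixed number of quantifier alternations (independent of $L$ and $n$). On the database $D$ it defines the constructible set $$A_{L,n}(D)=\{(f(\gamma_1),\dots,f(\gamma_m),x,f(x))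 : f\in W_{L,n},\ x\in\mathbb{C}^n\}\subseteq\mathbb{C}^{m+n+1}.$$ The extended sample point query associated to $\Phi_{L,n}(S,P)$, evaluated on $D$, is the one associated to the set $A_{L,n}(D)$. *)

(* Defs.v *)
From HB Require Import structures.
From mathcomp Require Import all_boot all_order all_algebra.
From mathcomp Require Import generic_quotient ring_quotient fraction.
From mathcomp Require Import boolp reals.
From mathcomp Require Import complex mpoly.

Set Implicit Arguments.
Unset Strict Implicit.
Unset Printing Implicit Defensive.

Import GRing.Theory Num.Theory.
Local Open Scope ring_scope.
Local Open Scope quotient_scope.

(** * Arithmetic circuits *)

(* The leaves of the graph are not gates: a gate refers directly to a
   variable, a scalar, a rational constant, or an earlier gate.  A labeled
   directed acyclic graph is given by a topological order of its internal
   nodes, and its size is the number of gates. *)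

Inductive operand (n s : nat) :=
  | OVar of 'I_n
  | OScal of 'I_s
  | OConst of rat
  | OGate of nat.

Arguments OConst {n s} _.

Variant arith_op := AAdd | ASub | AMul | ADiv.

Record gate (n s : nat) :=
  Gate { gate_op : arith_op; gate_l : operand n s; gate_r : operand n s }.

Record circuit (n s : nat) :=
  Circuit { gates : seq (gate n s); output : operand n s }.

Section Circuits.
Variables (n s : nat).
Implicit Types (o : operand n s) (g : gate n s) (c : circuit n s).

Definition circuit_size c : nat := size (gates c).

Definition gate0 : gate n s := Gate AAdd (OConst 0) (OConst 0).

Definition operand_before (k : nat) o : bool :=
  if o is OGate j then (j < k)%N else true.

Definition well_formed c : Prop :=
  (forall k, (k < circuit_size c)%N ->
     operand_before k (gate_l (nth gate0 (gates c) k)) /\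
     operand_before k (gate_r (nth gate0 (gates c) k)))
  /\ operand_before (circuit_size c) (output c).

Section Evaluation.
Variables (A : unitRingType) (cst : rat -> A) (x : 'I_n -> A) (t : 'I_s -> A).

Definition operand_val (vs : seq A) o : A :=
  match o with
  | OVar i => x i
  | OScal j => t j
  | OConst q => cst q
  | OGate k => nth 0 vs k
  end.

Definition gate_val (vs : seq A) g : A :=
  let a := operand_val vs (gate_l g) in
  let b := operand_val vs (gate_r g) in
  match gate_op g with
  | AAdd => a + b
  | ASub => a - b
  | AMul => a * b
  | ADiv => a / b
  end.

Definition gate_vals c : seq A :=
  foldl (fun vs g => rcons vs (gate_val vs g)) [::] (gates c).

End Evaluation.

Section Field.
Variables (F : fieldType) (t : 'I_s -> F).

Definition circuit_vals c : seq {mpoly F[n]} :=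
  gate_vals (fun q => (ratr q)%:MP) (fun i => 'X_i) (fun j => (t j)%:MP) c.

Definition poly_of_operand c o : {mpoly F[n]} :=
  operand_val (fun q => (ratr q)%:MP) (fun i => 'X_i) (fun j => (t j)%:MP)
    (circuit_vals c) o.

Definition circuit_poly c : {mpoly F[n]} := poly_of_operand c (output c).

Definition is_mul g : bool := if gate_op g is AMul then true else false.

Definition involves_vars c o : bool := (1 < msize (poly_of_operand c o))%N.

Definition nonscalar_size c : nat :=
  count (fun g => [&& is_mul g, involves_vars c (gate_l g)
                    & involves_vars c (gate_r g)]) (gates c).

End Field.

Definition is_div g : bool := if gate_op g is ADiv then true else false.

Definition division_free c : bool := all (fun g => ~~ is_div g) (gates c).

(* The value of an operand in Q[theta][x], the scalars being indeterminates. *)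
Definition formal_val c o : {mpoly {mpoly rat[s]}[n]} :=
  let cst q := (q%:MP)%:MP in
  let x i := 'X_i in
  let t j := ('X_j)%:MP in
  operand_val cst x t (gate_vals cst x t c) o.

(* Divisors are nonzero rational constants, so that every gate represents an
   element of Q[theta][x]; a quotient of scalars is itself a scalar leaf. *)
Definition essentially_division_free c : Prop :=
  forall k, (k < circuit_size c)%N -> is_div (nth gate0 (gates c) k) ->
  exists2 q : rat, q != 0 &
    formal_val c (gate_r (nth gate0 (gates c) k)) = (q%:MP)%:MP.

Definition plain_operand o : bool := if o is OConst _ then false else true.

(* Leaves are variables and scalars, gates are additions and multiplications. *)
Definition plain c : bool :=
  plain_operand (output c) &&
  all (fun g => [&& plain_operand (gate_l g), plain_operand (gate_r g) &
                  if gate_op g is (AAdd | AMul) then true else false])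
      (gates c).

End Circuits.

(** * First-order formulas over (+, *, 0, 1, =, S, P), with named variables *)

Inductive term :=
  | TVar of nat
  | TZero
  | TOne
  | TAdd of term & term
  | TMul of term & term.

Inductive formula :=
  | FEq of term & term
  | FS of term & term & term
  | FP of term & term & term
  | FNot of formula
  | FAnd of formula & formula
  | FOr of formula & formula
  | FImp of formula & formula
  | FEx of nat & formula
  | FAll of nat & formula.

Fixpoint term_length (t : term) : nat :=
  match t with
  | TAdd a b | TMul a b => (term_length a + term_length b).+1
  | _ => 1%N
  end.

(* Number of symbols, each variable counting for one. *)
Fixpoint formula_length (f : formula) : nat :=
  match f with
  | FEq a b => (term_length a + term_length b).+1
  | FS a b c | FP a b c =>
      (term_length a + term_length b + term_length c).+1
  | FNot g => (formula_length g).+1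
  | FAnd g h | FOr g h | FImp g h => (formula_length g + formula_length h).+1
  | FEx _ g | FAll _ g => (formula_length g).+2
  end.

Fixpoint term_vars (t : term) : seq nat :=
  match t with
  | TVar i => [:: i]
  | TAdd a b | TMul a b => term_vars a ++ term_vars b
  | _ => [::]
  end.

Fixpoint free_vars (f : formula) : seq nat :=
  match f with
  | FEq a b => term_vars a ++ term_vars b
  | FS a b c | FP a b c => term_vars a ++ term_vars b ++ term_vars c
  | FNot g => free_vars g
  | FAnd g h | FOr g h | FImp g h => free_vars g ++ free_vars h
  | FEx i g | FAll i g => filter (predC1 i) (free_vars g)
  end.

Fixpoint quantifier_free (f : formula) : bool :=
  match f with
  | FEq _ _ | FS _ _ _ | FP _ _ _ => true
  | FNot g => quantifier_free g
  | FAnd g h | FOr g h | FImp g h => quantifier_free g && quantifier_free h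
  | FEx _ _ | FAll _ _ => false
  end.

Fixpoint prenex (f : formula) : bool :=
  match f with
  | FEx _ g | FAll _ g => prenex g
  | _ => quantifier_free f
  end.

Fixpoint quantifier_prefix (f : formula) : seq bool :=
  match f with
  | FEx _ g => true :: quantifier_prefix g
  | FAll _ g => false :: quantifier_prefix g
  | _ => [::]
  end.

(* For prenex formulas: the number of changes in the quantifier prefix. *)
Definition alternations (f : formula) : nat :=
  if quantifier_prefix f is b :: bs then count id (pairmap addb b bs) else 0%N.

Section Translation.
Variables (n s : nat).

(* Variables 0 .. s-1 are the scalars z, s .. s+n-1 are the inputs x, s+n is
   the output y, and s+n+1+k is the value of gate k.  Rational constants have
   no translation; the circuits to which this is applied have none. *)
Definition operand_term (o : operand n s) : term :=
  match o with
  | OVar i => TVar (s + i)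
  | OScal j => TVar j
  | OConst _ => TZero
  | OGate k => TVar (s + n + 1 + k)
  end.

Definition gate_formula (k : nat) (g : gate n s) : formula :=
  let a := operand_term (gate_l g) in
  let b := operand_term (gate_r g) in
  let v := TVar (s + n + 1 + k) in
  match gate_op g with
  | AAdd => FS a b v
  | ASub => FS v b a
  | AMul => FP a b v
  | ADiv => FP v b a
  end.

Definition circuit_formula (c : circuit n s) : formula :=
  let body :=
    foldr (fun k f => FAnd (gate_formula k (nth (gate0 n s) (gates c) k)) f)
      (FEq (TVar (s + n)) (operand_term (output c)))
      (iota 0 (circuit_size c)) in
  foldr (fun k f => FEx (s + n + 1 + k) f) body (iota 0 (circuit_size c)).

End Translation.

Section Complex.
Variable R : realType.
Local Notation C := R[i].

(** * Algebraic sets over C *)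

Section AffineSpace.
Variable N : nat.
Implicit Types (X Y : 'rV[C]_N -> Prop) (w : 'rV[C]_N).

(* The points at which finitely many polynomials vanish and one does not. *)
Definition cell : Type := (seq {mpoly C[N]} * {mpoly C[N]})%type.

Definition in_cell (cl : cell) w : bool :=
  all (fun p => p.@[w ord0] == 0) cl.1 && (cl.2.@[w ord0] != 0).

Definition constructible X : Prop :=
  exists cells : seq cell, forall w, X w <-> has (in_cell^~ w) cells.

Definition zclosure X w : Prop :=
  forall p : {mpoly C[N]}, (forall v, X v -> p.@[v ord0] = 0) ->
  p.@[w ord0] = 0.

Definition zclosed X : Prop := forall w, zclosure X w -> X w.

Definition irreducible X : Prop :=
  (exists w, X w) /\
  forall Y Z, zclosed Y -> zclosed Z -> (forall w, X w -> Y w \/ Z w) ->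
  (forall w, X w -> Y w) \/ (forall w, X w -> Z w).

Record variety := Variety {
  vpoints :> 'rV[C]_N -> Prop;
  variety_closed : zclosed vpoints;
  variety_irr : irreducible vpoints }.

End AffineSpace.

(** * The function field of an irreducible variety *)

Section FunctionField.
Variables (m : nat) (V : variety m).

Definition vanishing : {pred {mpoly C[m]}} :=
  fun p => `[< forall v : 'rV[C]_m, V v -> p.@[v ord0] = 0 >].

Lemma vanishing_idealr : idealr_closed vanishing.
Proof.
split.
- by apply/asboolP => v _; rewrite meval0.
- apply/negP => /asboolP h; have [[v Vv] _] := variety_irr V.
  by have := h v Vv; rewrite meval1 => /eqP; rewrite oner_eq0.
- move=> a p q /asboolP hp /asboolP hq; apply/asboolP => v Vv.
  by rewrite mevalD mevalM hp // hq // mulr0 addr0.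
Qed.

HB.instance Definition _ := isIdealr.Build _ vanishing vanishing_idealr.

Lemma zclosed_zero (p : {mpoly C[m]}) :
  zclosed (fun v : 'rV[C]_m => p.@[v ord0] = 0).
Proof. by move=> w; apply. Qed.

Lemma vanishing_prime : prime_idealr_closed vanishing.
Proof.
move=> p q /asboolP pq0.
have [_ irr] := variety_irr V.
have [|h|h] := irr _ _ (@zclosed_zero p) (@zclosed_zero q).
- move=> v Vv; have := pq0 v Vv; rewrite mevalM => /eqP.
  by rewrite mulf_eq0 => /orP[/eqP|/eqP]; [left|right].
- by apply/orP; left; apply/asboolP.
- by apply/orP; right; apply/asboolP.
Qed.

HB.instance Definition _ := isPrimeIdealrClosed.Build _ vanishing vanishing_prime.

Definition coord_ring : Type := {ideal_quot (vanishing : idealr {mpoly C[m]})}.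

HB.instance Definition _ := GRing.ComNzRing.on coord_ring.

Definition coord_unit : {pred coord_ring} :=
  fun x => `[< exists y : coord_ring, y * x = 1 >].

Definition coord_inv (x : coord_ring) : coord_ring :=
  if pselect (exists y : coord_ring, y * x = 1) is left h
  then projT1 (cid h) else x.

Lemma coord_mulVx : {in coord_unit, left_inverse 1 coord_inv *%R}.
Proof.
move=> x /asboolP ux; rewrite /coord_inv.
by case: pselect => // h; case: (cid h).
Qed.

Lemma coord_unitP (x y : coord_ring) : y * x = 1 -> coord_unit x.
Proof. by move=> yx1; apply/asboolP; exists y. Qed.

Lemma coord_inv_out : {in [predC coord_unit], coord_inv =1 id}.
Proof.
move=> x /negP nux; rewrite /coord_inv.
by case: pselect => // h; case: nux; apply/asboolP.
Qed.

HB.instance Definition _ := GRing.ComNzRing_hasMulInverse.Build coord_ring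
  coord_mulVx coord_unitP coord_inv_out.

Lemma coord_integral : GRing.integral_domain_axiom coord_ring.
Proof. exact: Quotient.rquot_IdomainAxiom. Qed.

HB.instance Definition _ :=
  GRing.ComUnitRing_isIntegral.Build coord_ring coord_integral.

Definition function_field : fieldType := {fraction coord_ring}.

Definition coord_fun (p : {mpoly C[m]}) : coord_ring := \pi p.

(* Meaningful when q does not vanish identically on V. *)
Definition rational_fun (p q : {mpoly C[m]}) : function_field :=
  FracField.tofrac (coord_fun p) / FracField.tofrac (coord_fun q).

End FunctionField.
(** * Values and places *)

Section Places.
Variables (m : nat) (V : variety m).
Implicit Types (u : 'rV[C]_m) (th : function_field V).

(* th belongs to the local ring of V at u and takes the value a there. *)
Definition has_value u th (a : C) : Prop :=
  exists p q : {mpoly C[m]},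
    [/\ q.@[u ord0] != 0, th = rational_fun V p q
      & a = p.@[u ord0] / q.@[u ord0]].

(* None stands for infinity; places are trivial on C. *)
Definition place (phi : function_field V -> option C) : Prop :=
  [/\ forall c : C, phi (rational_fun V c%:MP 1) = Some c,
      forall x y a b, phi x = Some a -> phi y = Some b ->
        phi (x + y) = Some (a + b) /\ phi (x * y) = Some (a * b)
    & forall x, phi x = None -> x != 0 /\ phi x^-1 = Some 0].

(* The valuation ring of phi contains the local ring of V at u, and its
   maximal ideal cuts out the maximal ideal of the local ring. *)
Definition place_at u (phi : function_field V -> option C) : Prop :=
  place phi /\
  forall th a, has_value u th a ->
    exists2 b, phi th = Some b & (b = 0 <-> a = 0).

End Places.

(** * Extended sample point queries *)

Section Queries.
Variables m n : nat.
Implicit Types (A : 'rV[C]_(m + n + 1) -> Prop) (f : {mpoly C[n]}).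

Definition point (u : 'rV[C]_m) (x : 'rV[C]_n) (y : C) : 'rV[C]_(m + n + 1) :=
  row_mx (row_mx u x) y%:M.

Definition proj A (u : 'rV[C]_m) : Prop := exists x y, A (point u x y).

Definition fibre_graph A (u : 'rV[C]_m) f : Prop :=
  forall x y, A (point u x y) <-> y = f.@[x ord0].

Definition rational_family A : Prop :=
  [/\ constructible A, exists w, A w
    & forall u, proj A u -> exists f, fibre_graph A u f].

(* A circuit whose scalars are given as fractions of polynomials in u. *)
Record representation := Representation {
  nscalars : nat;
  rep_circuit : circuit n nscalars;
  rep_num : 'I_nscalars -> {mpoly C[m]};
  rep_den : 'I_nscalars -> {mpoly C[m]} }.

Definition branching_free_rep A (r : representation) : Prop :=
  let B := zclosure A in
  [/\ rational_family A, irreducible B, rational_family B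
    & (forall u f, proj A u -> fibre_graph A u f -> fibre_graph B u f)]
  /\ exists V : variety m,
    [/\ forall u, V u <-> zclosure (proj A) u,
        forall u, V u <-> proj B u,
        well_formed (rep_circuit r),
        essentially_division_free (rep_circuit r)
      & forall j : 'I_(nscalars r), coord_fun V (rep_den j) != 0] /\
    let theta (j : 'I_(nscalars r)) := rational_fun V (rep_num j) (rep_den j) in
    (forall u f (a : 'I_(nscalars r) -> C),
       proj A u -> fibre_graph A u f ->
       (forall j, has_value u (theta j) (a j)) ->
       circuit_poly a (rep_circuit r) = f)
    /\
    (forall u, V u -> forall j,
       (forall phi, place_at u phi -> exists a, phi (theta j) = Some a) /\
       (forall phi psi, place_at u phi -> place_at u psi ->
          phi (theta j) = psi (theta j))).

Definition admits_branching_free_rep A : Prop :=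
  exists r, branching_free_rep A r.

(* Either a single representation, or several ones guarded by conditions on
   the parameters. *)
Inductive query_output :=
  | BranchingFree of representation
  | Branching of seq (cell m * representation).

Definition evaluates_on (g : cell m) (r : representation) A : Prop :=
  forall u f, in_cell g u -> proj A u -> fibre_graph A u f ->
  [/\ well_formed (rep_circuit r), division_free (rep_circuit r),
      forall j : 'I_(nscalars r), (rep_den j).@[u ord0] != 0
    & circuit_poly
        (fun j : 'I_(nscalars r) =>
           (rep_num j).@[u ord0] / (rep_den j).@[u ord0])
        (rep_circuit r) = f].

Definition answers A (o : query_output) : Prop :=
  match o with
  | BranchingFree r => branching_free_rep A r
  | Branching bs =>
      (forall u, proj A u -> has (fun b => in_cell b.1 u) bs) /\
      foldr (fun b => and (evaluates_on b.1 b.2 A)) True bs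
  end.

Definition output_size (o : query_output) : nat :=
  match o with
  | BranchingFree r => circuit_size (rep_circuit r)
  | Branching bs => sumn [seq circuit_size (rep_circuit b.2) | b <- bs]
  end.

End Queries.

(** * Constraint databases over the schema (S, P) *)

Record database := Database {
  relS : C -> C -> C -> Prop;
  relP : C -> C -> C -> Prop }.

Definition constraint_relation (T : C -> C -> C -> Prop) : Prop :=
  constructible (fun w : 'rV[C]_3 => T (w ord0 0) (w ord0 1) (w ord0 ord_max)).

Definition constraint_database (D : database) : Prop :=
  constraint_relation (relS D) /\ constraint_relation (relP D).

Definition arith_database : database :=
  Database (fun a b c => c = a + b) (fun a b c => c = a * b).

Fixpoint term_val (e : nat -> C) (t : term) : C :=
  match t with
  | TVar i => e i
  | TZero => 0
  | TOne => 1
  | TAdd a b => term_val e a + term_val e b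
  | TMul a b => term_val e a * term_val e b
  end.

Definition update (e : nat -> C) (i : nat) (v : C) : nat -> C :=
  fun j => if j == i then v else e j.

Fixpoint sat (D : database) (e : nat -> C) (f : formula) : Prop :=
  match f with
  | FEq a b => term_val e a = term_val e b
  | FS a b c => relS D (term_val e a) (term_val e b) (term_val e c)
  | FP a b c => relP D (term_val e a) (term_val e b) (term_val e c)
  | FNot g => ~ sat D e g
  | FAnd g h => sat D e g /\ sat D e h
  | FOr g h => sat D e g \/ sat D e h
  | FImp g h => sat D e g -> sat D e h
  | FEx i g => exists v, sat D (update e i v) g
  | FAll i g => forall v, sat D (update e i v) g
  end.

(* The variables 0 .. N-1 take the coordinates of w as their values. *)
Definition env N (w : 'rV[C]_N) (i : nat) : C :=
  if insub i is Some j then w ord0 j else 0.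

Definition defined_set N (D : database) (f : formula) (w : 'rV[C]_N) : Prop :=
  sat D (env w) f.

(** * Query evaluation procedures *)

(* In a query with m parameters and n variables, the formula variables
   0 .. m-1 are u, m .. m+n-1 are x, and m+n is y.  Of the running time it is
   only required that it is at least the size of the circuits produced. *)
Record procedure := Procedure {
  proc_output : forall m n : nat, formula -> database -> query_output m n;
  proc_time : forall m n : nat, formula -> database -> nat;
  proc_time_ge : forall m n f D,
    (output_size (proc_output m n f D) <= proc_time m n f D)%N }.

Definition query_class : Type := nat -> nat -> formula -> Prop.

Definition evaluates_queries (Pr : procedure) (Q : query_class) : Prop :=
  forall m n f D, Q m n f -> constraint_database D ->
  let A := @defined_set (m + n + 1) D f in
  rational_family A -> answers A (proc_output Pr m n f D).

Definition branching_parsimonious (Pr : procedure) (Q : query_class) : Prop :=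
  forall m n f D, Q m n f -> constraint_database D ->
  let A := @defined_set (m + n + 1) D f in
  rational_family A -> admits_branching_free_rep A ->
  exists2 r, proc_output Pr m n f D = BranchingFree r & branching_free_rep A r.

Definition bounded_alternation_queries (q : nat) : query_class :=
  fun m n f => [/\ prenex f, (alternations f <= q)%N
                 & {in free_vars f, forall i, (i < m + n + 1)%N}].

(* On the fixed database of complex arithmetic. *)
Definition polynomial_time (Pr : procedure) (Q : query_class) : Prop :=
  exists c d : nat, forall m n f, Q m n f ->
  rational_family (@defined_set (m + n + 1) arith_database f) ->
  (proc_time Pr m n f arith_database <= c * formula_length f ^ d + c)%N.

(** * The formulas Phi *)

Definition is_complexity n (f : {mpoly C[n]}) (l : nat) : Prop :=
  let attained k := exists s (c : circuit n s) (t : 'I_s -> C),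
    [/\ well_formed c, division_free c, circuit_poly t c = f
      & nonscalar_size t c = k] in
  attained l /\ forall k, attained k -> (l <= k)%N.

Definition W (L n : nat) (f : {mpoly C[n]}) : Prop :=
  exists2 l, is_complexity f l & (l <= L)%N.

(* Zariski closure in the space of coefficients: the equations are polynomial
   in finitely many coefficients. *)
Definition coef_closure n (X : {mpoly C[n]} -> Prop) (f : {mpoly C[n]}) : Prop :=
  forall k (mon : 'I_k -> 'X_{1..n}) (H : {mpoly C[k]}),
  (forall g, X g -> H.@[fun i => g@_(mon i)] = 0) ->
  H.@[fun i => f@_(mon i)] = 0.

Definition nb_scalars (L n : nat) : nat := (L + n + 1) ^ 2.

Definition nb_params (L n : nat) : nat := 4 * (L + n) ^ 2 + 2.

Definition generic_circuit L n (c : circuit n (nb_scalars L n)) : Prop :=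
  [/\ well_formed c, plain c
    & forall f : {mpoly C[n]},
        (exists zeta : 'I_(nb_scalars L n) -> C, circuit_poly zeta c = f)
        <-> W L f].

Definition ratpoint n (g : 'rV[rat]_n) : 'rV[C]_n := map_mx ratr g.

Definition identification_sequence m n (X : {mpoly C[n]} -> Prop)
    (gam : 'I_m -> 'rV[rat]_n) : Prop :=
  forall f g, X f -> X g ->
  (forall k, f.@[ratpoint (gam k) ord0] = g.@[ratpoint (gam k) ord0]) -> f = g.

Section Phi.
Variables (L n : nat) (c : circuit n (nb_scalars L n)).
Variable gam : 'I_(nb_params L n) -> 'rV[rat]_n.

Definition Psi_holds (D : database) (zeta : 'rV[C]_(nb_scalars L n))
    (x : 'rV[C]_n) (y : C) : Prop :=
  defined_set D (circuit_formula c) (point zeta x y).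

Definition Psi_map (D : database) (h : 'rV[C]_n -> C) : Prop :=
  exists zeta, forall x y, Psi_holds D zeta x y <-> y = h x.

Definition is_operation (T : C -> C -> C -> Prop) : Prop :=
  forall a b, exists! v, T a b v.

Definition Delta_spec (Delta : formula) : Prop :=
  free_vars Delta = [::] /\
  forall D (e : nat -> C), sat D e Delta <->
    [/\ is_operation (relS D), is_operation (relP D),
        forall h1 h2, Psi_map D h1 -> Psi_map D h2 ->
          (forall k, h1 (ratpoint (gam k)) = h2 (ratpoint (gam k))) ->
          forall x, h1 x = h2 x
      & exists h, Psi_map D h].

(* Phi is equivalent to
   (exists z, Psi(z, x, y) /\ /\_k Psi(z, gamma_k, u_k)) /\ Delta. *)
Definition Phi_spec (Delta Phi : formula) : Prop :=
  {in free_vars Phi, forall i, (i < nb_params L n + n + 1)%N} /\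
  forall D (u : 'rV[C]_(nb_params L n)) x y,
    defined_set D Phi (point u x y) <->
    (exists zeta, Psi_holds D zeta x y /\
       forall k, Psi_holds D zeta (ratpoint (gam k)) (u ord0 k))
    /\ sat D (fun=> 0) Delta.

End Phi.

Definition Phi_queries (Phi : nat -> nat -> formula) : query_class :=
  fun m n f => exists2 L, m = nb_params L n & f = Phi L n.

End Complex.

(* Main.v *)
(* W_{L,n} is the image of the polynomials t f_z, where f_z is computed by the
   generic circuit with scalars z. Its closure is a cone on which the values at
   the points gamma_k are injective, so a place of C(t, z, x) which is finite at
   these values is finite at the coefficients of t f_z: otherwise divide by a
   dominant coefficient to get a nonzero element of the cone vanishing at all
   gamma_k. Hence the parameters u determine the values of the coefficients at
   every place over u. It follows that the coefficients lie in C(u), and that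
   they are the scalars of a branching-free representation.

   Conversely, let theta_j be the scalars of any such representation. The point
   u = 0 is the image of all of t = 0, so the places over it give each theta_j a
   single value c_j, and along a generic line t -> t f_z the scalars are regular
   at t = 0 with value c_j. Differentiating the circuit at t = 0 writes the
   coefficients of f_z as fixed linear forms in the derivatives of the used
   scalars. The 2^n squarefree monomials all lie in W_{n,n}, so at least 2^n
   scalars are used, and a circuit of size k uses at most 2k + 1 of them. *)
Require Import Defs.
From HB Require Import structures.
From mathcomp Require Import all_boot all_order all_algebra.
From mathcomp Require Import generic_quotient ring_quotient fraction.
From mathcomp Require Import closed_field boolp reals.
From mathcomp Require classical_sets.
From mathcomp Require Import complex mpoly ring zify.

Set Implicit Arguments.
Unset Strict Implicit.
Unset Printing Implicit Defensive.

Import GRing.Theory.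

(** Parsimony binds the procedure only once a branching-free representation is known to exist, so
    existence has to be proved before any bound. The representation exhibited is the dense one, with
    all coefficients as scalars; its size is irrelevant. The factor t does not enlarge W_{L,n},
    since multiplication by a scalar is free in the non-scalar size. No limit is taken in a
    topology. A point of a closure is reached as the centre of a place, obtained from Zorn's lemma.
    Derivatives are algebraic as well, with remainders of the form t^2 times a fraction regular at t
    = 0. Since a fraction has a conventional value at its poles, identities are proved at generic
    points and extended through polynomials, which are determined by their values because the field
    is infinite. *)

(** * Polynomials in several variables and their values *)

Section Mpoly.
Local Open Scope ring_scope.

(** Properties stable under the ring operations are checked on generators; this serves identities
    between morphisms, values at places and jets alike. *)
Lemma mpoly_gen_ind (A : comNzRingType) n (P : {mpoly A[n]} -> Prop) :
  (forall c, P c%:MP) -> (forall i, P 'X_i) ->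
  (forall p q, P p -> P q -> P (p + q)) ->
  (forall p q, P p -> P q -> P (p * q)) -> forall p, P p.
Proof.
move=> PC PX PD PM p.
rewrite (mpolyE p); elim: (msupp p) => [|m s IH].
  by rewrite big_nil -mpolyC0; exact: PC.
rewrite big_cons -mul_mpolyC; apply: (PD) => //; apply: (PM) => //.
rewrite mpolyXE_id; elim: (index_enum _) => [|i r IHr].
  by rewrite big_nil; exact: (PC 1).
rewrite big_cons; apply: (PM) => //; elim: (m i) => [|k IHk].
  by rewrite expr0; exact: (PC 1).
by rewrite exprS; apply: (PM).
Qed.

Lemma mmap_XU (A : nzRingType) (B : comNzRingType) n (f : {rmorphism A -> B})
    (v : 'I_n -> B) i :
  mmap f v 'X_i = v i.
Proof. by rewrite mmapX mmap1U. Qed.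

Lemma rmorph_mmap (A : comNzRingType) (B D : comNzRingType) n
    (f : {rmorphism A -> B}) (g : {rmorphism B -> D}) (v : 'I_n -> B) p :
  g (mmap f v p) = mmap (g \o f) (g \o v) p.
Proof.
elim/mpoly_gen_ind: p => [c|i|p q IHp IHq|p q IHp IHq].
- by rewrite !mmapC.
- by rewrite !mmap_XU.
- by rewrite !rmorphD /= IHp IHq.
- by rewrite !rmorphM /= IHp IHq.
Qed.

Lemma eq_mmap (A : comNzRingType) (B : comNzRingType) n
    (f f' : {rmorphism A -> B}) (v v' : 'I_n -> B) p :
  f =1 f' -> v =1 v' -> mmap f v p = mmap f' v' p.
Proof.
move=> ef ev; elim/mpoly_gen_ind: p => [c|i|p q IHp IHq|p q IHp IHq].
- by rewrite !mmapC; exact: ef.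
- by rewrite !mmap_XU ev.
- by rewrite !rmorphD /= IHp IHq.
- by rewrite !rmorphM /= IHp IHq.
Qed.

(** The exponent of the last variable becomes the degree in [muni p], so the coefficient of [p] at
    [m] is recovered from the coefficient of [muni p] of degree [m ord_max]. *)
Lemma muni_inj (A : comNzRingType) n : injective (@muni n A).
Proof.
apply: raddf_inj => p /= muni00; move/polyP: muni00 => muni0; apply/mpolyP => m;
  rewrite mcoeff0.
have := muni0 (m ord_max); rewrite coef0 => /mpolyP.
move=> /(_ [multinom m (widen_ord (leqnSn n) i) | i < n]); rewrite mcoeff0.
rewrite muniE coef_sum raddf_sum => e.
have [mp|/memN_msupp_eq0 //] := boolP (m \in msupp p).
rewrite -[RHS]e (bigD1_seq m) //= big1_seq ?addr0.
  by rewrite !coefZ coefXn eqxx mulr1 mcoeffZ mcoeffX eqxx mulr1.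
move=> m' /andP[m'm _]; rewrite !coefZ coefXn.
case: eqP => [mx|]; rewrite ?mulr0 ?mcoeff0 // mulr1 mcoeffZ mcoeffX.
case: eqP => [em|]; rewrite ?mulr0 //; case/eqP: m'm; apply/mnmP => i.
have [j ->|->] := unliftP ord_max i; last by rewrite mx.
move/mnmP/(_ j): em; rewrite !mnmE.
by rewrite (_ : widen_ord _ j = lift ord_max j) //; apply: val_inj;
  rewrite /= /bump leqNgt ltn_ord.
Qed.

Lemma meval_muni (A : comNzRingType) n (v : 'I_n.+1 -> A) (p : {mpoly A[n.+1]}) :
  p.@[v] =
  (map_poly (meval (fun i => v (widen_ord (leqnSn n) i))) (muni p)).[v ord_max].
Proof.
rewrite muniE raddf_sum horner_sum {1}(mpolyE p) raddf_sum; apply: eq_bigr =>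
  m _ /=.
rewrite mevalZ mevalX big_ord_recr /= map_polyZ map_polyXn /= hornerZ hornerXn.
rewrite mevalZ mevalX mulrA; congr (_ * _ * _); apply: eq_bigr => i _.
by rewrite mnmE.
Qed.

Lemma poly_eval_neq0 (F : numDomainType) (q : {poly F}) :
  q != 0 -> exists x, q.[x] != 0.
Proof.
(* One natural number more than [q] can have roots, all distinct in characteristic 0. *)
move=> q0; pose s := [seq (k%:R : F) | k <- iota 0 (size q)].
have [/allP h|] := boolP (all (root q) s); last first.
  by move=> /allPn[x _ rx]; exists x.
have us : uniq s.
  rewrite map_inj_uniq ?iota_uniq // => i k /eqP.
  by rewrite Num.Theory.eqr_nat => /eqP.
have := max_poly_roots q0 (introT allP h) us.
by rewrite size_map size_iota ltnn.
Qed.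

(** By induction the leading coefficient of [muni p] is nonzero at some point; specialised there,
    [muni p] is a nonzero polynomial in the last variable. *)
Lemma mpoly_eval_neq0 (F : numDomainType) n (p : {mpoly F[n]}) :
  p != 0 -> exists v, p.@[v] != 0.
Proof.
elim: n p => [|n IH] p p0.
  exists (fun=> 0); apply: contraNneq p0.
  by rewrite (nvar0_mpolyC p) mevalC => ->.
have : muni p != 0.
  by apply: contraNneq p0 => e; apply/eqP/(@muni_inj F n); rewrite e muni0.
rewrite -lead_coef_eq0 => /IH[v hv]; set q := map_poly (meval v) (muni p).
have q0 : q != 0.
  apply: contraNneq hv => q0.
  by rewrite lead_coefE -coef_map_id0 ?raddf0 // -/q q0 coef0.
have [x qx] := poly_eval_neq0 q0.
exists (fun i => if unlift ord_max i is Some k then v k else x).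
rewrite meval_muni unlift_none; move: qx; congr (_.[_] != 0).
apply: eq_map_poly => r; apply: meval_eq => i.
have -> : widen_ord (leqnSn n) i = lift ord_max i.
  by apply: val_inj; rewrite /= /bump leqNgt ltn_ord.
by rewrite liftK.
Qed.

Lemma mpoly_eval_eq (F : numDomainType) n (p q : {mpoly F[n]}) :
  (forall v, p.@[v] = q.@[v]) -> p = q.
Proof.
move=> h; apply/eqP; rewrite -subr_eq0.
have [//|/mpoly_eval_neq0[v]] := eqVneq (p - q) 0.
by rewrite mevalB h subrr eqxx.
Qed.

End Mpoly.

(** * Extending injective morphisms to fields of fractions *)

Section Fractions.
Local Open Scope ring_scope.
Local Open Scope quotient_scope.
Variable A : idomainType.
Local Notation tofrac := (@FracField.tofrac A).

Lemma frac_numden (x : {fraction A}) :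
  exists2 ab : A * A, ab.2 != 0 & x = tofrac ab.1 / tofrac ab.2.
Proof.
elim/quotW: x => r; exists (\n_r, \d_r); rewrite /= ?denom_ratioP //.
have d0 : tofrac \d_r != 0 by rewrite tofrac_eq0 denom_ratioP.
apply: (mulIf d0); rewrite divfK //; unlock FracField.tofrac.
rewrite -[LHS]FracField.pi_mul; apply/eqmodP; rewrite /= FracField.equivfE
  /FracField.mulf.
by rewrite !numden_Ratio ?mulf_neq0 ?oner_neq0 ?denom_ratioP // !mulr1 mulrC.
Qed.

Variables (K : fieldType) (f : {rmorphism A -> K}) (f_inj : forall a, f a = 0 ->
    a = 0).

(** A fraction is read through a chosen pair; [frac_lift_funE] shows that the choice is immaterial,
    [f_inj] keeping the denominators nonzero. *)
Definition frac_lift_fun (x : {fraction A}) : K :=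
  let ab := s2val (cid2 (frac_numden x)) in f ab.1 / f ab.2.

Lemma frac_lift_funE a b : b != 0 -> frac_lift_fun (tofrac a / tofrac b) =
    f a / f b.
Proof.
move=> b0; rewrite /frac_lift_fun; case: cid2 => -[c d] /= d0 e.
have f0 z : z != 0 -> f z != 0 by apply: contraNneq => /f_inj->.
apply/eqP; rewrite eqr_div ?f0 // -!rmorphM; apply/eqP; congr (f _).
apply/eqP; rewrite -tofrac_eq !tofracM -eqr_div ?tofrac_eq0 //.
by apply/eqP.
Qed.

Lemma frac_lift_zmod : zmod_morphism frac_lift_fun.
Proof.
move=> x y; have [[a b] /= b0 ->] := frac_numden x; have [[c d] /= d0 ->] :=
  frac_numden y.
have f0 z : z != 0 -> f z != 0 by apply: contraNneq => /f_inj->.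
rewrite -mulNr -tofracN addf_div ?tofrac_eq0 // -!tofracM -tofracD.
rewrite !frac_lift_funE ?mulf_neq0 // -mulNr addf_div ?f0 //.
by rewrite rmorphD !rmorphM rmorphN.
Qed.

Lemma frac_lift_monoid : monoid_morphism frac_lift_fun.
Proof.
split.
  by rewrite -[1]divr1 -tofrac1 frac_lift_funE ?oner_neq0 // rmorph1 divr1.
move=> x y; have [[a b] /= b0 ->] := frac_numden x; have [[c d] /= d0 ->] :=
  frac_numden y.
rewrite mulf_div -!tofracM !frac_lift_funE ?mulf_neq0 // mulf_div.
by rewrite !rmorphM.
Qed.

Lemma frac_lift : exists g : {rmorphism {fraction A} -> K}, forall a,
    g (tofrac a) = f a.
Proof.
pose g1 := GRing.isZmodMorphism.Build {fraction A} K _ frac_lift_zmod.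
pose g2 := GRing.isMonoidMorphism.Build {fraction A} K _ frac_lift_monoid.
pose g : {rmorphism {fraction A} -> K} := HB.pack frac_lift_fun g1 g2.
exists g => a; rewrite -[tofrac a]divr1 -tofrac1 [LHS]frac_lift_funE ?oner_neq0 //.
by rewrite rmorph1 divr1.
Qed.

End Fractions.

(** * Dickson's lemma and the basis theorem *)

Section Hilbert.

(** The tails have a finite basis [ts] by induction. Give each of its elements a head in [S], and
    let [a] bound these heads. A vector with head at least [a] dominates one of them, and the
    smaller heads are treated one at a time, again by induction on tails. *)
Lemma dickson n (S : seq nat -> Prop) : (forall s, S s -> size s = n) ->
  exists ms : seq (seq nat), (forall m, m \in ms -> S m) /\
    forall s, S s -> exists2 m, m \in ms & all2 leq m s.
Proof.
elim: n S => [|n IH] S szS.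
  have [S0|S0] := pselect (S [::]); last first.
    by exists [::]; split=> // s Ss; case: S0; rewrite -(size0nil (szS s Ss)).
  exists [:: [::]]; split=> [m|s Ss]; first by rewrite inE => /eqP->.
  by exists [::]; rewrite ?inE // (size0nil (szS s Ss)).
have [ts [tsS tsP]] : exists ts : seq (seq nat), (forall t, t \in ts ->
  exists a, S (a :: t)) /\
    forall t, (exists a, S (a :: t)) -> exists2 u, u \in ts & all2 leq u t.
  by apply: IH => t [a /szS /= []].
have [ls [lsS lsP]] : exists ls : seq (seq nat), (forall m, m \in ls -> S m) /\
    forall t, t \in ts -> exists a, a :: t \in ls.
  elim: ts tsS {tsP} => [|t ts IHt] tsS; first by exists [::].
  have [|ls [lsS lsP]] := IHt; first by move=> u ut; apply: tsS;
    rewrite inE ut orbT.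
  have [a Sa] := tsS t (mem_head _ _).
  exists ((a :: t) :: ls); split=> [m|u]; rewrite inE.
    by move=> /predU1P[->|/lsS].
  move=> /predU1P[->|/lsP[b bu]]; first by exists a; rewrite mem_head.
  by exists b; rewrite inE bu orbT.
have [a maxa] : exists a, forall m, m \in ls -> head 0 m <= a.
  exists (\max_(m <- ls) head 0 m) => m mls.
  by rewrite (big_rem m) //= leq_maxl.
have [ms [msS msP]] : exists ms : seq (seq nat), (forall m, m \in ms -> S m) /\
    forall c t, c < a -> S (c :: t) -> exists2 m, m \in ms & all2 leq m (c :: t).
  elim: a {maxa} => [|a [ms [msS msP]]]; first by exists [::].
  have [|us [usS usP]] := IH (fun t => S (a :: t)); first by move=> t /szS /= [].
  exists (map (cons a) us ++ ms); split=> [m|c t].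
    by rewrite mem_cat => /orP[/mapP[u /usS Su ->]|/msS].
  rewrite ltnS leq_eqVlt => /predU1P[->|ca] Sct.
    have [u uu leu] := usP _ Sct; exists (a :: u); rewrite /= ?leqnn //.
    by rewrite mem_cat map_f.
  by have [m mm lem] := msP _ _ ca Sct; exists m; rewrite // mem_cat mm orbT.
exists (ls ++ ms); split=> [m|[|c t] Ss]; last 2 first.
- by move/szS: Ss.
- have [ca|ac] := ltnP c a.
    by have [m mm lem] := msP _ _ ca Ss; exists m; rewrite // mem_cat mm orbT.
  have [|u uts leu] := tsP t; first by exists c.
  have [b bls] := lsP _ uts; exists (b :: u); first by rewrite mem_cat bls.
  by rewrite /= leu andbT (leq_trans (maxa _ bls)).
by rewrite mem_cat => /orP[/lsS|/msS].
Qed.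

Local Open Scope ring_scope.

(** Take elements of [I] whose leading monomials form a Dickson basis. Subtracting a multiple of one
    of them lowers the leading monomial of [p] and leaves its value at a common zero unchanged. The
    conclusion speaks of zeros, the form used for closures. *)
Lemma hilbert_basis (F : fieldType) n (I : {mpoly F[n]} -> Prop) :
  (forall p q r, I p -> I q -> I (p - r * q)) ->
  exists ps : seq {mpoly F[n]}, (forall p, p \in ps -> I p) /\
    forall v, (forall p, p \in ps -> p.@[v] = 0) -> forall p, I p -> p.@[v] = 0.
Proof.
move=> subI.
pose S (s : seq nat) := exists2 p, I p /\ p != 0 & s = mlead p :> seq nat.
have [|ms [msS msP]] := @dickson n S; first by move=> _ [p _ ->];
  rewrite size_tuple.
have [ps [psI psP]] : exists ps : seq {mpoly F[n]}, (forall p, p \in ps -> I p) /\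
    forall m, m \in ms ->
      exists2 p, p \in ps /\ p != 0 & m = mlead p :> seq nat.
  elim: ms msS {msP} => [|m ms IH] msS; first by exists [::].
  have [|ps [psI psP]] := IH; first by move=> u ums; apply: msS;
    rewrite inE ums orbT.
  have [p [Ip p0] em] := msS m (mem_head _ _).
  exists (p :: ps); split=> [q|u]; rewrite inE => /predU1P[->|] //;
    first exact: psI.
    by exists p; rewrite ?mem_head.
  by move=> /psP[q [qps q0] eu]; exists q; rewrite // inE qps orbT.
exists ps; split=> // v vps p.
have [m] : exists m, mlead p = m by exists (mlead p).
elim: (ltom_wf m) p => {}m _ IH p em Ip.
have [->|p0] := eqVneq p 0; first by rewrite meval0.
have [|s /psP[q [qps q0] es] les] := msP (mlead p); first by exists p.
have leqp : (mlead q <= mlead p)%MM.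
  rewrite es in les; apply/mnm_lepP => i; rewrite !(mnm_nth 0%N).
  have sz (w : 'X_{1..n}) : size w = n by rewrite size_tuple.
  move: les; rewrite all2E => /andP[_ /(all_nthP (0, 0)%N)/(_ i)].
  by rewrite size_zip !sz minnn nth_zip ?sz //=; apply; exact: ltn_ord.
pose c := (mleadc p / mleadc q) *: 'X_[(mlead p - mlead q)%MM] : {mpoly F[n]}.
have c0 : mleadc p / mleadc q != 0.
  by rewrite mulf_neq0 ?invr_eq0 ?mleadc_eq0.
have lcq : mlead (c * q) = mlead p.
  rewrite mleadM ?mleadZ ?mleadXm ?submK //.
  rewrite scaler_eq0 negb_or c0 -msupp_eq0 msuppX //.
have cc : (c * q)@_(mlead p) = mleadc p.
  rewrite /c -scalerAl mcoeffZ -{2}(submK leqp) -{1}(mleadXm F (mlead p - mlead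
    q)%MM).
  by rewrite mleadcM mleadXm mcoeffX eqxx mul1r divfK // mleadc_eq0.
have e : p.@[v] = (p - c * q).@[v].
  by rewrite mevalB mevalM (vps q qps) mulr0 subr0.
rewrite e; have [->|r0] := eqVneq (p - c * q) 0; first by rewrite meval0.
apply: (IH (mlead (p - c * q))) => //; last exact/subI/psI.
rewrite -em Order.POrderTheory.lt_neqAle; apply/andP; split; last first.
  by have := mleadB_le p (c * q); rewrite lcq Order.JoinTheory.joinxx.
by apply: contraNneq r0 => el; rewrite -mleadc_eq0 el mcoeffB cc subrr.
Qed.

End Hilbert.

(** * Extension of places *)

Section Places.
Local Open Scope ring_scope.
Variables (C : closedFieldType) (K : fieldType) (j : {rmorphism C -> K}).

Definition is_place (phi : K -> option C) : Prop :=
  [/\ forall c, phi (j c) = Some c,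
      forall x y a b, phi x = Some a -> phi y = Some b ->
        phi (x + y) = Some (a + b) /\ phi (x * y) = Some (a * b)
    & forall x, phi x = None -> x != 0 /\ phi x^-1 = Some 0].

(* The graph of a ring homomorphism over C from a subring of K to C. *)
Record partial_hom (G : K -> C -> Prop) : Prop := PartialHom {
  ph_const : forall c, G (j c) c;
  ph_sub : forall x a y b, G x a -> G y b -> G (x - y) (a - b);
  ph_mul : forall x a y b, G x a -> G y b -> G (x * y) (a * b);
  ph_fun : forall a, G 0 a -> a = 0 }.

Section OnePartialHom.
Variables (G : K -> C -> Prop) (hG : partial_hom G).

Lemma ph0 : G 0 0.
Proof. by have := ph_const hG 0; rewrite rmorph0. Qed.

Lemma ph1 : G 1 1.
Proof. by have := ph_const hG 1; rewrite rmorph1. Qed.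

Lemma ph_add x a y b : G x a -> G y b -> G (x + y) (a + b).
Proof.
move=> xa yb; have := ph_sub hG xa (ph_sub hG ph0 yb).
by rewrite !sub0r !opprK.
Qed.

Lemma ph_sum (I : Type) (r : seq I) (E : I -> K) (E' : I -> C) :
  (forall i, G (E i) (E' i)) -> G (\sum_(i <- r) E i) (\sum_(i <- r) E' i).
Proof.
move=> h; elim: r => [|i r IH]; rewrite ?big_nil ?big_cons; first exact: ph0.
exact: ph_add.
Qed.

Lemma ph_uniq x a b : G x a -> G x b -> a = b.
Proof.
move=> xa xb; apply/eqP; rewrite -subr_eq0; apply/eqP/(ph_fun hG).
by rewrite -(subrr x); apply: ph_sub.
Qed.

Definition ph_poly (P : {poly K}) (Q : {poly C}) := forall i, G P`_i Q`_i.

Lemma ph_polyC x a : G x a -> ph_poly x%:P a%:P.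
Proof. by move=> xa i; rewrite !coefC; case: eqP => // _; exact: ph0. Qed.

Lemma ph_polyX : ph_poly 'X 'X.
Proof. by move=> i; rewrite !coefX; case: eqP => _; [exact: ph1|exact: ph0]. Qed.

Lemma ph_polyB P Q P' Q' :
  ph_poly P Q -> ph_poly P' Q' -> ph_poly (P - P') (Q - Q').
Proof. by move=> h h' i; rewrite !coefB; apply: ph_sub. Qed.

Lemma ph_polyM P Q P' Q' :
  ph_poly P Q -> ph_poly P' Q' -> ph_poly (P * P') (Q * Q').
Proof. by move=> h h' i; rewrite !coefM; apply: ph_sum => k; apply: ph_mul. Qed.

Lemma ph_poly_const Q : ph_poly (map_poly j Q) Q.
Proof. by move=> i; rewrite coef_map; apply: ph_const. Qed.

(* The kernel of G and x generate the unit ideal: x satisfies an equation over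
   the domain of G which becomes 1 = 0 in C, so G does not extend to x. *)
Definition excluded n x :=
  exists2 P, ph_poly P 1 & (size P <= n.+1)%N /\ P.[x] = 0.

(** The equation of [y], multiplied by x^(n+1), is one for [x]; cancelling the top coefficient
    against it gives a shorter equation for [x]. Cross-multiplication avoids dividing in the domain
    of [G], and the new constant coefficient still has value 1. *)
Lemma excluded_not_both n m x y :
  x * y = 1 -> excluded n x -> excluded m y -> False.
Proof.
have [k] := ubnP (n + m)%N; elim: k n m x y => // k IH n m x y lek xy1 ex ey.
wlog lemn : n m x y lek xy1 ex ey / (m <= n)%N.
  move=> W; case/orP: (leq_total m n) => h; first exact: (W n m x y).
  by apply: (W m n y x) => //; rewrite 1?addnC // mulrC.
have [P hP [sP Px]] := ex; have [P' hP' [sP' P'y]] := ey.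
case: n => [|n] in lek ex sP lemn *.
  move: Px; rewrite (size1_polyC sP) hornerC => P0.
  by have := hP 0%N; rewrite P0 coef1 => /(ph_fun hG)/eqP; rewrite oner_eq0.
pose e i := P'`_0 * P`_i - P`_n.+1 * P'`_(n.+1 - i).
apply: (IH n m x y) => //; exists (\poly_(i < n.+1) e i).
  move=> i; rewrite coef_poly coef1; case: ltnP => [lin|]; last first.
    by case: i => // i _; exact: ph0.
  have -> : (i == 0%N)%:R = 1 * (i == 0%N)%:R - 0 * (n.+1 - i == 0)%N%:R :> C.
    by rewrite mul1r mul0r subr0.
  apply: ph_sub => //; apply: ph_mul => //.
  - by have := hP' 0%N; rewrite coef1.
  - by have := hP i; rewrite coef1.
  - by have := hP n.+1; rewrite coef1.
  - by have := hP' (n.+1 - i)%N; rewrite coef1.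
split; first exact: size_poly.
have en : e n.+1 = 0 by rewrite /e subnn mulrC subrr.
have -> : (\poly_(i < n.+1) e i).[x] = \sum_(i < n.+2) e i * x ^+ i.
  by rewrite horner_poly [RHS]big_ord_recr /= en mul0r addr0.
rewrite /e; under eq_bigr do rewrite mulrBl -!mulrA.
rewrite sumrB -!mulr_sumr -(horner_coef_wide x sP) Px mulr0 sub0r.
have -> : \sum_(i < n.+2) P'`_(n.+1 - i) * x ^+ i = x ^+ n.+1 * P'.[y];
  last by rewrite P'y mulr0 mulr0 oppr0.
rewrite (@horner_coef_wide _ n.+2 P' y); last exact: leq_trans sP' _.
rewrite mulr_sumr (reindex_inj rev_ord_inj) /=; apply: eq_bigr => i _.
rewrite subSS subKn -1?ltnS // mulrCA; congr (_ * _).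
have -> : x ^+ n.+1 = x ^+ (n.+1 - i) * x ^+ i by rewrite -exprD subnK // -ltnS.
by rewrite -mulrA -exprMn xy1 expr1n mulr1.
Qed.

(** The extension of [G] to the ring generated by [y], with [y] sent to [c]. Being only a relation,
    it can be written down before it is known to be single-valued. *)
Definition adjoin y c x a :=
  exists P Q, [/\ ph_poly P Q, x = P.[y] & a = Q.[c]].

Lemma adjoin_ext y c x a : G x a -> adjoin y c x a.
Proof.
move=> xa; exists x%:P, a%:P; split; rewrite ?hornerC //; exact: ph_polyC.
Qed.

Lemma adjoin_gen y c : adjoin y c y c.
Proof. by exists 'X, 'X; split; rewrite ?hornerX //; exact: ph_polyX. Qed.

Lemma adjoin_hom y c :
  (forall P Q, ph_poly P Q -> P.[y] = 0 -> Q.[c] = 0) ->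
  partial_hom (adjoin y c).
Proof.
move=> h; split.
- by move=> a; apply/adjoin_ext/(ph_const hG).
- move=> x a x' a' [P [Q [hP -> ->]]] [P' [Q' [hP' -> ->]]].
  by exists (P - P'), (Q - Q'); rewrite !hornerE; split=> //; apply: ph_polyB.
- move=> x a x' a' [P [Q [hP -> ->]]] [P' [Q' [hP' -> ->]]].
  by exists (P * P'), (Q * Q'); rewrite !hornerE; split=> //; apply: ph_polyM.
- by move=> a [P [Q [hP e ->]]]; apply: (h P).
Qed.

Hypothesis Gmax : forall G', partial_hom G' ->
  (forall x a, G x a -> G' x a) -> forall x a, G' x a -> G x a.

Lemma maximal_adjoin y c :
  G y c \/ exists P Q, [/\ ph_poly P Q, P.[y] = 0 & Q.[c] != 0].
Proof.
have [[P [Q h]]|h] :=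
    pselect (exists P Q, [/\ ph_poly P Q, P.[y] = 0 & Q.[c] != 0]).
  by right; exists P, Q.
left; apply: (Gmax _ (@adjoin_ext y c)); last exact: adjoin_gen.
apply: adjoin_hom => P Q hP Py; have [//|Qc] := eqVneq Q.[c] 0.
by case: h; exists P, Q.
Qed.

(** The equations of [y] reduce to an ideal [J] of C[X]. As [y] has no value, [J] has no common
    zero; since C is algebraically closed, Euclidean division then descends to a nonzero constant in
    [J]. *)
Lemma maximal_excluded y : (forall c, ~ G y c) -> exists n, excluded n y.
Proof.
move=> hy; pose J Q := exists2 P, ph_poly P Q & P.[y] = 0.
have JB Q Q' R : J Q -> J Q' -> J (Q - R * Q').
  move=> [P h e] [P' h' e']; exists (P - map_poly j R * P').
    exact/ph_polyB/ph_polyM/h'/ph_poly_const.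
  by rewrite !hornerE e e' mulr0 subr0.
have J0 : J 0 by exists 0; rewrite ?horner0 // => i; rewrite !coef0; exact: ph0.
have nJ c : exists2 Q, J Q & Q.[c] != 0.
  have [/hy//|[P [Q [h e e']]]] := maximal_adjoin y c.
  by exists Q => //; exists P.
suff [Q JQ s1] : exists2 Q, J Q & size Q = 1%N.
  have Q0 : Q`_0 != 0.
    by have := s1 => /(congr1 predn) /= <-;
      rewrite -/(lead_coef Q) lead_coef_eq0 -size_poly_eq0 s1.
  have [P hP e] : J 1.
    have := JB 0 Q (- (Q`_0)^-1%:P) J0 JQ.
    by rewrite {2}(size1_polyC (eq_leq s1)) mulNr opprK add0r -polyCM mulVf.
  by exists (size P); exists P.
have [Q0 JQ0 Q00] := nJ 0.
have {Q00} : Q0 != 0 by apply: contraNneq Q00 => ->; rewrite horner0.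
have [n] := ubnP (size Q0); elim: n Q0 JQ0 => // n IH Q JQ leQ Q0.
have [s1|s1] := eqVneq (size Q) 1%N; first by exists Q.
have [c /rootP rc] := closed_rootP _ s1.
have [Q' JQ' Q'c] := nJ c.
apply: (IH (Q' %% Q)).
- by have := JB Q' Q (Q' %/ Q) JQ' JQ; rewrite {1}(divp_eq Q' Q) addrAC subrr add0r.
- by rewrite (leq_trans (ltn_modpN0 Q' Q0)).
- apply: contraNneq Q'c => e; rewrite (divp_eq Q' Q) e addr0 hornerM rc mulr0 //.
Qed.

(** The domain of a maximal [G] is a valuation ring: an element without value satisfies an equation
    reducing to 1 = 0, its inverse cannot do so too, and hence the inverse has a value. *)
Lemma maximal_place : exists2 phi, is_place phi & forall x a, G x a ->
    phi x = Some a.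
Proof.
pose phi x := if pselect (exists a, G x a) is left h then Some (projT1 (cid h))
  else None.
have phiP x a : G x a <-> phi x = Some a.
  rewrite /phi; split => [xa|].
    case: pselect => [h|[]]; last by exists a.
    by case: (cid h) => b /= xb; rewrite (ph_uniq xa xb).
  by case: pselect => // h; case: (cid h) => b /= xb [<-].
have phiN x : phi x = None -> forall a, ~ G x a.
  by rewrite /phi; case: pselect => // h _ a xa; apply: h; exists a.
exists phi; last by move=> x a /phiP.
split=> [c|x y a b /phiP xa /phiP yb|x /phiN nx].
- exact/phiP/(ph_const hG).
- by split; apply/phiP; [exact: ph_add|exact: ph_mul].
have x0 : x != 0 by apply/eqP => x0; apply: (nx 0); rewrite x0; exact: ph0.
split=> //; apply/phiP.
have [n ex] := maximal_excluded nx.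
have [[a ya]|ny] := pselect (exists a, G x^-1 a); last first.
  have [m ey] : exists m, excluded m x^-1.
    by apply: maximal_excluded => c yc; apply: ny; exists c.
  by case: (excluded_not_both _ ex ey); rewrite divff.
have [<- //|a0] := eqVneq a 0.
(* If [a] is nonzero, try to give [x] the value [a^-1]. An obstruction [P], reversed, is an equation
   of [x^-1], so its reduction vanishes at [a], and [Q] vanishes at [a^-1] after all. *)
have [/nx//|[P [Q [hP Px]]]] := maximal_adjoin x a^-1.
set d := maxn (size P) (size Q).
have eP : \sum_(i < d) P`_i * x^-1 ^+ (d - i) = 0.
  transitivity (P.[x] * x^-1 ^+ d); last by rewrite Px mul0r.
  rewrite (@horner_coef_wide _ d P x) ?leq_maxl // mulr_suml.
  apply: eq_bigr => i _.
  have -> : x^-1 ^+ d = x^-1 ^+ i * x^-1 ^+ (d - i).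
    by rewrite -exprD subnKC // ltnW.
  by rewrite -mulrA (mulrA (x ^+ i)) -exprMn divff // expr1n mul1r.
have : G 0 (\sum_(i < d) Q`_i * a ^+ (d - i)).
  rewrite -eP; apply: ph_sum => i; apply: ph_mul => //.
  by elim: (d - i)%N => [|k IH]; [exact: ph1|rewrite !exprS; apply: ph_mul].
move=> /(ph_fun hG) eQ; case/eqP.
apply/(mulIf (expf_neq0 d a0)); rewrite mul0r -[RHS]eQ.
rewrite (@horner_coef_wide _ d Q) ?leq_maxr // mulr_suml.
apply: eq_bigr => i _.
have -> : a ^+ d = a ^+ i * a ^+ (d - i) by rewrite -exprD subnKC // ltnW.
by rewrite -mulrA (mulrA (_ ^+ i)) -exprMn mulVf // expr1n mul1r.
Qed.

End OnePartialHom.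

Lemma place_extension (G0 : K -> C -> Prop) : partial_hom G0 ->
  exists2 phi, is_place phi & forall x a, G0 x a -> phi x = Some a.
Proof.
move=> hG0.
pose T := {G : K -> C -> Prop |
            partial_hom G /\ forall x a, G0 x a -> G x a}.
pose R (s t : T) := `[< forall x a, sval s x a -> sval t x a >].
have t0 : T by exists G0.
have [t|r s t /asboolP rs /asboolP st|A totA|[G [hG hG0G]] maxG] :=
    @classical_sets.ZL_preorder T t0 R.
- exact/asboolP.
- by apply/asboolP => x a /rs /st.
- have [[s As]|nA] := pselect (exists s, A s); last first.
    by exists t0 => s As; case: nA; exists s.
  pose U x a := exists2 s, A s & sval s x a.
  have U2 x a y b : U x a -> U y b -> exists2 s, A s & sval s x a /\ sval s y b.
    move=> [s1 A1 h1] [s2 A2 h2].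
    have [/asboolP h|/asboolP h] := totA _ _ A1 A2.
      by exists s2 => //; split=> //; exact: h.
    by exists s1 => //; split=> //; exact: h.
  have hU : partial_hom U.
    split=> [c|x a y b xa yb|x a y b xa yb|a [[G' [hG' ?]] /= _]].
    - by exists s => //; exact: ph_const (proj1 (svalP s)) c.
    - have [s' As' [??]] := U2 _ _ _ _ xa yb; exists s' => //.
      exact: ph_sub (proj1 (svalP s')) _ _ _ _ _ _.
    - have [s' As' [??]] := U2 _ _ _ _ xa yb; exists s' => //.
      exact: ph_mul (proj1 (svalP s')) _ _ _ _ _ _.
    - exact: ph_fun hG' _.
  have hGU x a : G0 x a -> U x a.
    by move=> xa; exists s => //; exact: (proj2 (svalP s)).
  exists (exist _ U (conj hU hGU)) => s' As'; apply/asboolP => x a /= xa.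
  by exists s'.
have [G' hG' GG'|phi hphi Gphi] := maximal_place hG.
  have hG0' x a : G0 x a -> G' x a by move=> /hG0G /GG'.
  have /asboolP h := maxG (exist _ G' (conj hG' hG0'))
    (introT (asboolP _) GG').
  exact: h.
by exists phi => // x a /hG0G /Gphi.
Qed.

(** The kernel condition says that [h] factors through the image of [f], from which Zorn's lemma
    extends it. The places of C(t,z,x) used below all arise in this way. *)
Lemma place_of_hom (A : nzRingType) (f : {rmorphism A -> K})
    (h : {rmorphism A -> C}) (i : C -> A) :
  (forall c, f (i c) = j c) -> (forall c, h (i c) = c) ->
  (forall a, f a = 0 -> h a = 0) ->
  exists2 phi, is_place phi & forall a, phi (f a) = Some (h a).
Proof.
move=> fi hi fh.
have hG : partial_hom (fun x c => exists2 a, x = f a & c = h a).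
  split=> [c|_ _ _ _ [a -> ->] [b -> ->]|_ _ _ _ [a -> ->] [b -> ->]|_ [a e ->]].
  - by exists (i c).
  - by exists (a - b); rewrite rmorphB.
  - by exists (a * b); rewrite rmorphM.
  - exact: fh.
have [phi hphi e] := place_extension hG.
by exists phi => // a; apply: e; exists a.
Qed.

Section PlaceTheory.
Variables (phi : K -> option C) (hphi : is_place phi).

Lemma placeC c : phi (j c) = Some c.
Proof. by case: hphi. Qed.

Lemma placeD x y a b :
  phi x = Some a -> phi y = Some b -> phi (x + y) = Some (a + b).
Proof. by case: hphi => _ h _ xa yb; case: (h _ _ _ _ xa yb). Qed.

Lemma placeM x y a b :
  phi x = Some a -> phi y = Some b -> phi (x * y) = Some (a * b).
Proof. by case: hphi => _ h _ xa yb; case: (h _ _ _ _ xa yb). Qed.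

Lemma placeN x : phi x = None -> x != 0 /\ phi x^-1 = Some 0.
Proof. by case: hphi => _ _; apply. Qed.

Lemma placeV x a : phi x = Some a -> a != 0 -> phi x^-1 = Some a^-1.
Proof.
move=> xa a0; have p1 : phi 1 = Some 1 by rewrite -(rmorph1 j) placeC.
have x0 : x != 0.
  apply: contraNneq a0 => x0; move: xa.
  by rewrite x0 -(rmorph0 j) placeC => -[->].
case e : (phi x^-1) => [b|].
  have := placeM xa e; rewrite divff // p1 => -[ab].
  by congr Some; apply: (mulfI a0); rewrite divff.
have [_] := placeN e; rewrite invrK xa => -[a0'].
by rewrite a0' eqxx in a0.
Qed.

Lemma place_mmap k (v : 'I_k -> K) (a : 'I_k -> C) (H : {mpoly C[k]}) :
  (forall i, phi (v i) = Some (a i)) -> phi (mmap j v H) = Some H.@[a].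
Proof.
move=> va; elim/mpoly_gen_ind: H => [c|i|p q IHp IHq|p q IHp IHq].
- by rewrite mmapC mevalC placeC.
- by rewrite mmap_XU mevalXU.
- by rewrite rmorphD mevalD; apply: placeD.
- by rewrite rmorphM mevalM; apply: placeM.
Qed.

(** Any two nonzero elements compare, since their quotient or its inverse has a finite value; a
    maximum of a finite list for this order dominates the list. *)
Lemma place_largest (s : seq K) : has (fun x => x != 0) s ->
  exists2 y, (y \in s) && (y != 0) &
    forall x, x \in s -> exists a, phi (x / y) = Some a.
Proof.
have p0 : phi 0 = Some 0 by rewrite -(rmorph0 j) placeC.
have p1 : phi 1 = Some 1 by rewrite -(rmorph1 j) placeC.
elim: s => //= z s IH; have [-> /=|z0 _] := eqVneq z 0.
  move=> /IH[y /andP[ys y0] h]; exists y; rewrite ?inE ?ys ?orbT //.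
  move=> x; rewrite inE => /predU1P[->|/h //].
  by exists 0; rewrite mul0r.
have [/IH[y /andP[ys y0] h]|ns] := boolP (has (fun x => x != 0) s); last first.
  exists z; rewrite ?inE ?eqxx // => x; rewrite inE => /predU1P[->|xs].
    by exists 1; rewrite divff.
  by have /hasPn/(_ _ xs)/negPn/eqP-> := ns; exists 0; rewrite mul0r.
case e : (phi (z / y)) => [a|].
  exists y; rewrite ?inE ?ys ?orbT // => x; rewrite inE => /predU1P[->|/h //].
  by exists a.
have [_] := placeN e; rewrite invf_div => yz.
exists z; rewrite ?inE ?eqxx // => x; rewrite inE => /predU1P[->|/h[b xb]].
  by exists 1; rewrite divff.
by exists (b * 0); rewrite -(placeM xb yz) mulrA divfK.
Qed.

End PlaceTheory.
End Places.

(** * Expansions to first order *)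

Section Jets.
Local Open Scope ring_scope.
Variable F : numFieldType.

(** A two-term expansion at 0, stated on values. [E] collects the poles: at its zeros the division
    is conventional, and nothing is claimed. *)
Definition jet (g : F -> F) (a b : F) : Prop :=
  exists E H : {poly F}, E.[0] != 0 /\
    forall t, E.[t] != 0 -> g t = a + b * t + t ^+ 2 * (H.[t] / E.[t]).

Lemma jet_const a : jet (fun=> a) a 0.
Proof.
exists 1, 0; split=> [|t _]; first by rewrite hornerC oner_neq0.
by rewrite horner0 !mul0r mulr0 !addr0.
Qed.

Lemma jet_add g a b g' a' b' : jet g a b -> jet g' a' b' ->
  jet (fun t => g t + g' t) (a + a') (b + b').
Proof.
move=> [E [H [E0 h]]] [E' [H' [E'0 h']]]; exists (E * E'), (H * E' + H' * E).
split=> [|t]; first by rewrite hornerM mulf_neq0.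
rewrite !(hornerD, hornerN, hornerM, hornerZ, hornerC, hornerX, hornerXn)
  mulf_eq0 negb_or => /andP[Et E't]; rewrite h // h' //.
by field; rewrite ?Et ?E't.
Qed.

Lemma jet_mul g a b g' a' b' : jet g a b -> jet g' a' b' ->
  jet (fun t => g t * g' t) (a * a') (a * b' + a' * b).
Proof.
move=> [E [H [E0 h]]] [E' [H' [E'0 h']]]; exists (E * E').
exists ((b * b')%:P * E * E' + (a%:P + b *: 'X) * H' * E + (a'%:P + b' *:
  'X) * H * E'
        + 'X ^+ 2 * H * H').
split=> [|t]; first by rewrite hornerM mulf_neq0.
rewrite !(hornerD, hornerN, hornerM, hornerZ, hornerC, hornerX, hornerXn)
  mulf_eq0 negb_or => /andP[Et E't]; rewrite h // h' //.
by field; rewrite ?Et ?E't.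
Qed.

Lemma poly_root0 (p : {poly F}) : p.[0] = 0 -> exists q, p = 'X * q.
Proof.
by move=> /eqP /factor_theorem[q ->]; exists q; rewrite subr0 mulrC.
Qed.

Lemma jet_frac (P E : {poly F}) : E.[0] != 0 ->
  exists b, jet (fun t => P.[t] / E.[t]) (P.[0] / E.[0]) b.
Proof.
move=> E0; set a := P.[0] / E.[0].
have [|Q eQ] := @poly_root0 (P - a *: E); first by rewrite !(hornerD, hornerN,
  hornerM, hornerZ, hornerC, hornerX, hornerXn) /a divfK // subrr.
exists (Q.[0] / E.[0]); set b := Q.[0] / E.[0].
have [|H eH] := @poly_root0 (Q - b *: E); first by rewrite !(hornerD, hornerN,
  hornerM, hornerZ, hornerC, hornerX, hornerXn) /b divfK // subrr.
exists E, H; split=> // t Et.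
have -> : P.[t] = a * E.[t] + t * (b * E.[t] + t * H.[t]).
  move: eQ eH => /eqP; rewrite subr_eq => /eqP -> /eqP; rewrite subr_eq => /eqP ->.
  by rewrite !(hornerD, hornerN, hornerM, hornerZ, hornerC, hornerX, hornerXn);
    ring.
by field.
Qed.

(** Clearing [E] turns the two descriptions of [g] into a polynomial identity, true wherever [E] and
    [B] are nonzero, hence everywhere. Its terms of degrees 0 and 1 give a = 0 and b = f. *)
Lemma jet_linear g a b (B : {poly F}) f : jet g a b -> B != 0 ->
  (forall t, B.[t] != 0 -> g t = t * f) -> b = f.
Proof.
move=> [E [H [E0 h]]] B0 hf.
have nzE : E != 0 by apply: contraNneq E0 => ->; rewrite horner0.
pose Q := (f *: 'X - a%:P - b *: 'X) * E - 'X ^+ 2 * H.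
have Q0 : Q = 0.
  apply/eqP/negPn/negP => Q0.
  have [t] := poly_eval_neq0 (mulf_neq0 (mulf_neq0 Q0 nzE) B0).
  rewrite !hornerM !mulf_eq0 !negb_or -andbA => /and3P[+ Et Bt].
  have := hf t Bt; rewrite h // /Q !(hornerD, hornerN, hornerM, hornerZ,
    hornerC, hornerX, hornerXn) => e.
  suff -> : (f * t - a - b * t) * E.[t] - t ^+ 2 * H.[t] = 0 by rewrite eqxx.
  have -> : f * t = a + b * t + t ^+ 2 * (H.[t] / E.[t]) by rewrite e mulrC.
  by field.
have a0 : a = 0.
  have e : Q.[0] = - (a * E.[0]).
    by rewrite /Q !(hornerD, hornerN, hornerM, hornerZ, hornerC, hornerX); ring.
  move: e; rewrite Q0 horner0 => /esym/eqP.
  by rewrite oppr_eq0 mulf_eq0 (negPf E0) orbF => /eqP.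
have : (f - b)%:P * E - 'X * H = 0.
  have X0 : ('X : {poly F}) != 0 by rewrite polyX_eq0.
  apply: (mulfI X0); rewrite mulr0 -Q0 /Q a0 polyC0 subr0 -scalerBl -mul_polyC.
  by ring.
move=> /(congr1 (horner^~ 0)); rewrite !(hornerD, hornerN, hornerM, hornerZ,
  hornerC, hornerX, hornerXn) mul0r subr0 => /eqP.
by rewrite mulf_eq0 (negPf E0) orbF subr_eq0 => /eqP.
Qed.

(** The chain rule. The gradient [D] is fixed by [om] and [v] before the curves [tau] are chosen, so
    the same linear form serves every line through the point; the final dimension count rests on
    this order of quantifiers. *)
Lemma jet_mmap s (om : {mpoly rat[s]}) (v : 'I_s -> F) :
  exists (a : F) (D : 'I_s -> F), forall (tau : 'I_s -> F -> F) b,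
    (forall j, jet (tau j) (v j) (b j)) ->
    jet (fun t => mmap ratr (fun j => tau j t) om) a (\sum_j D j * b j).
Proof.
elim/mpoly_gen_ind: om => [x|i|p q [a [D hp]] [a' [D' hq]]|p q [a [D hp]]
  [a' [D' hq]]].
- exists (ratr x), (fun=> 0) => tau b _; rewrite big1 => [|j _];
  last by rewrite mul0r.
  by rewrite (_ : (fun t => _) = fun=> ratr x);
    [exact: jet_const|apply/funext => t; rewrite mmapC].
- exists (v i), (fun j => (j == i)%:R) => tau b hb.
  rewrite (bigD1 i) //= eqxx mul1r big1 ?addr0 => [|j /negPf->];
    last by rewrite mul0r.
  by rewrite (_ : (fun t => _) = tau i) //; apply/funext => t; rewrite mmap_XU.
- exists (a + a'), (fun j => D j + D' j) => tau b hb.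
  have -> : \sum_j (D j + D' j) * b j = \sum_j D j * b j + \sum_j D' j * b j.
    by rewrite -big_split /=; apply: eq_bigr => j _; rewrite mulrDl.
  rewrite (_ : (fun t => _) = fun t => mmap ratr (fun j => tau j t) p + mmap
    ratr (fun j => tau j t) q).
    by apply: jet_add; [exact: hp|exact: hq].
  by apply/funext => t; rewrite rmorphD.
- exists (a * a'), (fun j => a * D' j + a' * D j) => tau b hb.
  have -> : \sum_j (a * D' j + a' * D j) * b j =
    a * (\sum_j D' j * b j) + a' * \sum_j D j * b j.
    rewrite !mulr_sumr -big_split /=; apply: eq_bigr => j _.
    by rewrite mulrDl !mulrA.
  rewrite (_ : (fun t => _) = fun t => mmap ratr (fun j => tau j t) p * mmap
    ratr (fun j => tau j t) q).
    by apply: jet_mul; [exact: hp|exact: hq].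
  by apply/funext => t; rewrite rmorphM.
Qed.

End Jets.

(** * Restriction to a hyperplane and to the lines across it *)

Section Reduction.
Local Open Scope ring_scope.
Variables (F : numFieldType) (N : nat) (i0 : 'I_N).

Definition set_at (w : 'I_N -> F) (t : F) : 'I_N -> F :=
    fun k => if k == i0 then t else w k.

Definition cut0 (p : {mpoly F[N]}) : {mpoly F[N]} :=
  mmap (@mpolyC N F) (fun k => if k == i0 then 0 else 'X_k) p.

Lemma cut0_eval p w : (cut0 p).@[w] = p.@[set_at w 0].
Proof.
rewrite /cut0 (rmorph_mmap _ (meval w)) [RHS]/meval.
apply: eq_mmap => [a|k]; first by rewrite /= mevalC.
by rewrite /= /set_at; case: eqP => _; rewrite ?meval0 ?mevalXU.
Qed.

Lemma cut0_div p : exists q, p = cut0 p + 'X_i0 * q.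
Proof.
elim/mpoly_gen_ind: p => [c|i|p q [p' ep] [q' eq]|p q [p' ep] [q' eq]].
- by exists 0; rewrite mulr0 addr0 /cut0 mmapC.
- rewrite /cut0 mmap_XU; case: eqP => [->|_]; first by exists 1;
  rewrite mulr1 add0r.
  by exists 0; rewrite mulr0 addr0.
- by exists (p' + q'); rewrite {1}ep {1}eq /cut0 rmorphD /=; ring.
- exists (cut0 p * q' + cut0 q * p' + 'X_i0 * p' * q').
  by rewrite {1}ep {1}eq /cut0 rmorphM /=; ring.
Qed.

Definition line (w : 'I_N -> F) (p : {mpoly F[N]}) : {poly F} :=
  mmap (@polyC F) (fun k => if k == i0 then 'X else (w k)%:P) p.

Lemma line_eval w p t : (line w p).[t] = p.@[set_at w t].
Proof.
rewrite -/(horner_eval t _) /line (rmorph_mmap _ (horner_eval t)) [RHS]/meval.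
apply: eq_mmap => [a|k]; first by rewrite /= /horner_eval hornerC.
by rewrite /= /horner_eval /set_at; case: eqP; rewrite ?hornerX ?hornerC.
Qed.

(** Factors ['X_i0] are cancelled until numerator and denominator no longer both vanish on the
    hyperplane; the size of [q] drops each time. *)
Lemma reduce_fraction (p q : {mpoly F[N]}) : q != 0 ->
  exists p' q' : {mpoly F[N]}, [/\ q' != 0, p * q' = p' * q &
    exists w, (p'.@[set_at w 0] != 0) || (q'.@[set_at w 0] != 0)].
Proof.
move: p q; suff H k (p q : {mpoly F[N]}) : (msize q < k)%N -> q != 0 ->
  exists p' q' : {mpoly F[N]}, [/\ q' != 0, p * q' = p' * q &
    exists w, (p'.@[set_at w 0] != 0) || (q'.@[set_at w 0] != 0)].
  by move=> p q; apply: H (ltnSn _).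
elim: k p q => [|k IH] p q sq q0; first by rewrite ltn0 in sq.
have [[w h]|nw] := pselect (exists w, (p.@[set_at w 0] != 0) || (q.@[set_at w 0]
  != 0)).
  by exists p, q; split=> //; exists w.
have div0 s : (forall w, s.@[set_at w 0] = 0) -> exists s', s = 'X_i0 * s'.
  move=> s0; have [s' es] := cut0_div s; exists s'; rewrite {1}es.
  suff -> : cut0 s = 0 by rewrite add0r.
  by apply: mpoly_eval_eq => w; rewrite cut0_eval s0 meval0.
have [w|p1 ep] := div0 p.
  by apply/eqP/negPn/negP => h; apply: nw; exists w; rewrite h.
have [w|q1 eq] := div0 q.
  by apply/eqP/negPn/negP => h; apply: nw; exists w; rewrite h orbT.
have q10 : q1 != 0 by apply: contraNneq q0 => e; rewrite eq e mulr0.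
have X0 : 'X_i0 != 0 :> {mpoly F[N]} by rewrite -msupp_eq0 msuppX.
have sq1 : (msize q1 < k)%N.
  by move: sq; rewrite eq msizeM // msizeX mdeg1.
have [p' [q' [q'0 e ex]]] := IH p1 q1 sq1 q10.
by exists p', q'; split=> //; rewrite ep eq -mulrA e mulrCA.
Qed.

End Reduction.

(** * Definable sets are constructible *)

Section Constructible.
Local Open Scope ring_scope.
Variable R : realType.
Local Notation C := R[i].

Fixpoint ring_term (t : term) : GRing.term C :=
  match t with
  | TVar i => GRing.Var _ i
  | TZero => GRing.Const 0
  | TOne => GRing.Const 1
  | TAdd a b => GRing.Add (ring_term a) (ring_term b)
  | TMul a b => GRing.Mul (ring_term a) (ring_term b)
  end.

(** [S] and [P] become equations, as they are on the database of arithmetic, so that quantifier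
    elimination over algebraically closed fields applies. *)
Fixpoint ring_formula (f : formula) : GRing.formula C :=
  match f with
  | FEq a b => GRing.Equal (ring_term a) (ring_term b)
  | FS a b c => GRing.Equal (ring_term c) (GRing.Add (ring_term a) (ring_term b))
  | FP a b c => GRing.Equal (ring_term c) (GRing.Mul (ring_term a) (ring_term b))
  | FNot g => GRing.Not (ring_formula g)
  | FAnd g h => GRing.And (ring_formula g) (ring_formula h)
  | FOr g h => GRing.Or (ring_formula g) (ring_formula h)
  | FImp g h => GRing.Implies (ring_formula g) (ring_formula h)
  | FEx i g => GRing.Exists i (ring_formula g)
  | FAll i g => GRing.Forall i (ring_formula g)
  end.

Lemma rterm_ring_term t : GRing.rterm (ring_term t).
Proof. by elim: t => //= a -> b ->. Qed.

Lemma rformula_ring_formula f : GRing.rformula (ring_formula f).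
Proof.
by elim: f => //= [a b|a b c|a b c|g -> h ->|g -> h ->|g -> h ->] //;
  rewrite !rterm_ring_term.
Qed.

Lemma eval_ring_term (s : seq C) e t :
  (forall i, e i = s`_i) -> GRing.eval s (ring_term t) = term_val e t.
Proof. by move=> es; elim: t => //= a -> b ->. Qed.

Lemma holds_ring_formula (s : seq C) e f : (forall i, e i = s`_i) ->
  GRing.holds s (ring_formula f) <-> sat (arith_database R) e f.
Proof.
elim: f s e => /= [a b|a b c|a b c|g IH|g IHg h IHh|g IHg h IHh|g IHg h IHh|i g
  IH|i g IH] s e es;
  rewrite ?(eval_ring_term _ es) //.
- by rewrite (IH s e es).
- by rewrite (IHg s e es) (IHh s e es).
- by rewrite (IHg s e es) (IHh s e es).
- by rewrite (IHg s e es) (IHh s e es).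
- have H v : GRing.holds (set_nth 0 s i v) (ring_formula g) <->
             sat (arith_database R) (update e i v) g.
    by apply: IH => k; rewrite nth_set_nth /= /update es.
  by split=> -[v /H hv]; exists v.
- have H v : GRing.holds (set_nth 0 s i v) (ring_formula g) <->
             sat (arith_database R) (update e i v) g.
    by apply: IH => k; rewrite nth_set_nth /= /update es.
  by split=> hv v; apply/H.
Qed.

Section Cells.
Variable N : nat.

Fixpoint term_poly (t : GRing.term C) : {mpoly C[N]} :=
  match t with
  | GRing.Var i => if insub i is Some k then 'X_k else 0
  | GRing.Const c => c%:MP
  | GRing.NatConst n => n%:R
  | GRing.Add a b => term_poly a + term_poly b
  | GRing.Opp a => - term_poly a
  | GRing.NatMul a n => term_poly a *+ n
  | GRing.Mul a b => term_poly a * term_poly b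
  | GRing.Exp a n => term_poly a ^+ n
  | GRing.Inv _ => 0
  end.

Lemma term_polyE (w : 'rV[C]_N) t : GRing.rterm t ->
  (term_poly t).@[w ord0] = GRing.eval (mkseq (env w) N) t.
Proof.
elim: t => //= [i|c|n|a IHa b IHb|a IH|a IH n|a IHa b IHb|a IH n] h.
- rewrite /env; have [k ik ki|ni] := insubP.
    by rewrite mevalXU nth_mkseq // -ki valK.
  by rewrite meval0 nth_default // size_mkseq leqNgt.
- by rewrite mevalC.
- by rewrite rmorph_nat.
- by case/andP: h => ra rb; rewrite mevalD IHa ?IHb.
- by rewrite mevalN IH.
- by rewrite mevalMn IH.
- by case/andP: h => ra rb; rewrite mevalM IHa ?IHb.
- by rewrite rmorphXn /= IH.
Qed.

(** A cell has a single inequation, so those of a conjunction are multiplied together. *)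
Definition dnf_cell (bc : seq (GRing.term C) * seq (GRing.term C)) : cell R N :=
  (map term_poly bc.1, \prod_(t <- bc.2) term_poly t).

Lemma in_dnf_cells (w : 'rV[C]_N) bcs : all (@GRing.dnf_rterm _) bcs ->
  has ((@in_cell R N)^~ w) (map dnf_cell bcs) =
  GRing.qf_eval (mkseq (env w) N) (GRing.dnf_to_form bcs).
Proof.
elim: bcs => //= -[b c] bcs IH /andP[/andP[/= rb rc] /IH->]; congr orb.
rewrite /in_cell /=; congr andb.
  elim: b rb => //= t b IHb /andP[rt /IHb->]; rewrite term_polyE //.
elim: c rc => /= [|t c IHc] rc; first by rewrite big_nil meval1 oner_neq0.
by case/andP: rc => rt /IHc <-; rewrite big_cons mevalM mulf_eq0 negb_or term_polyE.
Qed.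

Lemma defined_set_constructible f :
  constructible (@defined_set R N (arith_database R) f).
Proof.
have closedC := @solve_monicpoly C.
have wf := @ClosedFieldQE.wf_ex_elim C.
have ok := ClosedFieldQE.holds_ex_elim closedC.
set g := GRing.quantifier_elim (@ClosedFieldQE.ex_elim C) (ring_formula f).
have rf := rformula_ring_formula f.
have /andP[qg rg] := GRing.quantifier_elim_wf wf rf.
exists (map dnf_cell (GRing.qf_to_dnf g false)) => w.
rewrite in_dnf_cells; last exact: GRing.qf_to_dnf_rterm.
rewrite GRing.qf_to_dnfP ?qg //.
rewrite /defined_set -(@holds_ring_formula (mkseq (env w) N)); last first.
  move=> i; rewrite /env; have [k ik ki|ni] := insubP.
    by rewrite nth_mkseq // -ki valK.
  by rewrite nth_default // size_mkseq leqNgt.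
exact: (rwP (GRing.quantifier_elim_rformP wf ok _ rf)).
Qed.

(** By the basis theorem finitely many equations suffice, and a closed set is one cell. *)
Lemma zclosure_constructible (X : 'rV[C]_N -> Prop) : constructible (zclosure X).
Proof.
pose I (p : {mpoly C[N]}) := forall v, X v -> p.@[v ord0] = 0.
have [p q r hp hq v Xv|ps [psI psP]] := @hilbert_basis C N I.
  by rewrite mevalB mevalM hp // hq // mulr0 subr0.
exists [:: (ps, 1)] => w; rewrite /= orbF /in_cell meval1 oner_neq0 andbT.
split=> [h|/allP h p pX].
  by apply/allP => p /psI pI; apply/eqP/h.
by apply: psP => // q /h /eqP.
Qed.

End Cells.
End Constructible.

(** * Arithmetic circuits *)

Section GateValues.
Local Open Scope ring_scope.
Variables (n s : nat).
Implicit Types (gs : seq (gate n s)) (o : operand n s) (c : circuit n s).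

Section OneRing.
Variables (A : unitRingType) (cst : rat -> A) (x : 'I_n -> A) (t : 'I_s -> A).

Definition vals gs := gate_vals cst x t (Circuit gs (OConst 0)).

Lemma gate_valsE c : gate_vals cst x t c = vals (gates c).
Proof. by []. Qed.

Lemma vals_rcons gs g : vals (rcons gs g) =
    rcons (vals gs) (gate_val cst x t (vals gs) g).
Proof. by rewrite /vals /gate_vals /= -cats1 foldl_cat. Qed.

Lemma size_vals gs : size (vals gs) = size gs.
Proof. by elim/last_ind: gs => // gs g IH; rewrite vals_rcons !size_rcons IH. Qed.

Lemma vals_cat gs1 gs2 : take (size gs1) (vals (gs1 ++ gs2)) = vals gs1.
Proof.
elim/last_ind: gs2 => [|gs2 g IH]; first by rewrite cats0 -size_vals take_size.
rewrite -rcons_cat vals_rcons -cats1 takel_cat //.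
by rewrite size_vals size_cat leq_addr.
Qed.

Lemma nth_vals gs k : (k < size gs)%N ->
  nth 0 (vals gs) k = gate_val cst x t (take k (vals gs)) (nth (gate0 n s) gs k).
Proof.
move=> kgs; have e : gs = rcons (take k gs) (nth (gate0 n s) gs k) ++ drop k.+1 gs.
  by rewrite -take_nth // cat_take_drop.
have sk : size (take k gs) = k by rewrite size_takel // ltnW.
have tk j : (j <= size gs)%N -> take j (vals gs) = vals (take j gs).
  by move=> jg; rewrite -{1}(cat_take_drop j gs) -{1}(size_takel jg) vals_cat.
rewrite tk ?(ltnW kgs) // -(@nth_take k.+1 _ 0) // tk // (take_nth (gate0 n s)) //.
by rewrite vals_rcons nth_rcons size_vals sk ltnn eqxx.
Qed.

Lemma operand_val_take vs k o :
  operand_before k o -> operand_val cst x t (take k vs) o =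
    operand_val cst x t vs o.
Proof. by case: o => //= i ik; rewrite nth_take. Qed.

Lemma operand_val_cat gs1 gs2 o : operand_before (size gs1) o ->
  operand_val cst x t (vals (gs1 ++ gs2)) o = operand_val cst x t (vals gs1) o.
Proof. by move=> ho; rewrite -(vals_cat gs1 gs2) operand_val_take. Qed.

End OneRing.

Lemma operand_beforeW k m o : (k <= m)%N -> operand_before k o ->
    operand_before m o.
Proof. by case: o => //= i km ik; exact: leq_trans km. Qed.

Lemma well_formed_all c : well_formed c ->
  all (fun g => operand_before (circuit_size c) (gate_l g)
             && operand_before (circuit_size c) (gate_r g)) (gates c).
Proof.
move=> [wf _]; apply/(all_nthP (gate0 n s)) => k kc.
by have [hl hr] := wf k kc; apply/andP; split; apply: operand_beforeW (ltnW kc) _.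
Qed.

Section Naturality.
Variables (A B : unitRingType) (h : {rmorphism A -> B}).
Variables (cst : rat -> A) (x : 'I_n -> A) (t : 'I_s -> A).
Variables (cst' : rat -> B) (x' : 'I_n -> B) (t' : 'I_s -> B).
Hypotheses (h_cst : forall q, h (cst q) = cst' q).
Hypotheses (h_x : forall i, h (x i) = x' i) (h_t : forall j, h (t j) = t' j).

Lemma operand_val_nat vs o :
  h (operand_val cst x t vs o) = operand_val cst' x' t' (map h vs) o.
Proof.
case: o => //= k; have [kv|kv] := ltnP k (size vs); first by rewrite (nth_map 0).
by rewrite !nth_default ?size_map ?rmorph0.
Qed.

(** A morphism commutes with the inverses of units; at other elements the inverse is a convention,
    whence the condition on divisors. *)
Lemma gate_val_nat vs g :
  (is_div g -> operand_val cst x t vs (gate_r g) \is a GRing.unit) ->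
  h (gate_val cst x t vs g) = gate_val cst' x' t' (map h vs) g.
Proof.
rewrite /gate_val /is_div -!operand_val_nat.
case: (gate_op g) => hu.
- exact: rmorphD.
- exact: rmorphB.
- exact: rmorphM.
- by rewrite rmorphM rmorphV ?hu.
Qed.

Lemma vals_nat gs :
  (forall k, (k < size gs)%N -> is_div (nth (gate0 n s) gs k) ->
     operand_val cst x t (take k (vals cst x t gs)) (gate_r (nth (gate0 n s) gs k))
       \is a GRing.unit) ->
  map h (vals cst x t gs) = vals cst' x' t' gs.
Proof.
move=> hdiv.
suff H k : (k <= size gs)%N ->
    map h (take k (vals cst x t gs)) = take k (vals cst' x' t' gs).
  have := H _ (leqnn _).
  by rewrite !take_oversize ?size_vals.
elim: k => [|k IH] kgs; first by rewrite !take0.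
rewrite !(take_nth 0) ?size_vals // map_rcons IH ?(ltnW kgs) //.
congr rcons; rewrite !nth_vals // gate_val_nat; last exact: hdiv.
by rewrite IH // ltnW.
Qed.

Lemma division_free_nat c o : division_free c ->
  h (operand_val cst x t (gate_vals cst x t c) o) =
  operand_val cst' x' t' (gate_vals cst' x' t' c) o.
Proof.
move=> df; rewrite !gate_valsE operand_val_nat vals_nat // => k kc dk.
move/(all_nthP (gate0 n s))/(_ k kc): df; by rewrite dk.
Qed.

End Naturality.
End GateValues.

Section PolyCircuits.
Local Open Scope ring_scope.
Variable F : numFieldType.

Definition pvals n s (t : 'I_s -> F) (gs : seq (gate n s)) : seq {mpoly F[n]} :=
  vals (fun q => (ratr q)%:MP) (fun i => 'X_i) (fun j => (t j)%:MP) gs.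

Definition pval n s (t : 'I_s -> F) (gs : seq (gate n s)) o : {mpoly F[n]} :=
  operand_val (fun q => (ratr q)%:MP) (fun i => 'X_i) (fun j => (t j)%:MP)
    (pvals t gs) o.

Lemma circuit_polyE n s (t : 'I_s -> F) c : circuit_poly t c =
    pval t (gates c) (output c) :> {mpoly F[n]}.
Proof. by []. Qed.

Definition good_gates n s (gs : seq (gate n s)) :=
  (forall k, (k < size gs)%N ->
     operand_before k (gate_l (nth (gate0 n s) gs k)) /\
     operand_before k (gate_r (nth (gate0 n s) gs k)))
  /\ all (fun g => ~~ is_div g) gs.

Lemma good_gates_rcons n s (gs : seq (gate n s)) g : good_gates gs ->
  operand_before (size gs) (gate_l g) -> operand_before (size gs) (gate_r g) ->
  ~~ is_div g -> good_gates (rcons gs g).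
Proof.
move=> [wf df] hl hr dg; split; last by rewrite all_rcons dg.
move=> k; rewrite size_rcons ltnS leq_eqVlt nth_rcons => /predU1P[->|kg].
  by rewrite ltnn eqxx.
by rewrite kg; apply: wf.
Qed.

Lemma pval_rcons n s (t : 'I_s -> F) (gs : seq (gate n s)) g :
  pval t (rcons gs g) (OGate _ _ (size gs)) =
  gate_val (fun q => (ratr q)%:MP) (fun i => 'X_i) (fun j => (t j)%:MP)
    (pvals t gs) g.
Proof. by rewrite /pval /= /pvals vals_rcons nth_rcons size_vals ltnn eqxx. Qed.

Lemma pval_cat n s (t : 'I_s -> F) (gs gs' : seq (gate n s)) o :
  operand_before (size gs) o -> pval t (gs ++ gs') o = pval t gs o.
Proof. exact: operand_val_cat. Qed.

(** Quantifying over the gates [gs] already present lets circuits be concatenated without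
    renumbering. The new gates are chosen before [t], so one circuit serves all values of the
    scalars. *)
Definition computable n s (P : ('I_s -> F) -> {mpoly F[n]}) :=
  forall gs, good_gates gs -> exists gs' o,
    [/\ good_gates (gs ++ gs'), operand_before (size (gs ++ gs')) o
      & forall t, pval t (gs ++ gs') o = P t].

Section Computable.
Variables n s : nat.
Implicit Types P Q : ('I_s -> F) -> {mpoly F[n]}.

Lemma computable_leaf P o : operand_before 0 o ->
  (forall t gs, pval t gs o = P t) -> computable P.
Proof.
move=> ho hP gs hgs; exists [::], o; rewrite cats0; split=> //.
exact: operand_beforeW ho.
Qed.


Lemma computableD P Q : computable P -> computable Q ->
    computable (fun t => P t + Q t).
Proof.
move=> hP hQ gs hgs; have [g1 [o1 [h1 ho1 e1]]] := hP gs hgs.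
have [g2 [o2 [h2 ho2 e2]]] := hQ _ h1.
pose g := Gate AAdd o1 o2.
have ho1' : operand_before (size ((gs ++ g1) ++ g2)) o1.
  by apply: operand_beforeW ho1; rewrite (size_cat (gs ++ g1)) leq_addr.
exists (rcons (g1 ++ g2) g), (OGate _ _ (size ((gs ++ g1) ++ g2))).
rewrite -rcons_cat catA; split; first exact: good_gates_rcons.
  by rewrite /= size_rcons.
by move=> t; rewrite pval_rcons -e1 -e2 -(pval_cat t g2 ho1).
Qed.

Lemma computableM P Q : computable P -> computable Q ->
    computable (fun t => P t * Q t).
Proof.
move=> hP hQ gs hgs; have [g1 [o1 [h1 ho1 e1]]] := hP gs hgs.
have [g2 [o2 [h2 ho2 e2]]] := hQ _ h1.
pose g := Gate AMul o1 o2.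
have ho1' : operand_before (size ((gs ++ g1) ++ g2)) o1.
  by apply: operand_beforeW ho1; rewrite (size_cat (gs ++ g1)) leq_addr.
exists (rcons (g1 ++ g2) g), (OGate _ _ (size ((gs ++ g1) ++ g2))).
rewrite -rcons_cat catA; split; first exact: good_gates_rcons.
  by rewrite /= size_rcons.
by move=> t; rewrite pval_rcons -e1 -e2 -(pval_cat t g2 ho1).
Qed.

Lemma computable_dense (mon : 'I_s -> 'X_{1..n}) :
  computable (fun t => \sum_j t j *: 'X_[mon j]).
Proof.
have c1 : @computable n s (fun=> 1).
  by apply: (@computable_leaf _ (OConst 1)) => // t gs; rewrite /pval /= rmorph1.
have -> : (fun t : 'I_s -> F => \sum_j t j *: 'X_[mon j] : {mpoly F[n]}) =
          (fun t => \sum_j (t j)%:MP * 'X_[mon j]).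
  by apply/funext => t; apply: eq_bigr => j _; rewrite mul_mpolyC.
elim: (index_enum _) => [|j r IH].
  have -> : (fun t : 'I_s -> F => \sum_(j <- [::]) (t j)%:MP * 'X_[mon j]
    : {mpoly F[n]}) = fun=> 0.
    by apply/funext => t; rewrite big_nil.
  by apply: (@computable_leaf _ (OConst 0)) => // t gs; rewrite /pval /= rmorph0.
have -> : (fun t : 'I_s -> F => \sum_(k <- j :: r) (t k)%:MP * 'X_[mon k]
  : {mpoly F[n]}) =
  fun t => (t j)%:MP * 'X_[mon j] + \sum_(k <- r) (t k)%:MP * 'X_[mon k].
  by apply/funext => t; rewrite big_cons.
apply: computableD => //; apply: computableM.
  exact: (@computable_leaf _ (OScal _ j)).
rewrite mpolyXE_id; elim: (index_enum _) => [|i r' IHr]; first by rewrite big_nil.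
rewrite big_cons; apply: (@computableM (fun=> _) (fun=> _)) => //.
elim: (mon j i) => [|k IHk]; first by rewrite expr0.
rewrite exprS; apply: (@computableM (fun=> _) (fun=> _)) => //.
exact: (@computable_leaf _ (OVar _ i)).
Qed.

Lemma dense_circuit (mon : 'I_s -> 'X_{1..n}) : exists c : circuit n s,
  [/\ well_formed c, division_free c
    & forall t : 'I_s -> F, circuit_poly t c = \sum_j t j *: 'X_[mon j]].
Proof.
have [|gs [o [[wf df] ho e]]] := @computable_dense mon [::]; first by [].
by exists (Circuit gs o).
Qed.

End Computable.

Definition scalars_of n s (o : operand n s) : seq 'I_s :=
  if o is OScal j then [:: j] else [::].

(** The number [s] of declared scalars is not bounded by the size, so the occurrences in operands
    are counted instead. *)
Definition used_scalars n s (c : circuit n s) : seq 'I_s :=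
  scalars_of (output c) ++
  flatten [seq scalars_of (gate_l g) ++ scalars_of (gate_r g) | g <- gates c].

Lemma size_used_scalars n s (c : circuit n s) :
  (size (used_scalars c) <= (circuit_size c).*2.+1)%N.
Proof.
have h o : (size (@scalars_of n s o) <= 1)%N by case: o.
rewrite /used_scalars size_cat -addn1 addnC leq_add // /circuit_size.
elim: (gates c) => //= g gs IH; rewrite size_cat size_cat doubleS -addn2 addnC.
by apply: leq_add => //; rewrite -[2%N]/(1 + 1)%N leq_add.
Qed.

Lemma eq_circuit_poly n s (t t' : 'I_s -> F) (c : circuit n s) :
  {in used_scalars c, t =1 t'} -> circuit_poly t c = circuit_poly t' c.
Proof.
have hop vs o : {in scalars_of o, t =1 t'} ->
    operand_val (fun q => (ratr q)%:MP) (fun i => 'X_i) (fun j => (t j)%:MP) vs o =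
    operand_val (fun q => (ratr q)%:MP) (fun i => 'X_i) (fun j => (t' j)%:MP) vs o
    :> {mpoly F[n]}.
  by case: o => //= j ->; rewrite ?mem_head.
case: c => gs o /= htt; rewrite !circuit_polyE /= /pval.
have -> : pvals t gs = pvals t' gs.
  have : {in flatten [seq scalars_of (gate_l g) ++ scalars_of (gate_r g) | g <-
    gs], t =1 t'}.
    by move=> j hj; apply: htt; rewrite /used_scalars mem_cat hj orbT.
  elim/last_ind: gs {htt} => // gs g IH htt.
  rewrite /pvals !vals_rcons -!/(pvals _ _) IH; last first.
    by move=> j hj; apply: htt; rewrite map_rcons flatten_rcons mem_cat hj.
  by rewrite /gate_val !hop // => j hj; apply: htt;
     rewrite map_rcons flatten_rcons !mem_cat hj ?orbT.
by apply: hop => j hj; apply: htt; rewrite mem_cat hj.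
Qed.

End PolyCircuits.

(** * Closure properties and elements of the class of bounded complexity *)

Section Complexity.
Local Open Scope ring_scope.
Variable R : realType.
Local Notation C := R[i].

Lemma W_intro L n s (c : circuit n s) (t : 'I_s -> C) :
  well_formed c -> division_free c -> (nonscalar_size t c <= L)%N ->
  W L (circuit_poly t c).
Proof.
move=> wf df cL; pose att k := `[< exists s (c' : circuit n s) (t' : 'I_s -> C),
  [/\ well_formed c', division_free c', circuit_poly t' c' = circuit_poly t c
    & nonscalar_size t' c' = k] >].
have ex : exists k, att k.
  by exists (nonscalar_size t c); apply/asboolP; exists s, c, t.
have [l /asboolP hl lmin] := ex_minnP ex.
exists l; last by apply: leq_trans cL; apply: lmin; apply/asboolP; exists s, c, t.
by split=> // k hk; apply: lmin; apply/asboolP.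
Qed.

Lemma W_elim L n (f : {mpoly C[n]}) : W L f ->
  exists s (c : circuit n s) (t : 'I_s -> C),
    [/\ well_formed c, division_free c, circuit_poly t c = f
      & (nonscalar_size t c <= L)%N].
Proof.
by case=> l [[s [c [t [wf df e el]]]] _] lL; exists s, c, t; rewrite el.
Qed.

Lemma W0 L n : W L (0 : {mpoly C[n]}).
Proof.
pose c : circuit n 0 := Circuit [::] (OConst 0).
have -> : 0 = circuit_poly (fun=> 0 : C) c by rewrite circuit_polyE /pval /=
  rmorph0.
exact: W_intro.
Qed.

Lemma eq_count_all T (b p q : pred T) gs :
  all b gs -> (forall g, b g -> p g = q g) -> count p gs = count q gs.
Proof. by move=> + h; elim: gs => //= g gs IH /andP[/h-> /IH->]. Qed.

Section Rename.
Variables n s : nat.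

Definition rename_operand (o : operand n s) : operand n s.+1 :=
  match o with
  | OVar i => OVar _ i
  | OScal j => OScal _ (lift ord_max j)
  | OConst q => OConst q
  | OGate k => OGate _ _ k
  end.

Definition rename_gate (g : gate n s) : gate n s.+1 :=
  Gate (gate_op g) (rename_operand (gate_l g)) (rename_operand (gate_r g)).

Variables (t : 'I_s -> C) (t' : 'I_s.+1 -> C).
Hypothesis tt' : forall j, t' (lift ord_max j) = t j.

Lemma rename_operand_val (vs : seq {mpoly C[n]}) o :
  operand_val (fun q => (ratr q)%:MP) (fun i => 'X_i) (fun j => (t' j)%:MP) vs
    (rename_operand o)
  = operand_val (fun q => (ratr q)%:MP) (fun i => 'X_i) (fun j => (t j)%:MP) vs o.
Proof. by case: o => //= j; rewrite tt'. Qed.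

Lemma rename_vals gs : pvals t' (map rename_gate gs) = pvals t gs.
Proof.
elim/last_ind: gs => // gs g IH; rewrite map_rcons /pvals !vals_rcons
  -!/(pvals _ _) IH.
by congr rcons; rewrite /gate_val /= !rename_operand_val.
Qed.

Lemma rename_before k o : operand_before k (rename_operand o) = operand_before k o.
Proof. by case: o. Qed.

End Rename.

(** One more gate multiplies by a new scalar. This factor involves no variable, so the gate is free
    in the non-scalar size. *)
Lemma W_scale L n (f : {mpoly C[n]}) a : W L f -> W L (a *: f).
Proof.
move=> /W_elim [s [[gs o] [t [[wf ho] df e cL]]]].
pose t' (j : 'I_s.+1) := if unlift ord_max j is Some i then t i else a.
have tt' j : t' (lift ord_max j) = t j by rewrite /t' liftK.
pose gs' := map (@rename_gate n s) gs.
pose g := Gate AMul (OScal n ord_max) (rename_operand o).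
have szg : size gs' = size gs by rewrite size_map.
have good : good_gates (rcons gs' g).
  apply: good_gates_rcons => //; last by rewrite /= rename_before szg.
  split; last by rewrite all_map.
  move=> k; rewrite szg => kg; rewrite (nth_map (gate0 n s)) //= !rename_before.
  exact: wf.
pose c := Circuit (rcons gs' g) (OGate n s.+1 (size gs')).
have ec : circuit_poly t' c = a *: f.
  rewrite circuit_polyE pval_rcons /gate_val /= (rename_vals tt').
  by rewrite (rename_operand_val tt') -mul_mpolyC /t' unlift_none -e.
rewrite -ec; apply: W_intro.
- by case: good => wf' df'; split=> //=; rewrite /circuit_size size_rcons.
- by case: good.
apply: leq_trans cL; rewrite /nonscalar_size /= -cats1 count_cat /= addn0.
rewrite [X in (_ + X)%N](_ : _ = 0%N) ?addn0; last first.
  by rewrite /involves_vars /poly_of_operand /= msizeC; case: (_ != 0).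
have inv (b : operand n s) : operand_before (size gs) b ->
    involves_vars t' c (rename_operand b) = involves_vars t (Circuit gs o) b.
  move=> hb1; rewrite /involves_vars; congr (_ < msize _)%N.
  transitivity (pval t' (rcons gs' g) (rename_operand b)) => //.
  rewrite -cats1 pval_cat ?szg ?rename_before // /pval (rename_vals tt').
  exact: rename_operand_val.
rewrite count_map; have :=
  well_formed_all (conj wf ho : well_formed (Circuit gs o)).
rewrite /circuit_size /= => hall; apply/eq_leq/(eq_count_all hall) =>
  h /andP[hl hr].
by rewrite /is_mul /= !inv.
Qed.

(** A chain of partial products. Gate [k] multiplies by 1 when [k] is not in [S], so that the
    positions of the gates do not depend on [S]. *)
Definition monomial_gate n (S : {set 'I_n}) (k : 'I_n) : gate n 0 :=
  Gate AMul (if k == 0 :> nat then OConst 1 else OGate n 0 k.-1)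
    (if k \in S then OVar 0 k else OConst 1).

Lemma W_mesym1 L n (S : {set 'I_n}) : (n <= L)%N ->
    W L ('X_[mesym1 S] : {mpoly C[n]}).
Proof.
move=> nL; case: n S nL => [|n] S nL.
  (* Without variables the chain has no last gate to read, and the monomial is 1. *)
  pose c : circuit 0 0 := Circuit [::] (OConst 1).
  have -> : 'X_[mesym1 S] = circuit_poly (fun=> 0 : C) c.
    rewrite circuit_polyE /pval /= !rmorph1 -mpolyX0; congr 'X_[_].
    by apply/mnmP => -[].
  exact: W_intro.
pose gs := [seq monomial_gate S k | k <- enum 'I_n.+1].
have sgs : size gs = n.+1 by rewrite size_map size_enum_ord.
have nthg (k : 'I_n.+1) : nth (gate0 _ _) gs k = monomial_gate S k.
  by rewrite (nth_map ord0) ?size_enum_ord // nth_ord_enum.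
pose c := Circuit gs (OGate n.+1 0 n).
have wf : well_formed c.
  split; last by rewrite /= /circuit_size sgs.
  rewrite /circuit_size /= sgs => k kn; rewrite (nthg (Ordinal kn)) /=.
  split; first by case: k kn => [|k] /= _ //; exact: ltnSn.
  by case: ifP.
have -> : 'X_[mesym1 S] = circuit_poly (fun=> 0 : C) c.
  rewrite circuit_polyE /pval /=.
  pose t (_ : 'I_0) : C := 0.
  pose E (k : 'I_n.+1) : {mpoly C[n.+1]} := if k \in S then 'X_k else 1.
  have step (k : 'I_n.+1) : nth 0 (pvals t gs) k =
      (if k == 0 :> nat then 1 else nth 0 (pvals t gs) k.-1) *
      E k.
    rewrite /pvals nth_vals ?sgs // nthg /gate_val /=.
    congr (_ * _); last by rewrite /E; case: ifP => //= _; rewrite rmorph1.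
    case: eqP => /= [|/eqP]; first by rewrite rmorph1.
    by rewrite -lt0n => k0; rewrite nth_take // prednK.
  suff H k : (k < n.+1)%N -> nth 0 (pvals t gs) k = \prod_(i < k.+1) E (inord i).
    rewrite H // mpolyXE_id; apply: eq_bigr => i _; rewrite inord_val /E mnmE.
    by case: (i \in S); rewrite ?expr1 ?expr0.
  elim: k => [|k IH] kn.
    rewrite (step ord0) /= mul1r big_ord1; congr E.
    by apply: val_inj; rewrite /= inordK.
  rewrite (step (Ordinal kn)) /= IH 1?ltnW // [RHS]big_ord_recr /=.
  by congr (_ * E _); apply: val_inj; rewrite /= inordK.
apply: W_intro => //.
  by rewrite /division_free /= all_map; apply/allP.
apply: leq_trans nL; apply: leq_trans (count_size _ _) _; rewrite /= sgs //.
Qed.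

End Complexity.

(** * The translation of circuits into formulas *)

Section CircuitFormula.
Local Open Scope ring_scope.
Variable R : realType.
Local Notation C := R[i].
Local Notation D := (arith_database R).

Lemma env_ord N (w : 'rV[C]_N) (j : 'I_N) : env w j = w ord0 j.
Proof. by rewrite /env valK. Qed.

Section Point.
Variables (s n : nat) (z : 'rV[C]_s) (x : 'rV[C]_n) (y : C).

Lemma point_param (j : 'I_s) : point z x y ord0 (lshift 1 (lshift n j)) = z ord0 j.
Proof. by rewrite /point !row_mxEl. Qed.

Lemma point_var (i : 'I_n) : point z x y ord0 (lshift 1 (rshift s i)) = x ord0 i.
Proof. by rewrite /point row_mxEl row_mxEr. Qed.

Lemma point_val : point z x y ord0 (rshift (s + n) ord0) = y.
Proof. by rewrite /point row_mxEr mxE eqxx. Qed.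

Lemma env_param (j : 'I_s) : env (point z x y) j = z ord0 j.
Proof. by rewrite -point_param -env_ord. Qed.

Lemma env_var (i : 'I_n) : env (point z x y) (s + i)%N = x ord0 i.
Proof. by rewrite -point_var -env_ord. Qed.

Lemma env_val : env (point z x y) (s + n)%N = y.
Proof. by rewrite -[RHS]point_val -env_ord /= addn0. Qed.

End Point.

Lemma point_surj s n (w : 'rV[C]_(s + n + 1)) : exists z x y, w = point z x y.
Proof.
exists (lsubmx (lsubmx w)), (rsubmx (lsubmx w)), (rsubmx w ord0 ord0).
by rewrite /point hsubmxK -mx11_scalar hsubmxK.
Qed.

Lemma sat_exists b ks body e :
  sat D e (foldr (fun k f => FEx (b + k) f) body ks) <->
  exists2 e', (forall i, (forall k, k \in ks -> i <> (b + k)%N) -> e' i = e i)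
    & sat D e' body.
Proof.
elim: ks e => [|k ks IH] e /=.
  split=> [h|[e' ee' h]]; first by exists e.
  by rewrite (_ : e = e') //; apply/funext => i; rewrite ee'.
split=> [[v /IH[e' he' h]]|[e' he' h]].
  exists e' => // i hi; rewrite he'; last first.
    by move=> k' kk'; apply: hi; rewrite inE kk' orbT.
  by rewrite /update; case: eqP => // ik; case: (hi k) => //; rewrite mem_head.
exists (e' (b + k)%N); apply/IH; exists e' => // i hi; rewrite /update.
case: eqP => [-> //|ik]; apply: he' => k'; rewrite inE => /predU1P[->|] //.
exact: hi.
Qed.

Lemma sat_conjunction (G : nat -> formula) body ks e :
  sat D e (foldr (fun k f => FAnd (G k) f) body ks) <->
  (forall k, k \in ks -> sat D e (G k)) /\ sat D e body.
Proof.
elim: ks => [|k ks IH] /=; first by split=> [h|[]].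
split=> [[hk /IH[hks hb]]|[h hb]].
  by split=> // k'; rewrite inE => /predU1P[->|/hks].
split; first by apply: h; rewrite mem_head.
by apply/IH; split=> // k' hk'; apply: h; rewrite inE hk' orbT.
Qed.

Section Plain.
Variables (n s : nat) (c : circuit n s).
Hypotheses (wf : well_formed c) (pl : plain c).

Lemma plain_division_free : division_free c.
Proof.
move: pl => /andP[_ hall]; apply: sub_all hall => g /and3P[_ _].
by rewrite /is_div; case: (gate_op g).
Qed.

Lemma plain_gate k : (k < circuit_size c)%N ->
  let g := nth (gate0 n s) (gates c) k in
  [&& plain_operand (gate_l g), plain_operand (gate_r g) &
      if gate_op g is (AAdd | AMul) then true else false].
Proof. by move: pl => /andP[_ /(all_nthP (gate0 n s))]; apply. Qed.

Variables (z : 'rV[C]_s) (x : 'rV[C]_n) (y : C).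

Definition point_vals : seq C := vals ratr (x ord0) (z ord0) (gates c).

Lemma circuit_poly_meval :
  (circuit_poly (z ord0) c).@[x ord0] = operand_val ratr (x ord0) (z ord0)
    point_vals (output c).
Proof.
rewrite /circuit_poly /poly_of_operand.
apply: division_free_nat plain_division_free => [q|i|j].
- exact: mevalC.
- exact: mevalXU.
- exact: mevalC.
Qed.

Lemma operand_term_val e k o :
  (forall i, (i < s + n + 1)%N -> e i = env (point z x y) i) ->
  (forall i, (i < k)%N -> e (s + n + 1 + i)%N = nth 0 point_vals i) ->
  operand_before k o -> plain_operand o ->
  term_val e (operand_term o) = operand_val ratr (x ord0) (z ord0) point_vals o.
Proof.
move=> he hv; case: o => [i|j|q|i] //= ho _; last exact: hv.
- by rewrite he ?env_var // -addnA ltn_add2l (leq_trans (ltn_ord i)) // leq_addr.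
- by rewrite he ?env_param // (leq_trans (ltn_ord j)) // -addnA leq_addr.
Qed.

Lemma sat_gate e k : (k < circuit_size c)%N ->
  (forall i, (i < s + n + 1)%N -> e i = env (point z x y) i) ->
  (forall i, (i < k)%N -> e (s + n + 1 + i)%N = nth 0 point_vals i) ->
  sat D e (gate_formula k (nth (gate0 n s) (gates c) k)) <->
  e (s + n + 1 + k)%N = nth 0 point_vals k.
Proof.
move=> kc he hv; have [hl hr] := wf.1 k kc; have /and3P[pgl pgr pop] :=
  plain_gate kc.
rewrite /point_vals nth_vals // -/point_vals /gate_formula /gate_val.
rewrite !operand_val_take //.
case: (gate_op _) pop => //= _; by rewrite !(operand_term_val he hv).
Qed.

(** The gate equations determine the quantified variables one after the other, so the only possible
    witnesses are the gate values. *)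
Lemma sat_circuit_formula :
  defined_set D (circuit_formula c) (point z x y) <->
  y = (circuit_poly (z ord0) c).@[x ord0].
Proof.
rewrite circuit_poly_meval /defined_set /circuit_formula sat_exists.
have ho := wf.2; have /andP[po _] := pl.
split=> [[e he]|ey].
  rewrite sat_conjunction => -[hg hy].
  have he1 i : (i < s + n + 1)%N -> e i = env (point z x y) i.
    by move=> ib; apply: he => k _ ik; move: ib; rewrite ik ltnNge leq_addr.
  have hv k : (k <= circuit_size c)%N ->
      forall i, (i < k)%N -> e (s + n + 1 + i)%N = nth 0 point_vals i.
    elim: k => // k IH kc i; rewrite ltnS leq_eqVlt => /predU1P[->|]; last first.
      exact: (IH (ltnW kc)).
    apply/(sat_gate kc he1 (IH (ltnW kc)))/hg.
    by rewrite mem_iota.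
  move: hy; rewrite /= (operand_term_val he1 (hv _ (leqnn _)) ho po) => <-.
  by rewrite he1 ?env_val // addn1.
pose e i := if (i < s + n + 1)%N then env (point z x y) i
  else if (i - (s + n + 1) < circuit_size c)%N then nth 0 point_vals
    (i - (s + n + 1))
  else env (point z x y) i.
have he1 i : (i < s + n + 1)%N -> e i = env (point z x y) i by rewrite /e => ->.
have hv i : (i < circuit_size c)%N -> e (s + n + 1 + i)%N = nth 0 point_vals i.
  by move=> ic; rewrite /e ltnNge leq_addr /= addKn ic.
exists e => [i hi|].
  rewrite /e; case: ltnP => // bi; case: ltnP => // ic.
  by case: (hi (i - (s + n + 1))%N); rewrite ?mem_iota ?subnKC.
apply/sat_conjunction; split=> [k|/=].
  rewrite mem_iota => /andP[_ kc]; apply/sat_gate => //; last exact: hv.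
  by move=> i ik; apply: hv; apply: ltn_trans kc.
by rewrite (operand_term_val he1 hv ho po) he1 ?env_val // addn1.
Qed.

End Plain.
End CircuitFormula.

(** * Coefficients as polynomials in the scalars *)

Section Formal.
Local Open Scope ring_scope.
Variables (F : numFieldType) (n s : nat).

(** The circuit is run once in Q[theta][x] and then specialised. The divisors are nonzero rational
    constants there, hence units, so specialisation commutes with every gate. *)
Lemma circuit_poly_formal (c : circuit n s) (a : 'I_s -> F) :
  well_formed c -> essentially_division_free c ->
  circuit_poly a c = map_mpoly (mmap ratr a) (formal_val c (output c)).
Proof.
move=> wf ed; rewrite /circuit_poly /poly_of_operand /formal_val /circuit_vals
  !gate_valsE.
pose h : {rmorphism {mpoly {mpoly rat[s]}[n]} -> {mpoly F[n]}} :=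
  map_mpoly (mmap ratr a).
have hc q : h ((q%:MP)%:MP) = (ratr q)%:MP by rewrite [LHS]map_mpolyC;
  congr (_%:MP); exact: mmapC.
have hx i : h 'X_i = 'X_i by exact: map_mpolyX.
have ht j : h ('X_j)%:MP = (a j)%:MP by rewrite [LHS]map_mpolyC; congr (_%:MP);
  exact: mmap_XU.
rewrite -[RHS]/(h _) (operand_val_nat hc hx ht) (vals_nat hc hx ht) // => k kc dk.
have [q q0 e] := ed k kc dk.
rewrite operand_val_take; last by case: (wf.1 k kc).
move: e; rewrite /formal_val gate_valsE => ->.
apply/unitrP; exists ((q^-1)%:MP)%:MP.
by rewrite -!mpolyCM mulVf // mulfV.
Qed.

Lemma circuit_poly_coef (c : circuit n s) (a : 'I_s -> F) al :
  well_formed c -> essentially_division_free c ->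
  (circuit_poly a c)@_al = mmap ratr a (formal_val c (output c))@_al.
Proof. by move=> wf ed; rewrite circuit_poly_formal // mcoeff_map_mpoly. Qed.

End Formal.

(** * Coordinates in three blocks *)

Section Tuple3.
Variables (X : Type) (a b d : nat).

Definition mk3 (u : 'I_a -> X) (v : 'I_b -> X) (y : 'I_d -> X)
    (k : 'I_(a + b + d)) : X :=
  match split k with
  | inl k' => match split k' with inl i => u i | inr j => v j end
  | inr l => y l
  end.

Definition ix1 (i : 'I_a) : 'I_(a + b + d) := lshift d (lshift b i).
Definition ix2 (j : 'I_b) : 'I_(a + b + d) := lshift d (rshift a j).
Definition ix3 (l : 'I_d) : 'I_(a + b + d) := rshift (a + b) l.

Lemma mk3_1 u v y i : mk3 u v y (ix1 i) = u i.
Proof. by rewrite /mk3 /ix1 (unsplitK (inl _)) (unsplitK (inl _)). Qed.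
Lemma mk3_2 u v y j : mk3 u v y (ix2 j) = v j.
Proof. by rewrite /mk3 /ix2 (unsplitK (inl _)) (unsplitK (inr _)). Qed.
Lemma mk3_3 u v y l : mk3 u v y (ix3 l) = y l.
Proof. by rewrite /mk3 /ix3 (unsplitK (inr _)). Qed.

Lemma mk3_ind (P : 'I_(a + b + d) -> Prop) :
  (forall i, P (ix1 i)) -> (forall j, P (ix2 j)) -> (forall l, P (ix3 l)) ->
  forall k, P k.
Proof.
move=> P1 P2 P3 k; rewrite -(splitK k); case: split => [k'|l] /=; last exact: P3.
by rewrite -(splitK k'); case: split => [i|j] /=; [exact: P1|exact: P2].
Qed.

End Tuple3.

Lemma mulf_congr (F : fieldType) (x y z : F) :
  (x != 0 -> y = z)%R -> (x * y = x * z)%R.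
Proof. by have [->|x0 ->] := eqVneq x 0%R; rewrite ?mul0r. Qed.

(* By pseudo-division, lead_coef P ^+ k *: S is a multiple of P up to the kernel
   of f. *)
Lemma minimal_zero (A B D : idomainType) (f : {rmorphism A -> B})
    (g : {rmorphism A -> D})
    (th : B) (b : D) (P S : {poly A}) :
  (forall a, f a = 0 -> g a = 0)%R -> (g (lead_coef P) != 0)%R ->
  ((map_poly f P).[th] = 0)%R ->
  (forall Q, (map_poly f Q).[th] = 0 -> (size Q < size P)%N -> map_poly f Q =
    0)%R ->
  ((map_poly f S).[th] = 0)%R -> ((map_poly g P).[b] = 0)%R ->
    ((map_poly g S).[b] = 0)%R.
Proof.
move=> fg gP Pth Pmin Sth Pb.
have P0 : P != 0%R by apply: contraNneq gP => ->; rewrite lead_coef0 rmorph0.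
have := Pdiv.WeakIdomain.divp_eq S P.
set k := Pdiv.IdomainDefs.scalp S P; set u := Pdiv.IdomainDefs.divp S P.
have := Pdiv.CommonIdomain.ltn_modp S P; rewrite P0.
move: (Pdiv.IdomainDefs.modp S P) => v ltv e.
have v0 : map_poly f v = 0%R.
  apply: Pmin ltv; have := congr1 (fun S => (map_poly f S).[th])%R e.
  by rewrite /= map_polyZ rmorphD rmorphM /= !hornerE Sth Pth !mulr0 add0r.
have gv0 : map_poly g v = 0%R.
  apply/polyP => i; rewrite coef_map coef0; apply: fg.
  by rewrite -coef_map v0 coef0.
have := congr1 (fun S => (map_poly g S).[b])%R e.
rewrite /= map_polyZ rmorphD rmorphM /= !hornerE gv0 Pb mulr0 horner0 addr0.
by move=> /eqP; rewrite rmorphXn mulf_eq0 expf_eq0 (negPf gP) andbF => /eqP.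
Qed.

(** * Closures and function fields *)

Section Closures.
Local Open Scope ring_scope.
Variable R : realType.
Local Notation C := R[i].

Lemma zclosure_closed N (X : 'rV[C]_N -> Prop) : zclosed (zclosure X).
Proof. by move=> w hw p hp; apply: hw => v hv; apply: hv. Qed.

Lemma zclosure_sub N (X : 'rV[C]_N -> Prop) w : X w -> zclosure X w.
Proof. by move=> Xw p; apply. Qed.

Lemma meval_comp M N (P : 'I_M -> {mpoly C[N]}) p w :
  (mmap (@mpolyC N C) P p).@[w] = p.@[fun k => (P k).@[w]].
Proof.
rewrite (rmorph_mmap _ (meval w)) [RHS]/meval; apply: eq_mmap => // a.
by rewrite /= mevalC.
Qed.

(** If neither closed set contains the closure of the image, each has an equation that pulls back to
    a nonzero polynomial. The product of the two is nonzero at some [w], whose image lies in neither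
    set. *)
Lemma irreducible_image M N (P : 'I_M -> {mpoly C[N]}) (X : 'rV[C]_M -> Prop) :
  (forall e, X e <-> exists w, forall k, e ord0 k = (P k).@[w]) ->
  irreducible (zclosure X).
Proof.
move=> XP; have Xw w : X (\row_k (P k).@[w]) by apply/XP; exists w => k;
  rewrite mxE.
split; first by exists (\row_k (P k).@[fun=> 0]); exact: zclosure_sub.
move=> Y Z cY cZ YZ.
have H Y' : zclosed Y' -> ~ (forall e, zclosure X e -> Y' e) ->
    exists p : {mpoly C[M]}, (forall v, Y' v -> p.@[v ord0] = 0) /\
      mmap (@mpolyC N C) P p != 0.
  move=> cY' /existsNP[e /not_implyP[Be nY']].
  have /existsNP[p /not_implyP[pY pe]] : ~ zclosure Y' e by move/cY'.
   exists p; split=> //; apply/negP => /eqP p0; apply: pe.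
  apply: Be => v /XP[w vw]; have := congr1 (meval w) p0.
  by rewrite meval0 meval_comp => <-; apply: meval_eq.
have [|/(H _ cY)[p [pY p0]]] := pselect (forall e, zclosure X e -> Y e);
  first by left.
have [|/(H _ cZ)[q [qZ q0]]] := pselect (forall e, zclosure X e -> Z e);
  first by right.
have [w pqw] : exists w, p.@[fun k => (P k).@[w]] * q.@[fun k => (P k).@[w]] != 0.
  have [w hw] := mpoly_eval_neq0 (mulf_neq0 p0 q0); exists w.
  by rewrite -(meval_comp P p) -(meval_comp P q) -mevalM.
move: pqw; rewrite mulf_eq0 negb_or => /andP[/eqP pw /eqP qw].
have ew Q : Q.@[(\row_k (P k).@[w]) ord0] = Q.@[fun k => (P k).@[w]].
  by apply: meval_eq => k; rewrite mxE.
have [/pY|/qZ] := YZ _ (zclosure_sub (Xw w)); by rewrite ew.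
Qed.

Lemma point_mk3 m n (u : 'rV[C]_m) (x : 'rV[C]_n) y k :
  point u x y ord0 k = mk3 (u ord0) (x ord0) (fun=> y) k.
Proof.
elim/mk3_ind: k => [i|i|i]; rewrite ?mk3_1 ?mk3_2 ?mk3_3.
- exact: point_param.
- exact: point_var.
- by rewrite (ord1 i); exact: point_val.
Qed.

End Closures.

(** * Coordinate rings and their pullbacks *)

Section CoordRing.
Local Open Scope ring_scope.
Local Open Scope quotient_scope.
Variable R : realType.
Local Notation C := R[i].
Variables (m : nat) (V : variety R m).

Lemma coord_funD p q : coord_fun V (p + q) = coord_fun V p + coord_fun V q.
Proof. exact: Quotient.pi_add. Qed.

Lemma coord_funN p : coord_fun V (- p) = - coord_fun V p.
Proof. exact: Quotient.pi_opp. Qed.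

Lemma coord_funM p q : coord_fun V (p * q) = coord_fun V p * coord_fun V q.
Proof. exact: Quotient.pi_mul. Qed.

Lemma coord_fun0 : coord_fun V 0 = 0.
Proof. by rewrite /coord_fun piE. Qed.

Lemma coord_fun1 : coord_fun V 1 = 1.
Proof. by rewrite /coord_fun piE. Qed.

Lemma coord_fun_eq p q : coord_fun V p = coord_fun V q <->
  forall v : 'rV[C]_m, V v -> p.@[v ord0] = q.@[v ord0].
Proof.
transitivity (p - q \in vanishing V).
  by rewrite Quotient.idealrBE; split=> [/eqP|/eqP].
split=> [/asboolP h v Vv|h]; first by apply/eqP; rewrite -subr_eq0 -mevalB h.
by apply/asboolP => v Vv; rewrite mevalB h // subrr.
Qed.

Lemma coord_fun_surj (x : coord_ring V) : exists p, x = coord_fun V p.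
Proof. by exists (repr x); rewrite /coord_fun reprK. Qed.

Section Pullback.
Variables (N : nat) (f : {rmorphism {mpoly C[m]} -> {mpoly C[N]}}).
Hypothesis fV : forall p, f p = 0 <-> forall v : 'rV[C]_m, V v -> p.@[v ord0] = 0.
Local Notation K := {fraction {mpoly C[N]}}.
Local Notation tf := (@FracField.tofrac {mpoly C[N]}).

Definition coord_pull (x : coord_ring V) : {mpoly C[N]} := f (repr x).

Lemma coord_pullE p : coord_pull (coord_fun V p) = f p.
Proof.
apply/eqP; rewrite -subr_eq0 -rmorphB; apply/eqP/fV => v Vv.
rewrite mevalB; apply/eqP; rewrite subr_eq0; apply/eqP.
by move: v Vv; apply/coord_fun_eq; rewrite {1}/coord_fun reprK.
Qed.

Lemma coord_pull_zmod : zmod_morphism coord_pull.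
Proof.
move=> x y; have [p ->] := coord_fun_surj x; have [q ->] := coord_fun_surj y.
by rewrite -coord_funN -coord_funD !coord_pullE rmorphB.
Qed.

Lemma coord_pull_monoid : monoid_morphism coord_pull.
Proof.
split=> [|x y]; first by rewrite -coord_fun1 coord_pullE rmorph1.
have [p ->] := coord_fun_surj x; have [q ->] := coord_fun_surj y.
by rewrite -coord_funM !coord_pullE rmorphM.
Qed.

Lemma coord_pull_inj x : coord_pull x = 0 -> x = 0.
Proof.
have [p ->] := coord_fun_surj x; rewrite coord_pullE => /fV p0.
by rewrite -coord_fun0; apply/coord_fun_eq => v Vv; rewrite p0 // meval0.
Qed.

(** By [fV] the kernel of [f] is the ideal of [V], so [f] induces an injection of the coordinate
    ring, which extends to fractions: the inclusion of function fields given by a dominant map. *)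
Lemma function_field_pull : exists io : {rmorphism function_field V -> K},
  forall p q, io (rational_fun V p q) = tf (f p) / tf (f q).
Proof.
pose g1 := GRing.isZmodMorphism.Build (coord_ring V) {mpoly C[N]} _ coord_pull_zmod.
pose g2 := GRing.isMonoidMorphism.Build (coord_ring V) {mpoly C[N]} _
  coord_pull_monoid.
pose g : {rmorphism coord_ring V -> {mpoly C[N]}} := HB.pack coord_pull g1 g2.
pose h : {rmorphism coord_ring V -> K} := tf \o g.
have hinj a : h a = 0 -> a = 0.
  by move=> /eqP; rewrite /h /= tofrac_eq0 => /eqP; exact: coord_pull_inj.
have [io ioE] := frac_lift hinj.
exists io => p q; rewrite /rational_fun rmorphM fmorphV !ioE /h /=.
by rewrite !coord_pullE.
Qed.

End Pullback.
End CoordRing.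

(** * Places of function fields as places over C *)

Section PlacesOfFunctionFields.
Local Open Scope ring_scope.
Variable R : realType.
Local Notation C := R[i].
Variables (m : nat) (V : variety R m).

Lemma const_morphism : exists j : {rmorphism C -> function_field V},
  forall a, j a = rational_fun V a%:MP 1.
Proof.
pose cf (a : C) := coord_fun V a%:MP.
have zm : zmod_morphism cf.
  by move=> a b; rewrite /cf -coord_funN -coord_funD -mpolyCB.
have mm : monoid_morphism cf.
  by split=> [|a b]; rewrite /cf ?coord_fun1 // -coord_funM -mpolyCM.
pose g1 := GRing.isZmodMorphism.Build C (coord_ring V) _ zm.
pose g2 := GRing.isMonoidMorphism.Build C (coord_ring V) _ mm.
pose g : {rmorphism C -> coord_ring V} := HB.pack cf g1 g2.
exists (@FracField.tofrac (coord_ring V) \o g) => a.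
by rewrite /rational_fun coord_fun1 tofrac1 divr1.
Qed.

Lemma place_is_place (j : {rmorphism C -> function_field V}) phi :
  (forall a, j a = rational_fun V a%:MP 1) -> place phi <-> is_place j phi.
Proof.
move=> jE; split=> -[h1 h2 h3]; split=> // a; first by rewrite jE.
by rewrite -jE.
Qed.

End PlacesOfFunctionFields.

(** * Linear relations *)

Section LinearAlgebra.
Local Open Scope ring_scope.

(** A matrix with fewer columns than rows has a nonzero vector in its left kernel. *)
Lemma linear_relation (F : fieldType) (I : finType) (J : eqType) (js : seq J)
    (D : I -> J -> F) : (size js < #|I|)%N ->
  exists lam : I -> F, (exists i, lam i != 0) /\
    {in js, forall j, \sum_i lam i * D i j = 0}.
Proof.
move=> sj.
pose M : 'M[F]_(#|I|, size js) :=
  \matrix_(i, j) D (enum_val i) (tnth (in_tuple js) j).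
have : kermx M != 0.
  rewrite -mxrank_eq0 mxrank_ker subn_eq0 -ltnNge.
  exact: leq_ltn_trans (rank_leq_col M) sj.
move=> /rowV0Pn[v /sub_kermxP vM v0].
exists (fun i => v ord0 (enum_rank i)); split.
  have [k vk] : exists k, v ord0 k != 0.
    apply/existsP; apply: contraNT v0; rewrite negb_exists => /forallP v0.
    by apply/eqP/rowP => k; rewrite mxE; apply/eqP/negPn/v0.
  by exists (enum_val k); rewrite enum_valK.
move=> j /seq_tnthP [l ->].
move/rowP/(_ l): vM; rewrite !mxE => e; rewrite -[RHS]e.
rewrite (reindex enum_rank); last first.
  by exists enum_val => i _; rewrite ?enum_rankK ?enum_valK.
by apply: eq_bigr => i _; rewrite mxE enum_rankK.
Qed.

End LinearAlgebra.

(** * The family of polynomials of bounded complexity *)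

Section Family.
Local Open Scope ring_scope.
Variable R : realType.
Local Notation C := R[i].
Variables (L n r m : nat) (c : circuit n r) (gam : 'I_m -> 'rV[rat]_n).
Hypotheses (df : division_free c)
  (genc : forall f : {mpoly C[n]},
     (exists zeta : 'I_r -> C, circuit_poly zeta c = f) <-> W L f)
  (ident : identification_sequence (coef_closure (@W R L n)) gam).

(** The scalars are kept as indeterminates, so the support lists all monomials that can occur for
    any values of them. *)
Definition generic_poly : {mpoly {mpoly C[r]}[n]} :=
  let cst q := ((ratr q)%:MP)%:MP in
  operand_val cst (fun i => 'X_i) (fun j => ('X_j)%:MP)
    (gate_vals cst (fun i => 'X_i) (fun j => ('X_j)%:MP) c) (output c).

Lemma generic_polyE (z : 'I_r -> C) : circuit_poly z c =
    map_mpoly (meval z) generic_poly.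
Proof.
apply/esym/division_free_nat => // [q|i|j].
- by rewrite [LHS]map_mpolyC; congr (_%:MP); exact: mevalC.
- exact: map_mpolyX.
- by rewrite [LHS]map_mpolyC; congr (_%:MP); exact: mevalXU.
Qed.

Definition ngmon := size (msupp generic_poly).
Definition gmon (i : 'I_ngmon) : 'X_{1..n} :=
    tnth (in_tuple (msupp generic_poly)) i.

Lemma gmon_inj : injective gmon.
Proof.
move=> i j; rewrite /gmon !(tnth_nth 0%MM) /= => /eqP.
by rewrite nth_uniq ?msupp_uniq // => /eqP/val_inj.
Qed.

Definition coef_poly (a : 'I_ngmon -> C) : {mpoly C[n]} :=
    \sum_i a i *: 'X_[gmon i].

Lemma mcoeff_coef_poly a i : (coef_poly a)@_(gmon i) = a i.
Proof.
rewrite /coef_poly raddf_sum (bigD1 i) //= mcoeffZ mcoeffX eqxx mulr1 big1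
  ?addr0 //.
move=> k ki; rewrite mcoeffZ mcoeffX (inj_eq gmon_inj) (negPf ki) mulr0 //.
Qed.

Lemma mcoeff_coef_poly_out a k : (forall i, gmon i != k) -> (coef_poly a)@_k = 0.
Proof.
move=> h; rewrite /coef_poly raddf_sum big1 // => i _.
by rewrite /= mcoeffZ mcoeffX (negPf (h i)) mulr0.
Qed.

Lemma coef_poly_eval a x : (coef_poly a).@[x] = \sum_i a i * ('X_[gmon i]).@[x].
Proof.
by rewrite /coef_poly raddf_sum; apply: eq_bigr => i _; rewrite /= mevalZ.
Qed.

(* The coordinates are t, then the scalars z, then the variables x: W is
   parameterized by the polynomials t f_z, with f_z computed by c. *)
Definition ndim := (1 + r + n)%N.
Local Notation T := {mpoly C[ndim]}.
Definition t_ix : 'I_ndim := ix1 _ _ ord0.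
Definition z_ix (j : 'I_r) : 'I_ndim := ix2 _ _ j.
Definition x_ix (i : 'I_n) : 'I_ndim := ix3 _ _ i.

(* zcoef, gcoef, gparam and pull are sealed, since unification would otherwise
   unfold the arithmetic of polynomials. *)
Fact zcoef_key : {f : 'X_{1..n} -> T |
  forall al, f al = mmap (@mpolyC ndim C) (fun j => 'X_(z_ix j)) generic_poly@_al}.
Proof. by eexists. Qed.

Definition zcoef := sval zcoef_key.

Lemma zcoefE al : zcoef al = mmap (@mpolyC ndim C) (fun j => 'X_(z_ix j))
    generic_poly@_al.
Proof. exact: (svalP zcoef_key). Qed.

Lemma zcoef_eval al w : (zcoef al).@[w] = (circuit_poly (w \o z_ix) c)@_al.
Proof.
rewrite generic_polyE mcoeff_map_mpoly zcoefE (rmorph_mmap _ (meval w)).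
rewrite /meval; apply: eq_mmap => [a|j]; first exact: mevalC.
by rewrite /= mevalXU.
Qed.

Fact gcoef_key : {f : 'I_ngmon -> T | forall i, f i = 'X_t_ix * zcoef (gmon i)}.
Proof. by eexists. Qed.

Definition gcoef := sval gcoef_key.

Lemma gcoefE i : gcoef i = 'X_t_ix * zcoef (gmon i).
Proof. exact: (svalP gcoef_key). Qed.

Definition gcoef_at (w : 'I_ndim -> C) (i : 'I_ngmon) : C := (gcoef i).@[w].

Lemma coef_poly_gcoef_at w : coef_poly (gcoef_at w) =
    w t_ix *: circuit_poly (w \o z_ix) c.
Proof.
apply/mpolyP => k; rewrite mcoeffZ.
have [[i <-]|nk] := pselect (exists i, gmon i = k).
  by rewrite mcoeff_coef_poly /gcoef_at gcoefE mevalM mevalXU zcoef_eval.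
rewrite mcoeff_coef_poly_out; last by move=> i; apply/eqP => ik; apply: nk;
  exists i.
rewrite generic_polyE mcoeff_map_mpoly memN_msupp_eq0 ?raddf0 ?mulr0 //.
by apply/negP => /seq_tnthP [i ki]; apply: nk; exists i; rewrite ki.
Qed.

Lemma W_familyP f : W L f <-> exists w, f = coef_poly (gcoef_at w).
Proof.
split=> [/genc[z <-]|[w ->]].
  exists (mk3 (fun=> 1) z (fun=> 0)); rewrite coef_poly_gcoef_at /t_ix mk3_1
    scale1r.
  rewrite (_ : _ \o z_ix = z) //; apply/funext => j; exact: mk3_2.
by rewrite coef_poly_gcoef_at; apply: W_scale; apply/genc; exists (w \o z_ix).
Qed.

Definition nodemon (l : 'I_m) (i : 'I_ngmon) : C :=
    ('X_[gmon i]).@[ratpoint R (gam l) ord0].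

Fact gparam_key : {f : 'I_m -> T | forall l, f l = \sum_i nodemon l i *: gcoef i}.
Proof. by eexists. Qed.

(** The parameter u_l as a polynomial in t and z: the value of t f_z at gamma_l. *)
Definition gparam := sval gparam_key.

Lemma gparamE l : gparam l = \sum_i nodemon l i *: gcoef i.
Proof. exact: (svalP gparam_key). Qed.

Definition node_values (a : 'I_ngmon -> C) (l : 'I_m) : C :=
    \sum_i nodemon l i * a i.

Lemma node_valuesE a l : node_values a l = (coef_poly a).@[ratpoint R (gam l) ord0].
Proof. by rewrite coef_poly_eval; apply: eq_bigr => i _; rewrite mulrC. Qed.

Lemma gparam_eval w l : (gparam l).@[w] = node_values (gcoef_at w) l.
Proof. by rewrite gparamE raddf_sum; apply: eq_bigr => i _; rewrite /= mevalZ. Qed.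

Local Notation clW := (coef_closure (@W R L n)).

Lemma clW_sub f : W L f -> clW f.
Proof. by move=> Wf k mn H; apply. Qed.

Lemma clW_inj a b : clW (coef_poly a) -> clW (coef_poly b) ->
    node_values a =1 node_values b -> a =1 b.
Proof.
move=> ha hb sab i; rewrite -(mcoeff_coef_poly a) -(mcoeff_coef_poly b);
  congr (_@__).
by apply: ident => // l; rewrite -!node_valuesE.
Qed.

(** [coef_closure] tests arbitrary lists of coefficients. Those outside [gmon] vanish on the whole
    family, so putting 0 for them leaves an equation in the coordinates [a]. *)
Lemma clW_intro a : (forall H : {mpoly C[ngmon]},
    (forall w, H.@[gcoef_at w] = 0) -> H.@[a] = 0) ->
  clW (coef_poly a).
Proof.
move=> ha k mn H hH.
pose v (j : 'I_k) : {mpoly C[ngmon]} := if [pick i | gmon i == mn j] is Some i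
  then 'X_i else 0.
have ev b : (mmap (@mpolyC ngmon C) v H).@[b] = H.@[fun j => (coef_poly b)@_(mn j)].
  rewrite (rmorph_mmap _ (meval b)) /meval; apply: eq_mmap => [x|j];
    first exact: mevalC.
  rewrite /= /v; case: pickP => [i /eqP <-|nj];
    first by rewrite mevalXU mcoeff_coef_poly.
  by rewrite meval0 mcoeff_coef_poly_out // => i; rewrite nj.
rewrite -ev; apply: ha => w; rewrite ev; apply: hH; apply/W_familyP; by exists w.
Qed.

Lemma clW_vanish a (H : {mpoly C[ngmon]}) : clW (coef_poly a) ->
  (forall w, H.@[gcoef_at w] = 0) -> H.@[a] = 0.
Proof.
move=> ca hH; have := ca _ gmon H.
rewrite (@meval_eq _ _ (fun i => (coef_poly a)@_(gmon i)) a);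
  last exact: mcoeff_coef_poly.
apply=> g /W_familyP[w ->]; rewrite -[RHS](hH w); apply: meval_eq => i;
  exact: mcoeff_coef_poly.
Qed.

Section Finiteness.
Variables (K : fieldType) (j : {rmorphism C -> K}) (g : 'I_ngmon -> K).
Hypothesis cone : forall (H : {mpoly C[ngmon]}) lam,
    (forall w, H.@[gcoef_at w] = 0) ->
  mmap j (fun i => lam * g i) H = 0.
Variables (phi : K -> option C) (hphi : is_place j phi).

(** Places respect equations, and by [cone] every multiple of the vector [g] satisfies those of the
    family. [K] and [g] are abstract because two fields are needed: C(t,z,x), and the function field
    of the parameter variety. *)
Lemma place_clW lam a : (forall i, phi (lam * g i) = Some (a i)) ->
    clW (coef_poly a).
Proof.
move=> ha; apply: clW_intro => H hH.
have := place_mmap hphi H ha; rewrite cone // -(rmorph0 j) (placeC hphi).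
by case.
Qed.

Lemma place_sum (b : 'I_ngmon -> C) (a : 'I_ngmon -> C) (g' : 'I_ngmon -> K) :
  (forall i, phi (g' i) = Some (a i)) ->
  phi (\sum_i j (b i) * g' i) = Some (\sum_i b i * a i).
Proof.
move=> ha; elim/big_rec2: _ => [|i x y _ IH]; first by rewrite -(rmorph0 j)
  (placeC hphi).
by apply: (placeD hphi) => //; apply: (placeM hphi); rewrite ?(placeC hphi).
Qed.

(* If some g i had a pole, dividing all of them by a dominant one would give a
   nonzero element of the closed cone clW vanishing at all points gam. *)
Lemma place_finite (u : 'I_m -> C) :
  (forall l, phi (\sum_i j (nodemon l i) * g i) = Some (u l)) ->
  exists a, [/\ forall i, phi (g i) = Some (a i), clW (coef_poly a) &
    forall l, node_values a l = u l].
Proof.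
move=> hu.
have [a ha] : exists a, forall i, phi (g i) = Some (a i); last first.
  exists a; split=> //.
    by apply: (@place_clW 1) => i; rewrite mul1r.
  by move=> l; have := hu l; rewrite (place_sum _ ha) => -[].
have [ha|/existsNP[i0 /contrapT hi0]] := pselect (forall i, phi (g i) <> None).
  have h i : exists a, phi (g i) = Some a.
    by have := ha i; case: (phi (g i)) => // a _; exists a.
  by exists (fun i => projT1 (cid (h i))) => i; case: (cid (h i)).
have [g00 _] := placeN hphi hi0.
have [|y /andP[/mapP[i1 _ ->] g10] dom] :=
  @place_largest _ _ j phi hphi (map g (enum 'I_ngmon)).
  by apply/hasP; exists (g i0); rewrite ?map_f ?mem_enum.
have {}dom i : exists a, phi ((g i1)^-1 * g i) = Some a.
  by rewrite mulrC; apply: dom; rewrite map_f ?mem_enum.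
pose a i := projT1 (cid (dom i)).
have ha i : phi ((g i1)^-1 * g i) = Some (a i) by rewrite /a; case: cid.
(* Otherwise [g i0] would be finite, as the product of [g i1] and a finite quotient. *)
have inf : phi (g i1) = None.
  case e : (phi (g i1)) => [b|] //; have := placeM hphi e (ha i0).
  by rewrite mulrA divff // mul1r hi0.
have [_ inv0] := placeN hphi inf.
have ca := place_clW ha.
have c0 : clW (coef_poly (fun=> 0)).
  by apply: clW_sub; rewrite /coef_poly big1 => [|i _]; rewrite ?scale0r //;
    exact: W0.
have : a i1 = 0.
  apply: (clW_inj ca c0) => l; rewrite /node_values [RHS]big1 => [|i _];
    last by rewrite mulr0.
  have := placeM hphi inv0 (hu l); rewrite mul0r mulr_sumr.
  under eq_bigr do rewrite mulrCA.
  by rewrite (place_sum _ ha) => -[].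
have := ha i1; rewrite mulVf // -(rmorph1 j) (placeC hphi) => -[<-] /eqP.
by rewrite oner_eq0.
Qed.

End Finiteness.

Lemma cone_hom (K : fieldType) (io : {rmorphism T -> K}) (j : {rmorphism C -> K}) :
  (forall a, io a%:MP = j a) ->
  forall (H : {mpoly C[ngmon]}) lam, (forall w, H.@[gcoef_at w] = 0) ->
  mmap j (fun i => lam * io (gcoef i)) H = 0.
Proof.
move=> ioC H lam hH.
have HG : mmap (@mpolyC ndim C) gcoef H = 0.
  apply: mpoly_eval_eq => w; rewrite meval0 (rmorph_mmap _ (meval w)) -[RHS](hH w).
  by rewrite [RHS]/meval; apply: eq_mmap => [a|i]; first exact: mevalC.
(* The coordinate t is scaled by lam, and with it the whole of gcoef. *)
pose v k := if k == t_ix then lam * io 'X_t_ix else io 'X_k.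
have := congr1 (mmap j v) HG; rewrite rmorph0 rmorph_mmap => <-.
apply: eq_mmap => [a|i]; first by rewrite /= mmapC.
transitivity (mmap j v 'X_t_ix * mmap j v (zcoef (gmon i))); last first.
  by rewrite /= gcoefE rmorphM.
rewrite mmap_XU {1}/v eqxx gcoefE rmorphM mulrA; congr (_ * _).
rewrite zcoefE !rmorph_mmap; apply: eq_mmap => [a|k]; first by rewrite /= mmapC ioC.
rewrite /= mmap_XU /v; by case: eqP => // /(congr1 val).
Qed.

Local Notation K := {fraction T}.
Local Notation tf := (@FracField.tofrac T).

Definition cst_frac : {rmorphism C -> K} := tf \o @mpolyC ndim C.

(** Evaluation at [e] kills the kernel of the substitution of [P], so a point of the closure of the
    image is the centre of a place of C(t,z,x). This replaces limits along curves. *)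
Lemma lift_place M (P : 'I_M -> T) (e : 'I_M -> C) :
  (forall p : {mpoly C[M]}, (forall w, p.@[fun i => (P i).@[w]] = 0) -> p.@[e] =
    0) ->
  exists2 phi, is_place cst_frac phi &
    forall p, phi (tf (mmap (@mpolyC _ C) P p)) = Some p.@[e].
Proof.
move=> h; pose f : {rmorphism {mpoly C[M]} -> K} := tf \o mmap (@mpolyC ndim C) P.
have := @place_of_hom _ _ cst_frac _ f (meval e) (@mpolyC M C); apply.
- by move=> a; rewrite /f /cst_frac /= mmapC.
- by move=> a; exact: mevalC.
- move=> p /eqP; rewrite /f /= tofrac_eq0 => /eqP p0; apply: h => w.
  have := congr1 (meval w) p0; rewrite meval0 (rmorph_mmap _ (meval w)) => <-.
  by rewrite {1}/meval; apply: eq_mmap => // a; rewrite /= mevalC.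
Qed.

Lemma tofrac_gparam l : \sum_i cst_frac (nodemon l i) * tf (gcoef i) =
    tf (gparam l).
Proof.
rewrite gparamE rmorph_sum; apply: eq_bigr => i _.
by rewrite -mul_mpolyC [RHS]rmorphM.
Qed.

Lemma place_point phi u : is_place cst_frac phi ->
    (forall l, phi (tf (gparam l)) = Some (u l)) ->
  exists a, [/\ forall i, phi (tf (gcoef i)) = Some (a i), clW (coef_poly a) &
    forall l, node_values a l = u l].
Proof.
move=> hphi hu; apply: (@place_finite K cst_frac (fun i => tf (gcoef i))) => //.
  by apply: cone_hom.
by move=> l; rewrite tofrac_gparam.
Qed.

Fact pull_key : {f : {mpoly C[m]} -> T | forall p, f p =
    mmap (@mpolyC _ C) gparam p}.
Proof. by eexists. Qed.

Definition pull := sval pull_key.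

Lemma pullE p : pull p = mmap (@mpolyC _ C) gparam p.
Proof. exact: (svalP pull_key). Qed.

Lemma pull_eval p w : (pull p).@[w] = p.@[fun l => (gparam l).@[w]].
Proof.
rewrite pullE (rmorph_mmap _ (meval w)) [RHS]/meval; apply: eq_mmap => // a.
by rewrite /= mevalC.
Qed.

Lemma pullM p q : pull (p * q) = pull p * pull q.
Proof. rewrite !pullE; exact: rmorphM. Qed.

Lemma pullC x : pull x%:MP = x%:MP.
Proof. rewrite pullE; exact: mmapC. Qed.

Lemma pull1 : pull 1 = 1.
Proof. by rewrite pullE rmorph1. Qed.

Lemma pullX l : pull 'X_l = gparam l.
Proof. rewrite pullE; exact: mmap_XU. Qed.

(** * Each coefficient is a rational function of the parameters *)

Section Birational.
Variable i0 : 'I_ngmon.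
Local Notation th := (gcoef i0).

Definition pull_poly (P : {poly {mpoly C[m]}}) : {poly T} :=
  map_poly (mmap (@mpolyC ndim C) gparam) P.
Definition spec_poly (w : 'I_ndim -> C) (P : {poly {mpoly C[m]}}) : {poly C} :=
  map_poly (meval (fun l => (gparam l).@[w])) P.

Lemma spec_poly_horner w P : (spec_poly w P).[th.@[w]] = (pull_poly P).[th].@[w].
Proof.
rewrite -horner_map; congr (_.[_]); rewrite /spec_poly /pull_poly -map_poly_comp.
by apply: eq_map_poly => p; rewrite /= -pullE pull_eval.
Qed.

(** A value compatible with all equations of [th] over the parameters is taken by a place above the
    parameters of [w]. By [place_point] it is then a coordinate of a point of the closure with these
    node values, and there is only one such point. *)
Lemma spec_value_uniq w b :
  (forall P, (pull_poly P).[th] = 0 -> (spec_poly w P).[b] = 0) -> b = th.@[w].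
Proof.
have H b' : (forall P, (pull_poly P).[th] = 0 -> (spec_poly w P).[b'] = 0) ->
    exists a, [/\ a i0 = b', clW (coef_poly a) & forall l, node_values a l =
      (gparam l).@[w]].
  move=> h.
  pose f : {rmorphism {poly {mpoly C[m]}} -> K} :=
    tf \o (horner_eval th \o map_poly (mmap (@mpolyC ndim C) gparam)).
  pose g : {rmorphism {poly {mpoly C[m]}} -> C} :=
    horner_eval b' \o map_poly (meval (fun l => (gparam l).@[w])).
  have [|||phi hphi e] := @place_of_hom _ _ cst_frac _ f g (fun x => (x%:MP)%:P).
  - by move=> x; rewrite /f /= map_polyC /= /horner_eval hornerC mmapC.
  - by move=> x; rewrite /g /= map_polyC /= /horner_eval hornerC mevalC.
  - move=> P /eqP; rewrite /f /= tofrac_eq0 /horner_eval => /eqP P0.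
    exact: h.
  have [|a [ha ca sa]] := @place_point phi (fun l => (gparam l).@[w]) hphi.
    move=> l; have := e ('X_l)%:P.
    by rewrite /f /g /= !map_polyC /= /horner_eval !hornerC mmap_XU mevalXU.
  exists a; split=> //; have := e 'X.
  by rewrite /f /g /= !map_polyX /= /horner_eval !hornerX ha => -[].
move=> /H [a [<- ca sa]].
have [|a' [<- ca' sa']] := H th.@[w].
  by move=> P P0; rewrite spec_poly_horner P0 meval0.
by apply: (clW_inj ca ca') => l; rewrite sa sa'.
Qed.

Lemma pull_polyB_monomial P a k :
  pull_poly (P - a *: 'X^k) = pull_poly P - pull a *: 'X^k.
Proof. by rewrite /pull_poly rmorphB /= map_polyZ /= map_polyXn pullE. Qed.

Lemma pull_polyC a : pull_poly a%:P = (pull a)%:P.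
Proof. by rewrite /pull_poly map_polyC pullE. Qed.

Lemma spec_poly_eq0 w P : pull_poly P = 0 -> spec_poly w P = 0.
Proof.
move=> /polyP P0; apply/polyP => k; rewrite coef_map coef0.
have := P0 k; rewrite coef_map coef0 /= -pullE => /(congr1 (meval w)).
by rewrite meval0 pull_eval.
Qed.

Lemma spec_minimal_zero w b P S :
  (lead_coef P).@[fun l => (gparam l).@[w]] != 0 -> (pull_poly P).[th] = 0 ->
  (forall Q, (pull_poly Q).[th] = 0 -> (size Q < size P)%N -> pull_poly Q = 0) ->
  (pull_poly S).[th] = 0 -> (spec_poly w P).[b] = 0 -> (spec_poly w S).[b] = 0.
Proof.
apply: minimal_zero => p /(congr1 (meval w)).
by rewrite meval0 /= -pullE pull_eval.
Qed.

(* By spec_value_uniq, a minimal polynomial of th over C(gparam) specializes to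
   polynomials with the single root th.@[w]. In characteristic 0 this root can
   be read off the two leading coefficients. *)
Lemma coef_rational : exists num den, pull den != 0 /\ pull num = pull den * th.
Proof.
pose alg P := pull_poly P != 0 /\ (pull_poly P).[th] = 0.
have [exP|nP] := pselect (exists P, alg P); last first.
  (* If [th] were transcendental over the parameters, all its equations would specialise to 0, and
     any value, such as this shifted one, would be compatible. *)
  have /eqP : th.@[fun=> 0] + 1 = th.@[fun=> 0].
    apply: spec_value_uniq => P e; rewrite spec_poly_eq0 ?horner0 //.
    by apply/eqP/negPn/negP => P0; apply: nP; exists P.
  by rewrite -subr_eq0 addrAC subrr add0r oner_eq0.
have exd : exists d, `[< exists2 P, alg P & size P = d >].
  by have [P hP] := exP; exists (size P); apply/asboolP; exists P.
have [d /asboolP[P [P0 Pth] sP] dmin] := ex_minnP exd.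
have {}dmin S : (pull_poly S).[th] = 0 -> (size S < d)%N -> pull_poly S = 0.
  move=> Sth Sd; apply/eqP; apply: contraTT Sd => S0; rewrite -leqNgt.
  by apply: dmin; apply/asboolP; exists S.
have nzP : P != 0 by apply: contraNneq P0 => ->; rewrite -polyC0 pull_polyC
  -[0]/(0%:MP) pullC mpolyC0 polyC0.
have [a ea] : exists a, a = lead_coef P by exists (lead_coef P).
have a0 : pull a != 0.
  (* Otherwise the leading term could be dropped without changing the pulled-back polynomial,
     against minimality. *)
  apply: contraNneq P0 => a0.
  pose S := P - a *: 'X ^+ (size P).-1.
  have eS : pull_poly S = pull_poly P.
    by rewrite /S pull_polyB_monomial a0 scale0r subr0.
  rewrite -eS; apply/eqP/dmin; first by rewrite eS.
  rewrite -sP; have := nzP; rewrite -size_poly_gt0 => /prednK <-.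
  rewrite ltnS; apply/leq_sizeP => k; rewrite leq_eqVlt => /predU1P[<-|kP].
    by rewrite coefB coefZ coefXn eqxx mulr1 ea lead_coefE subrr.
  have szP : (0 < size P)%N by rewrite size_poly_gt0.
  have -> : S`_k = P`_k - a * (k == (size P).-1)%:R by rewrite coefB coefZ coefXn.
  rewrite (gtn_eqF kP) mulr0 subr0; apply: nth_default.
  by rewrite -(prednK szP).
have d1 : (1 < d)%N.
  rewrite ltnNge; apply/negP => d1; move: Pth;
    rewrite (size1_polyC (_ : size P <= 1)%N) ?sP //.
  rewrite pull_polyC hornerC => P00; case/eqP: a0.
  rewrite ea lead_coefE sP.
  by rewrite (_ : d.-1 = 0%N) //; case: (d) d1 => [|[]].
have single w b : a.@[fun l => (gparam l).@[w]] != 0 ->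
  root (spec_poly w P) b -> b = th.@[w].
  move=> aw /rootP Pb; apply: spec_value_uniq => S Sth.
  rewrite ea in aw; apply: (spec_minimal_zero aw Pth _ Sth) => //.
  by move=> Q Qth; rewrite sP; apply: dmin.
have eden : pull ((- d.-1%:R)%:MP * a) = (- d.-1%:R)%:MP * pull a.
  by rewrite pullM pullC.
(* The degree is d-1 and all roots of the specialisation equal [th.@[w]], so the coefficient after
   the leading one is -(d-1) times [a] times [th]. *)
exists P`_d.-2, ((- d.-1%:R)%:MP * a); rewrite {}eden.
have dn0 : d.-1%:R != 0 :> C by rewrite Num.Theory.pnatr_eq0; case: (d) d1 => [|[]].
split; first by rewrite mulf_neq0 // mpolyC_eq0 oppr_eq0.
(* The extra factor [pull a] restricts the check to points where the leading coefficient does not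
   vanish. *)
apply: (mulfI a0); apply: mpoly_eval_eq => w; rewrite !mevalM mevalC.
apply: mulf_congr => aw.
rewrite !pull_eval in aw *.
have ssp : size (spec_poly w P) = d by rewrite size_map_poly_id0 ?sP -?ea.
have lsp : lead_coef (spec_poly w P) = a.@[fun l => (gparam l).@[w]].
  by rewrite lead_coefE ssp coef_map ea lead_coefE sP.
have [rs ers] := closed_field_poly_normal (spec_poly w P).
have srs : size rs = d.-1.
  have := ssp; rewrite ers size_scale ?lsp // size_prod_XsubC => <- //.
have rsE z : z \in rs -> z = th.@[w].
  move=> zrs; apply: single => //; rewrite ers rootE hornerZ; apply/eqP.
  by apply/eqP; rewrite mulf_eq0 -rootE root_prod_XsubC zrs orbT.
have : (spec_poly w P)`_d.-2 = a.@[fun l => (gparam l).@[w]] * -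
  (d.-1%:R * th.@[w]).
  rewrite {1}ers coefZ lsp; congr (_ * _).
  rewrite -srs coefPn_prod_XsubC; last by rewrite srs; case: (d) d1 => [|[]].
  congr (- _); rewrite big_seq (eq_bigr (fun=> th.@[w])); last by move=> z /rsE.
  by rewrite -big_seq big_const_seq count_predT iter_addr_0 mulr_natl.
rewrite coef_map /= => ->.
move: (a.@[_]) (th.@[w]) (d.-1%:R) => x y z; ring.
Qed.

End Birational.

(** * The query set, its closure and their projections *)

Variable A : 'rV[C]_(m + n + 1) -> Prop.
Hypothesis AP : forall u x y, A (point u x y) <->
  exists w, (forall l, u ord0 l = node_values (gcoef_at w) l) /\
    y = (coef_poly (gcoef_at w)).@[x ord0].

(** [gpoint] reads [x] from [w]; a prescribed [x] is reached by changing these coordinates only,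
    which leaves the coefficients alone. *)
Definition with_x (w : 'I_ndim -> C) (x : 'I_n -> C) : 'I_ndim -> C :=
  mk3 (fun=> w t_ix) (w \o z_ix) x.

Lemma gcoef_at_with_x w x i : gcoef_at (with_x w x) i = gcoef_at w i.
Proof.
have e v : gcoef_at v i = v t_ix * (circuit_poly (v \o z_ix) c)@_(gmon i).
  by rewrite -[LHS](mcoeff_coef_poly (gcoef_at v)) coef_poly_gcoef_at // mcoeffZ.
have e1 : with_x w x t_ix = w t_ix by exact: mk3_1.
have e2 : with_x w x \o z_ix = w \o z_ix.
  by apply/funext => j; exact: mk3_2.
by rewrite (e (with_x w x)) e1 e2 -e.
Qed.

Lemma proj_family u : proj A u <-> exists w, forall l, u ord0 l =
    node_values (gcoef_at w) l.
Proof.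
split=> [[x [y /AP[w [uw _]]]]|[w uw]]; first by exists w.
by exists 0, (coef_poly (gcoef_at w)).@[(0 : 'rV[C]_n) ord0]; apply/AP; exists w.
Qed.

Definition gvalue : T :=
  \sum_i gcoef i * mmap (@mpolyC ndim C) (fun k => 'X_(x_ix k)) 'X_[gmon i].

Definition gpoint : 'I_(m + n + 1) -> T := mk3 gparam (fun i => 'X_(x_ix i))
    (fun=> gvalue).

Lemma gvalue_eval w : gvalue.@[w] = (coef_poly (gcoef_at w)).@[w \o x_ix].
Proof.
rewrite /gvalue raddf_sum coef_poly_eval; apply: eq_bigr => i _.
rewrite /= mevalM meval_comp; congr (_ * _).
by apply: meval_eq => k; rewrite mevalXU.
Qed.

Lemma gpoint_eval w k : (gpoint k).@[w] =
  mk3 (node_values (gcoef_at w)) (w \o x_ix) (fun=> (coef_poly (gcoef_at w)).@[w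
    \o x_ix]) k.
Proof.
elim/mk3_ind: k => [l|i|l]; rewrite /gpoint ?mk3_1 ?mk3_2 ?mk3_3.
- exact: gparam_eval.
- exact: mevalXU.
- exact: gvalue_eval.
Qed.

(** A polynomial image of an affine space is the form needed for irreducibility and for lifting
    points of the closure to places. *)
Lemma family_image e : A e <-> exists w, forall k, e ord0 k = (gpoint k).@[w].
Proof.
have [u [x [y ->]]] := point_surj e; split=> [/AP[w [uw yw]]|[w ew]].
  have xx : with_x w (x ord0) \o x_ix = x ord0.
    by apply/funext => k; rewrite /= /with_x /x_ix mk3_3.
  have gw : gcoef_at (with_x w (x ord0)) = gcoef_at w by apply/funext => i;
    exact: gcoef_at_with_x.
  exists (with_x w (x ord0)) => k; rewrite gpoint_eval point_mk3 xx gw yw.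
  by elim/mk3_ind: k => k; rewrite ?mk3_1 ?mk3_2 ?mk3_3.
apply/AP; exists w.
have ew' (k : 'I_(m + n + 1)) : mk3 (u ord0) (x ord0) (fun=> y) k =
  mk3 (node_values (gcoef_at w)) (w \o x_ix) (fun=> (coef_poly (gcoef_at w)).@[w
  \o x_ix]) k.
  by rewrite -point_mk3 ew gpoint_eval.
split=> [l|]; first by have := ew' (ix1 _ _ l); rewrite !mk3_1.
have := ew' (ix3 _ _ ord0); rewrite !mk3_3 => ->; apply: meval_eq => k.
by have := ew' (ix2 _ _ k); rewrite !mk3_2.
Qed.

(** For fixed [x] the point is polynomial in the coefficients, so an equation of [A] becomes an
    equation of the family of coefficients, which persists on its closure. *)
Lemma closure_family_intro a (u : 'rV_m) (x : 'rV_n) y : clW (coef_poly a) ->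
    (forall l, u ord0 l = node_values a l) ->
  y = (coef_poly a).@[x ord0] -> zclosure A (point u x y).
Proof.
move=> ca ua ya p pA.
pose q b : 'I_(m + n + 1) -> C := mk3 (node_values b) (x ord0) (fun=>
  (coef_poly b).@[x ord0]).
pose v : 'I_(m + n + 1) -> {mpoly C[ngmon]} :=
  mk3 (fun l => \sum_i nodemon l i *: 'X_i) (fun k => (x ord0 k)%:MP)
      (fun=> \sum_i ('X_[gmon i]).@[x ord0] *: 'X_i).
have vq b k : (v k).@[b] = q b k.
  elim/mk3_ind: k => k; rewrite /v /q ?mk3_1 ?mk3_2 ?mk3_3.
  - by rewrite raddf_sum; apply: eq_bigr => i _; rewrite /= mevalZ mevalXU.
  - by rewrite mevalC.
  - rewrite raddf_sum coef_poly_eval; apply: eq_bigr => i _.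
    by rewrite /= mevalZ mevalXU mulrC.
have H b : (mmap (@mpolyC ngmon C) v p).@[b] = p.@[q b].
  by rewrite meval_comp; apply: meval_eq => k; rewrite vq.
have := clW_vanish ca (H := mmap (@mpolyC ngmon C) v p).
rewrite H (_ : p.@[q a] = p.@[point u x y ord0]); last first.
  apply: meval_eq => k; rewrite point_mk3 /q.
  by elim/mk3_ind: k => k; rewrite ?mk3_1 ?mk3_2 ?mk3_3.
apply=> w; rewrite H.
pose u' : 'rV[C]_m := \row_l node_values (gcoef_at w) l.
rewrite -[RHS](pA (point u' x (coef_poly (gcoef_at w)).@[x ord0])).
  apply: meval_eq => k; rewrite point_mk3 /q.
  by elim/mk3_ind: k => k; rewrite ?mk3_1 ?mk3_2 ?mk3_3 ?mxE.
by apply/AP; exists w; split=> // l; rewrite mxE.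
Qed.

(** Conversely, lift the point to a place: finite parameters force finite coefficients, and their
    values are the required [a]. *)
Lemma closure_familyP (u : 'rV_m) (x : 'rV_n) y : zclosure A (point u x y) <->
  exists a, [/\ clW (coef_poly a), (forall l, u ord0 l = node_values a l) & y =
    (coef_poly a).@[x ord0]].
Proof.
split=> [Be|[a [ca ua ya]]]; last exact: closure_family_intro ca ua ya.
have [p hp|phi hphi e] := @lift_place _ gpoint (point u x y ord0).
  apply: Be => v /family_image[w vw]; rewrite -[RHS](hp w); exact: meval_eq.
have eX k : phi (tf (gpoint k)) = Some (point u x y ord0 k).
  by have := e 'X_k; rewrite mmap_XU mevalXU.
have [l|a [ha ca sa]] := @place_point phi (u ord0) hphi.
  by have := eX (ix1 _ _ l); rewrite point_mk3 /gpoint !mk3_1.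
exists a; split=> //.
have hx q : phi (tf (mmap (@mpolyC ndim C) (fun k => 'X_(x_ix k)) q)) =
  Some q.@[x ord0].
  rewrite rmorph_mmap; apply: (@place_mmap _ _ cst_frac) => // k.
  by have := eX (ix2 _ _ k); rewrite point_mk3 /gpoint !mk3_2.
have := eX (ix3 _ _ ord0); rewrite point_mk3 /gpoint !mk3_3 /gvalue rmorph_sum
  /= => ey.
suff : Some y = Some (coef_poly a).@[x ord0] by case.
rewrite -ey coef_poly_eval; elim/big_rec2: _ => [|i z z' _ IH].
  by rewrite -(rmorph0 cst_frac) (placeC hphi).
have := placeD hphi (placeM hphi (ha i) (hx 'X_[gmon i])) IH.
by rewrite tofracM.
Qed.

(** The same description holds for the projection of the closure in [proj_closureP], so that B
    projects onto V. Finiteness at places plays the part of properness. *)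
Lemma closure_projP (u : 'rV_m) : zclosure (proj A) u <->
  exists a, clW (coef_poly a) /\ forall l, u ord0 l = node_values a l.
Proof.
split=> [Bu|[a [ca ua]] p pA].
  have [p hp|phi hphi e] := @lift_place _ gparam (u ord0).
    apply: Bu => v /proj_family[w vw]; rewrite -[RHS](hp w).
    by apply: meval_eq => l; rewrite vw gparam_eval.
  have [l|a [ha ca sa]] := @place_point phi (u ord0) hphi.
    by have := e 'X_l; rewrite mmap_XU mevalXU.
  by exists a; split=> // l; rewrite sa.
pose v l : {mpoly C[ngmon]} := \sum_i nodemon l i *: 'X_i.
have H b : (mmap (@mpolyC ngmon C) v p).@[b] = p.@[node_values b].
  rewrite meval_comp; apply: meval_eq => k.
  by rewrite raddf_sum; apply: eq_bigr => i _; rewrite /= mevalZ mevalXU.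
have := clW_vanish ca (H := mmap (@mpolyC ngmon C) v p).
rewrite H (_ : p.@[node_values a] = p.@[u ord0]); last by apply: meval_eq.
apply=> w; rewrite H -[RHS](pA (\row_l node_values (gcoef_at w) l)).
  by apply: meval_eq => l; rewrite mxE.
by apply/proj_family; exists w => l; rewrite mxE.
Qed.

Lemma proj_closureP (u : 'rV_m) : proj (zclosure A) u <->
  exists a, clW (coef_poly a) /\ forall l, u ord0 l = node_values a l.
Proof.
split=> [[x [y /closure_familyP[a [ca ua _]]]]|[a [ca ua]]]; first by exists a.
by exists 0, (coef_poly a).@[(0 : 'rV[C]_n) ord0]; apply/closure_familyP; exists a.
Qed.

Lemma fibre_closure (u : 'rV_m) a : clW (coef_poly a) ->
    (forall l, u ord0 l = node_values a l) ->
  fibre_graph (zclosure A) u (coef_poly a).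
Proof.
move=> ca ua x y; split=> [/closure_familyP[b [cb ub ->]]|ya]; last first.
  by apply/closure_familyP; exists a.
by congr (_.@[_]); congr coef_poly; apply/funext/(clW_inj cb ca) => l;
  rewrite -ub ua.
Qed.

Lemma clW_gcoef_at w : clW (coef_poly (gcoef_at w)).
Proof. by apply: clW_sub; apply/W_familyP; exists w. Qed.

Lemma fibre_family (u : 'rV_m) w :
    (forall l, u ord0 l = node_values (gcoef_at w) l) ->
  fibre_graph A u (coef_poly (gcoef_at w)).
Proof.
move=> uw x y; split=> [Axy|->]; last by apply/AP; exists w.
by apply/(fibre_closure (clW_gcoef_at w) uw)/zclosure_sub.
Qed.

Lemma fibre_uniq (X : 'rV[C]_(m + n + 1) -> Prop) u f g :
  fibre_graph X u f -> fibre_graph X u g -> f = g.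
Proof.
move=> fX gX; apply: mpoly_eval_eq => v.
have ev (h : {mpoly C[n]}) : h.@[v] = h.@[(\row_k v k) ord0].
  by apply: meval_eq => k; rewrite mxE.
by rewrite !ev; apply/gX/fX.
Qed.

Lemma fibre_familyP (u : 'rV_m) f : proj A u -> fibre_graph A u f ->
  exists w, (forall l, u ord0 l = node_values (gcoef_at w) l) /\
    f = coef_poly (gcoef_at w).
Proof.
move=> /proj_family[w uw] fu; exists w; split=> //.
exact: fibre_uniq fu (fibre_family uw).
Qed.

Hypothesis constr : constructible A.

Lemma rational_family_family : rational_family A.
Proof.
split=> // [|u /proj_family[w uw]]; last by exists (coef_poly (gcoef_at w));
  exact: fibre_family.
by exists (\row_k (gpoint k).@[fun=> 0]); apply/family_image;
  exists (fun=> 0) => k; rewrite mxE.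
Qed.

Lemma rational_family_closure : rational_family (zclosure A).
Proof.
split; first exact: zclosure_constructible.
  by have [_ [w Aw] _] := rational_family_family; exists w; exact: zclosure_sub.
by move=> u /proj_closureP[a [ca ua]]; exists (coef_poly a); exact: fibre_closure.
Qed.

Lemma irreducible_closure : irreducible (zclosure A).
Proof. exact: irreducible_image family_image. Qed.

Lemma irreducible_closure_proj : irreducible (zclosure (proj A)).
Proof.
apply: (@irreducible_image _ _ _ gparam) => u; rewrite proj_family.
by split=> -[w uw]; exists w => l; rewrite uw gparam_eval.
Qed.

Lemma fibre_family_closure u f : proj A u -> fibre_graph A u f ->
    fibre_graph (zclosure A) u f.
Proof.
move=> pu fu; have [w [uw ->]] := fibre_familyP pu fu.
by apply: fibre_closure => //; exact: clW_gcoef_at.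
Qed.

Section ParameterVariety.
Variable V : variety R m.
Hypothesis VP : forall u, V u <-> zclosure (proj A) u.

Lemma pull_eq0 p : pull p = 0 <-> forall v : 'rV[C]_m, V v -> p.@[v ord0] = 0.
Proof.
split=> [p0 v /VP|pV]; last first.
  apply: mpoly_eval_eq => w; rewrite pull_eval meval0.
  rewrite -[RHS](pV (\row_l (gparam l).@[w])); first by apply: meval_eq => l;
    rewrite mxE.
  apply/VP/zclosure_sub/proj_family; exists w => l.
  by rewrite mxE gparam_eval.
apply=> u /proj_family[w uw].
have <- : (pull p).@[w] = 0 by rewrite p0 meval0.
by rewrite pull_eval; apply: meval_eq => l; rewrite gparam_eval uw.
Qed.

Lemma function_field_embedding : exists io : {rmorphism function_field V -> K},
  forall p q, io (rational_fun V p q) = tf (pull p) / tf (pull q).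
Proof.
have [|io ioE] := @function_field_pull R m V ndim (mmap (@mpolyC ndim C) gparam).
  by move=> p; have := pull_eq0 p; rewrite pullE.
by exists io => p q; rewrite ioE !pullE.
Qed.

Lemma coord_fun_neq0 p : pull p != 0 -> coord_fun V p != 0.
Proof.
apply: contraNneq => p0; apply/eqP/pull_eq0 => v Vv.
have e0 : coord_fun V p = coord_fun V 0.
  by rewrite p0 coord_fun0.
by rewrite (iffLR (coord_fun_eq V p 0) e0 v Vv) meval0.
Qed.

(** [place_at] only tells which values vanish, so the value of [p] is found by subtracting the
    constant [p.@[u ord0]]. *)
Lemma place_at_coord (u : 'rV_m) phi (j : {rmorphism C -> function_field V}) :
  (forall a, j a = rational_fun V a%:MP 1) -> place_at u phi ->
  forall p, phi (rational_fun V p 1) = Some p.@[u ord0].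
Proof.
move=> jE [/(place_is_place _ jE) hphi hu] p.
have [|b e [_ b0]] := hu (rational_fun V (p - (p.@[u ord0])%:MP) 1) 0.
  exists (p - (p.@[u ord0])%:MP), 1; split=> //; first by rewrite meval1 oner_neq0.
  by rewrite mevalB mevalC subrr mul0r.
have := placeD hphi e (placeC hphi p.@[u ord0]); rewrite b0 // add0r jE => <-.
congr phi; rewrite /rational_fun -mulrDl; congr (_ / _).
by rewrite -tofracD -coord_funD subrK.
Qed.

(** [has_value] may use any fraction representing the scalar on [V]; each one, pulled back,
    satisfies the polynomial identity with [gcoef i], which is then evaluated at [w]. *)
Lemma has_value_coef (io : {rmorphism function_field V -> K}) th i (u : 'rV_m) w a :
  (forall p q, io (rational_fun V p q) = tf (pull p) / tf (pull q)) ->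
  io th = tf (gcoef i) -> (forall l, u ord0 l = node_values (gcoef_at w) l) ->
  has_value u th a -> a = gcoef_at w i.
Proof.
move=> ioE ioth uw [p [q [q0 thpq ->]]].
have eu s : (pull s).@[w] = s.@[u ord0].
  by rewrite pull_eval; apply: meval_eq => l; rewrite gparam_eval uw.
have qn0 : pull q != 0 by apply: contraNneq q0 => e; rewrite -eu e meval0.
have e : pull p = pull q * gcoef i.
  apply/eqP; rewrite -tofrac_eq tofracM -ioth thpq ioE mulrC divfK //.
  by rewrite tofrac_eq0.
by rewrite -!eu e mevalM mulrC mulKf // eu.
Qed.

Section Coefficients.
Variables (th : 'I_ngmon -> function_field V).
Variable io : {rmorphism function_field V -> K}.
Hypothesis ioE : forall p q, io (rational_fun V p q) = tf (pull p) / tf (pull q).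
Hypothesis ioth : forall i, io (th i) = tf (gcoef i).

Lemma place_at_coef (u : 'rV_m) phi : place_at u phi ->
  exists a, [/\ forall i, phi (th i) = Some (a i), clW (coef_poly a) &
    forall l, node_values a l = u ord0 l].
Proof.
have [j jE] := const_morphism V.
have ioj a : io (j a) = cst_frac a.
  by rewrite jE ioE pullC pull1 tofrac1 divr1.
move=> hu; have [/(place_is_place _ jE) hphi _] := hu.
have cone (H : {mpoly C[ngmon]}) lam : (forall w, H.@[gcoef_at w] = 0) ->
    mmap j (fun i => lam * th i) H = 0.
  move=> hH; apply: (fmorph_inj io); rewrite rmorph0 rmorph_mmap.
  have ioC : forall a : C, tf a%:MP = cst_frac a by [].
  rewrite -[RHS](cone_hom ioC (io lam) hH); apply: eq_mmap => [a|i].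
    exact: ioj.
  by rewrite /= rmorphM ioth.
apply: (place_finite cone hphi) => l.
rewrite -(mevalXU (u ord0) l) -(place_at_coord jE hu); congr phi.
apply: (fmorph_inj io); rewrite ioE pullX pull1 tofrac1 divr1.
rewrite -tofrac_gparam rmorph_sum; apply: eq_bigr => i _.
by rewrite rmorphM ioth [X in X * _]ioj.
Qed.

End Coefficients.
End ParameterVariety.

(** The scalars of the dense circuit are the fractions of [coef_rational]. Two places over [u] give
    coefficient vectors in the closure with the same node values, hence equal ones. *)
Lemma admits_rep : admits_branching_free_rep A.
Proof.
pose V := Variety (@zclosure_closed R m (proj A)) irreducible_closure_proj.
have VP u : V u <-> zclosure (proj A) u by [].
have cr i := coef_rational i.
pose num i := projT1 (cid (cr i)).
pose den i := projT1 (cid (projT2 (cid (cr i)))).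
have ndP i : pull (den i) != 0 /\ pull (num i) = pull (den i) * gcoef i.
  by rewrite /den /num; case: cid => x hx /=; case: cid.
have [c' [wf' df' ec']] := @dense_circuit C n ngmon gmon.
exists (Representation c' num den); split.
  split; [exact: rational_family_family|exact: irreducible_closure|
    exact: rational_family_closure|].
  by move=> u f; exact: fibre_family_closure.
have [io ioE] := function_field_embedding VP.
have ioth i : io (rational_fun V (num i) (den i)) = tf (gcoef i).
  have [d0 e] := ndP i; rewrite ioE e tofracM mulrC mulKf // tofrac_eq0 //.
exists V; split.
  split=> //.
  - by move=> u; rewrite (VP u) closure_projP proj_closureP.
  - by move=> k kc; move/(all_nthP (gate0 _ _))/(_ k kc): df' => /negPf->.
  - by move=> i; apply: coord_fun_neq0; case: (ndP i).
split=> [u f a pu fu ha|u Vu i].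
  have [w [uw ->]] := fibre_familyP pu fu.
  rewrite /= ec' /coef_poly; apply: eq_bigr => i _; congr (_ *: _).
  exact: (has_value_coef ioE (ioth i) uw (ha i)).
split=> [phi hphi|phi psi hphi hpsi].
  by have [a [ha _ _]] := place_at_coef ioE ioth hphi; exists (a i).
have [a [ha ca sa]] := place_at_coef ioE ioth hphi.
have [b [hb cb sb]] := place_at_coef ioE ioth hpsi.
rewrite /= ha hb; congr Some; apply: (clW_inj ca cb) => l.
by rewrite sa sb.
Qed.

(** * Lower bound for an arbitrary branching-free representation *)

Lemma center_place (w : 'I_ndim -> C) :
  exists2 phi, is_place cst_frac phi & forall p, phi (tf p) = Some p.@[w].
Proof.
have := @place_of_hom _ _ cst_frac _ tf (meval w) (@mpolyC _ C); apply=> [//|a|p].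
- exact: mevalC.
- by move=> /eqP; rewrite tofrac_eq0 => /eqP ->; exact: meval0.
Qed.

Lemma gcoef_at_t0 w : w t_ix = 0 -> forall i, gcoef_at w i = 0.
Proof. by move=> w0 i; rewrite /gcoef_at gcoefE mevalM mevalXU w0 mul0r. Qed.

Lemma coef_poly_set_at w t al : (coef_poly (gcoef_at (set_at t_ix w t)))@_al =
    t * (zcoef al).@[w].
Proof.
by rewrite coef_poly_gcoef_at // mcoeffZ zcoef_eval //.
Qed.

Section Representation.
Variable V : variety R m.
Hypothesis VP : forall u, V u <-> zclosure (proj A) u.
Variable io : {rmorphism function_field V -> K}.
Hypothesis ioE : forall p q, io (rational_fun V p q) = tf (pull p) / tf (pull q).

(** All coefficients vanish along t = 0, and so do the parameters; restriction along [io] turns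
    every point of this hyperplane into places of [V] over the single point 0. *)
Lemma place_at_0 w phi : w t_ix = 0 -> is_place cst_frac phi ->
  (forall p, phi (tf p) = Some p.@[w]) -> place_at (0 : 'rV_m) (phi \o io).
Proof.
move=> w0 hphi hw; split.
  split=> [a|x y a b xa yb|x nx].
  - by rewrite /= ioE pullC pull1 tofrac1 divr1 hw mevalC.
  - by rewrite /= rmorphD rmorphM; split;
    [exact: (placeD hphi xa yb)|exact: (placeM hphi xa yb)].
  - have [x0 xV] := placeN hphi nx; rewrite /= fmorphV xV; split=> //.
    by apply: contraNneq x0 => ->; rewrite rmorph0.
move=> th a [p [q [q0 -> ->]]].
have e s : phi (tf (pull s)) = Some s.@[(0 : 'rV[C]_m) ord0].
  rewrite hw pull_eval; congr Some; apply: meval_eq => l.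
  rewrite gparam_eval mxE /node_values big1 // => i _;
    by rewrite gcoef_at_t0 ?mulr0.
exists (p.@[(0 : 'rV[C]_m) ord0] / q.@[(0 : 'rV[C]_m) ord0]) => //.
rewrite /= ioE; apply: (placeM hphi) => //; exact: (placeV hphi).
Qed.

Lemma params_at_0 : V 0.
Proof.
apply/VP/zclosure_sub/proj_family; exists (fun=> 0) => l.
by rewrite mxE /node_values big1 // => i _; rewrite gcoef_at_t0 ?mulr0.
Qed.

Variables (s : nat) (num den : 'I_s -> {mpoly C[m]}).
Hypothesis den0 : forall j, pull (den j) != 0.
Hypothesis fin : forall u, V u -> forall j,
  (forall phi, place_at u phi ->
    exists a, phi (rational_fun V (num j) (den j)) = Some a) /\
  (forall phi psi, place_at u phi -> place_at u psi ->
     phi (rational_fun V (num j) (den j)) = psi (rational_fun V (num j) (den j))).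

(* All places over the point 0 of V give the scalars the same values, so their
   restrictions to the lines through 0 have no pole at 0. *)
Lemma scalars_at_0 : exists cv : 'I_s -> C, forall j, exists NM : T * T,
  [/\ pull (num j) * NM.2 = NM.1 * pull (den j),
      forall w, w t_ix = 0 -> NM.1.@[w] = cv j * NM.2.@[w]
    & exists w, w t_ix = 0 /\ NM.2.@[w] != 0].
Proof.
pose th j := rational_fun V (num j) (den j).
have [phi0 hphi0 phi0E] := center_place (fun=> 0).
have pl0 := place_at_0 erefl hphi0 phi0E.
pose cv j := projT1 (cid ((fin params_at_0 j).1 _ pl0)).
have cvE j w phi : w t_ix = 0 -> is_place cst_frac phi ->
    (forall p, phi (tf p) = Some p.@[w]) -> phi (io (th j)) = Some (cv j).
  move=> w0 hphi hw; rewrite /cv; case: cid => a /= <-.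
  exact: ((fin params_at_0 j).2 _ _ (place_at_0 w0 hphi hw) pl0).
exists cv => j.
(* Reduced, so that a pole along t = 0 would show as a denominator vanishing there. *)
have [N [M [M0 e [w hw]]]] := reduce_fraction t_ix (pull (num j)) (den0 j).
have NM w' : w' t_ix = 0 -> N.@[w'] = cv j * M.@[w'].
  move=> w0; have [phi hphi phiE] := center_place w'.
  have := placeM hphi (cvE j w' phi w0 hphi phiE) (phiE M).
  have -> : io (th j) * tf M = tf N.
    rewrite /th ioE mulrAC -tofracM e tofracM mulfK // tofrac_eq0; exact: den0.
  by rewrite phiE => -[].
exists (N, M); split=> //.
have s0 : set_at t_ix w 0 t_ix = 0 by rewrite /set_at eqxx.
exists (set_at t_ix w 0); split=> //.
(* On the hyperplane the numerator is [cv j] times the denominator, so it is nonzero only where the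
   denominator is. *)
case/orP: hw => //; rewrite NM // mulf_eq0 negb_or => /andP[] //.
Qed.

Variable c0 : circuit n s.
Hypotheses (wf0 : well_formed c0) (ed0 : essentially_division_free c0).
Hypothesis eval0 : forall u f (a : 'I_s -> C), proj A u -> fibre_graph A u f ->
  (forall j, has_value u (rational_fun V (num j) (den j)) (a j)) ->
  circuit_poly a c0 = f.

(* For generic w, the coefficients of the computed polynomial t * f are, to
   first order at t = 0, linear in the derivatives of the used scalars. *)
Lemma first_order : exists (Gen : T) (D : 'X_{1..n} -> 'I_s -> C), Gen != 0 /\
  forall w, Gen.@[w] != 0 -> exists b : 'I_s -> C,
    (forall j, j \notin used_scalars c0 -> b j = 0) /\
    forall al, (zcoef al).@[w] = \sum_j D al j * b j.
Proof.
have [cv /choice [NM NMP]] := scalars_at_0.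
pose om al := (formal_val c0 (output c0))@_al.
have hD al := jet_mmap (om al) cv.
pose a al := projT1 (cid (hD al)).
pose D al := projT1 (cid (projT2 (cid (hD al)))).
have DP al : forall (tau : 'I_s -> C -> C) b, (forall j, jet (tau j) (cv j)
  (b j)) ->
    jet (fun t => mmap ratr (fun j => tau j t) (om al)) (a al)
      (\sum_j D al j * b j).
  by rewrite /D /a; case: cid => x hx /=; case: cid.
(* Off the zeros of this product, the reduced denominators are nonzero where the line through [w]
   meets t = 0, and no [den j] vanishes identically along that line. *)
exists (\prod_j (cut0 t_ix (NM j).2 * pull (den j))), D; split.
  apply/prodf_neq0 => j _; apply: mulf_neq0 => //.
  have [_ _ [w [w0 Mw]]] := NMP j; apply: contraNneq Mw => e.
  apply/eqP; transitivity ((cut0 t_ix (NM j).2).@[w]); last by rewrite e meval0.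
  rewrite cut0_eval; apply: meval_eq => k.
  by rewrite /set_at; case: eqP => // ->.
move=> w hgen.
have genj j : (NM j).2.@[set_at t_ix w 0] != 0 /\ (pull (den j)).@[w] != 0.
  move: hgen; rewrite rmorph_prod => /prodf_neq0/(_ j isT).
  by rewrite /= mevalM cut0_eval mulf_eq0 negb_or => /andP[].
pose P j := line t_ix w (NM j).1; pose E j := line t_ix w (NM j).2.
have E0 j : (E j).[0] != 0 by rewrite line_eval; case: (genj j).
have PE0 j : (P j).[0] / (E j).[0] = cv j.
  rewrite !line_eval; have [_ h _] := NMP j.
  by rewrite h ?mulfK // ?/set_at ?eqxx //; case: (genj j).
have hb j := jet_frac (P j) (E0 j).
pose b0 j := projT1 (cid (hb j)).
have b0P j : jet (fun t => (P j).[t] / (E j).[t]) (cv j) (b0 j).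
  by rewrite /b0; case: cid => x /=; rewrite PE0.
pose used j := j \in used_scalars c0.
(* Freezing the scalars that do not occur makes their derivatives 0 and leaves the computed
   polynomial unchanged. *)
pose b j := if used j then b0 j else 0.
pose tau j t := if used j then (P j).[t] / (E j).[t] else cv j.
have tauP j : jet (tau j) (cv j) (b j).
  by rewrite /tau /b; case: (used j) => //; exact: jet_const.
exists b; split=> [j nj|al]; first by rewrite /b /used (negPf nj).
(* Where [B] is nonzero, the original scalars are defined at the point of the line and equal the
   reduced fractions. *)
pose B := \prod_j (E j * line t_ix w (pull (den j))).
have B0 : B != 0.
  apply/prodf_neq0 => j _; apply: mulf_neq0.
    by apply: contraNneq (E0 j) => ->; rewrite horner0.
  have [_] := genj j; apply: contraNneq => e.
  apply/eqP; transitivity ((line t_ix w (pull (den j))).[w t_ix]);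
    last by rewrite e horner0.
  rewrite line_eval; apply: meval_eq => k.
  by rewrite /set_at; case: eqP => // ->.
apply/esym; apply: (jet_linear (DP al tau b tauP) B0) => t Bt.
have Btj j : (E j).[t] != 0 /\ (pull (den j)).@[set_at t_ix w t] != 0.
  move: Bt; rewrite horner_prod => /prodf_neq0/(_ j isT).
  rewrite hornerM mulf_eq0 negb_or => /andP[Et dt]; split=> //;
    by rewrite -line_eval.
rewrite -(circuit_poly_coef _ _ wf0 ed0).
have -> : circuit_poly (fun j => tau j t) c0 =
  circuit_poly (fun j => (P j).[t] / (E j).[t]) c0.
  by apply: eq_circuit_poly => j ju; rewrite /tau /used ju.
pose u : 'rV[C]_m := \row_l node_values (gcoef_at (set_at t_ix w t)) l.
have uE l : u ord0 l = node_values (gcoef_at (set_at t_ix w t)) l by rewrite mxE.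
have pu : proj A u by apply/proj_family; exists (set_at t_ix w t).
rewrite (eval0 pu (fibre_family uE)) ?coef_poly_set_at // => j.
have cu p : (pull p).@[set_at t_ix w t] = p.@[u ord0].
  by rewrite pull_eval; apply: meval_eq => l; rewrite uE gparam_eval.
have [Et dt] := Btj j.
exists (num j), (den j); split=> //; first by rewrite -cu.
rewrite !line_eval -!cu; apply/eqP; rewrite eqr_div //; last by rewrite -line_eval.
by have [e _ _] := NMP j; rewrite -!mevalM e.
Qed.

Hypothesis nL : (n <= L)%N.

(** With fewer scalars the rows [D] of the squarefree monomials would be dependent. The relation
    would pass to the coefficients of f_z for generic, hence for all, z; but every squarefree
    monomial is itself some f_z. *)
Lemma used_scalars_lower_bound : (2 ^ n <= size (used_scalars c0))%N.
Proof.
have [Gen [D [Gen0 hD]]] := first_order.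
rewrite leqNgt; apply/negP => small.
have cardI : #|{set 'I_n}| = (2 ^ n)%N.
  by rewrite -cardsT -powersetT card_powerset cardsT card_ord.
have [|lam [[S0 lam0] hlam]] := @linear_relation C {set 'I_n} _ (used_scalars c0)
  (fun S j => D (mesym1 S) j); first by rewrite cardI.
pose Q : T := \sum_S lam S *: zcoef (mesym1 S).
have Qe w : Q.@[w] = \sum_S lam S * (zcoef (mesym1 S)).@[w].
  by rewrite /Q raddf_sum; apply: eq_bigr => S _; rewrite /= mevalZ.
have Q0 : Q = 0.
  apply/eqP/negPn/negP => Q0; have [w] := mpoly_eval_neq0 (mulf_neq0 Q0 Gen0).
  rewrite mevalM mulf_eq0 negb_or => /andP[/eqP Qw /hD [b [b0 hb]]]; apply: Qw.
  rewrite Qe; under eq_bigr do rewrite hb mulr_sumr.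
  rewrite exchange_big /= big1 // => j _.
  have [ju|/b0 ->] := boolP (j \in used_scalars c0); last first.
    by rewrite big1 // => S _; rewrite !mulr0.
  under eq_bigr do rewrite mulrA.
  by rewrite -mulr_suml hlam ?mul0r.
(* At this [z] the relation reduces to [lam S0] = 0. *)
have /genc[z hz] := W_mesym1 R S0 nL.
have := Qe (mk3 (fun=> 0) z (fun=> 0)); rewrite Q0 meval0 (bigD1 S0) //= big1.
  rewrite addr0 zcoef_eval // (_ : mk3 _ _ _ \o _ = z); last first.
    by apply/funext => j; exact: mk3_2.
  by rewrite hz mcoeffX eqxx mulr1 => /esym/eqP; rewrite (negPf lam0).
move=> S SS0; rewrite zcoef_eval // (_ : mk3 _ _ _ \o _ = z); last first.
  by apply/funext => j; exact: mk3_2.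
by rewrite hz mcoeffX (inj_eq (@inj_mesym1 n)) eq_sym (negPf SS0) mulr0.
Qed.

End Representation.

Lemma representation_lower_bound (rp : representation R m n) : (n <= L)%N ->
  branching_free_rep A rp -> (2 ^ n <= (circuit_size (rep_circuit rp)).*2.+1)%N.
Proof.
move=> nL [_ [V [[VP _ wf ed cden] [hi hii]]]].
have [io ioE] := function_field_embedding VP.
apply: leq_trans (size_used_scalars _).
apply: (used_scalars_lower_bound VP ioE _ hii wf ed hi nL) => j.
apply: contraNneq (cden j) => /(pull_eq0 VP) d0.
rewrite -(coord_fun0 V); apply/eqP/coord_fun_eq => v Vv.
by rewrite d0 // meval0.
Qed.

End Family.

(** * The lower bound for the queries *)

Section Query.
Local Open Scope ring_scope.
Variable R : realType.
Local Notation C := R[i].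
Local Notation D := (arith_database R).

Lemma arith_constraint_database : constraint_database D.
Proof.
split.
  exists [:: ([:: 'X_ord_max - ('X_0 + 'X_1)], 1)] => w.
  rewrite /= orbF /in_cell /= meval1 oner_neq0 !andbT.
  by rewrite mevalB mevalD !mevalXU subr_eq0; split=> [->|/eqP].
exists [:: ([:: 'X_ord_max - ('X_0 * 'X_1)], 1)] => w.
rewrite /= orbF /in_cell /= meval1 oner_neq0 !andbT.
by rewrite mevalB mevalM !mevalXU subr_eq0; split=> [->|/eqP].
Qed.

Variables (L n : nat) (c : circuit n (nb_scalars L n)).
Variables (gam : 'I_(nb_params L n) -> 'rV[rat]_n) (Delta Phi : formula).
Hypotheses (circ_generic : generic_circuit R c)
  (gam_ident : identification_sequence (coef_closure (@W R L n)) gam)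
  (DeltaP : Delta_spec R c gam Delta) (PhiP : Phi_spec R c gam Delta Phi).

Local Notation A := (@defined_set R (nb_params L n + n + 1) D Phi).

Let wf : well_formed c. Proof. by case: circ_generic. Qed.
Let pl : plain c. Proof. by case: circ_generic. Qed.
Let df : division_free c. Proof. exact: plain_division_free pl. Qed.
Let genc f : (exists zeta : 'I_(nb_scalars L n) -> C, circuit_poly zeta c =
    f) <-> W L f.
Proof. by case: circ_generic. Qed.

Lemma PsiE zeta x y : Psi_holds c D zeta x y <-> y =
    (circuit_poly (zeta ord0) c).@[x ord0].
Proof. exact: sat_circuit_formula. Qed.

Lemma Delta_holds e : sat D e Delta.
Proof.
apply/(DeltaP.2 D e); split.
- by move=> a b; exists (a + b); split=> // v ->.
- by move=> a b; exists (a * b); split=> // v ->.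
- move=> h1 h2 [z1 hz1] [z2 hz2] h12 x.
  have E1 v : h1 v = (circuit_poly (z1 ord0) c).@[v ord0] by apply/PsiE/hz1.
  have E2 v : h2 v = (circuit_poly (z2 ord0) c).@[v ord0] by apply/PsiE/hz2.
  have ez : circuit_poly (z1 ord0) c = circuit_poly (z2 ord0) c.
    apply: gam_ident => [||k].
    + by apply/clW_sub/genc; exists (z1 ord0).
    + by apply/clW_sub/genc; exists (z2 ord0).
    + by apply: etrans (esym (E1 _)) (etrans (h12 k) (E2 _)).
  by rewrite (E1 x) ez (E2 x).
- exists (fun v => (circuit_poly ((0 : 'rV[C]_(nb_scalars L n)) ord0) c).@[v ord0]).
  by exists 0 => x y; rewrite PsiE.
Qed.

(** The formula has no scaling variable: its z is used with t = 1, and conversely t f_z is computed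
    by other scalars, because the class is closed under scaling. *)
Lemma query_setP u x y : A (point u x y) <-> exists w,
  (forall l, u ord0 l = node_values gam (gcoef_at (c := c) w) l) /\
    y = (coef_poly (gcoef_at (c := c) w)).@[x ord0].
Proof.
rewrite (PhiP.2 D u x y); split=> [[[zeta [/PsiE yz uz]] _]|[w [uw yw]]].
  pose w : 'I_(ndim n (nb_scalars L n)) -> C := mk3 (fun=> 1) (zeta ord0) (fun=> 0).
  have ew : coef_poly (gcoef_at (c := c) w) = circuit_poly (zeta ord0) c.
    rewrite coef_poly_gcoef_at // {1}/w /t_ix mk3_1 scale1r.
    have -> : w \o @z_ix n (nb_scalars L n) = zeta ord0 by apply/funext => j;
      exact: mk3_2.
    by [].
  by exists w; split=> [l|]; rewrite ?node_valuesE // ew //; apply/PsiE.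
split; last exact: Delta_holds.
have /genc[z hz] : W L (coef_poly (gcoef_at (c := c) w)) by apply/(W_familyP df
  genc); exists w.
have hz' : circuit_poly ((\row_j z j) ord0) c = coef_poly (gcoef_at (c := c) w).
  have -> : (\row_j z j) ord0 = z by apply/funext => j; rewrite mxE.
  exact: hz.
exists (\row_j z j); split=> [|k]; apply/PsiE; rewrite hz' //.
by rewrite uw node_valuesE.
Qed.

Lemma query_constructible : constructible A.
Proof. exact: defined_set_constructible. Qed.

Lemma query_rational_family : rational_family A.
Proof.
exact: (@rational_family_family R L n _ _ c gam df genc gam_ident A query_setP
  query_constructible).
Qed.

Lemma query_admits : admits_branching_free_rep A.
Proof.
exact: (@admits_rep R L n _ _ c gam df genc gam_ident A query_setP
  query_constructible).
Qed.

Lemma query_time Pr Q : (n <= L)%N -> branching_parsimonious Pr Q ->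
  Q (nb_params L n) n Phi ->
  (2 ^ n <= (proc_time Pr (nb_params L n) n Phi D).*2.+1)%N.
Proof.
move=> nL bp QPhi.
have [rp e hrp] := bp _ _ _ _ QPhi arith_constraint_database
  query_rational_family query_admits.
apply: leq_trans (representation_lower_bound df genc gam_ident query_setP nL hrp) _.
rewrite ltnS leq_double; have := proc_time_ge Pr (nb_params L n) n Phi D.
by rewrite e.
Qed.

End Query.

(** * Growth estimates and conclusion *)

(** Parity improves the hypothesis to 2^(n-1) <= t, and 2(n-1) >= n. *)
Lemma exp2_le_square n t : 2 <= n -> 2 ^ n <= t.*2.+1 -> 2 ^ n <= t ^ 2.
Proof.
case: n => [|[|k]] // _ h.
have ht : 2 ^ k.+1 <= t.
  by rewrite -leq_double -mul2n -expnS -ltnS ltn_neqAle h andbT expnS mul2n;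
    apply/eqP => /(congr1 odd); rewrite /= !odd_double.
apply: (@leq_trans ((2 ^ k.+1) ^ 2)); last by rewrite leq_sqr.
by rewrite -expnM leq_exp2l // muln2 doubleS !ltnS -addnn leq_addr.
Qed.

Lemma exp2_beats_power c d : exists n, 0 < n /\ c * n ^ d < 2 ^ n.
Proof.
(* With n = 2^(2j) the exponent to beat is c + 2jd. It is at most (j+1)^2, because c <= j and 2d <=
   j, hence at most 2^(2j) = n. *)
pose j := c + d.*2.
exists (2 ^ j.*2); split; first by rewrite expn_gt0.
rewrite -expnM.
apply: leq_trans (_ : 2 ^ (c + j.*2 * d) <= _).
  by rewrite expnD ltn_pmul2r ?expn_gt0 // ltn_expl.
rewrite leq_exp2l //.
apply: (@leq_trans (j.+1 * j.+1)); last first.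
  by rewrite -addnn expnD leq_mul // ltn_expl.
rewrite /j; nia.
Qed.

Theorem theorem1 (R : realType)
  (circ : forall L n : nat, circuit n (nb_scalars L n))
  (gam : forall L n : nat, 'I_(nb_params L n) -> 'rV[rat]_n)
  (Delta Phi : nat -> nat -> formula) (a b q : nat)
  (circ_generic : forall L n, generic_circuit R (circ L n))
  (circ_small : forall L n, 0 < L + n ->
     circuit_size (circ L n) <= a * (L + n) ^ 2)
  (gam_ident : forall L n,
     identification_sequence (coef_closure (@W R L n)) (gam L n))
  (DeltaP : forall L n, Delta_spec R (circ L n) (gam L n) (Delta L n))
  (PhiP : forall L n, Phi_spec R (circ L n) (gam L n) (Delta L n) (Phi L n))
  (Phi_prenex : forall L n, prenex (Phi L n))
  (Phi_length : forall L n, 0 < L + n ->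
     formula_length (Phi L n) <= b * (L + n) ^ 2)
  (Phi_alternations : forall L n, alternations (Phi L n) <= q) :
  (forall Pr : procedure R,
     evaluates_queries Pr (Phi_queries Phi) ->
     branching_parsimonious Pr (Phi_queries Phi) ->
     (* time >= 2 ^ (n / k) for all large n *)
     exists k n0, 0 < k /\ forall n, n0 <= n ->
       2 ^ n <= proc_time Pr (nb_params n n) n (Phi n n) (arith_database R) ^ k)
  /\
  ~ (exists Pr : procedure R,
       [/\ evaluates_queries Pr (bounded_alternation_queries q),
           branching_parsimonious Pr (bounded_alternation_queries q)
         & polynomial_time Pr (bounded_alternation_queries q)]).
Proof.
have time Pr Q n : branching_parsimonious Pr Q -> Q (nb_params n n) n (Phi n n) ->
    2 ^ n <= (proc_time Pr (nb_params n n) n (Phi n n) (arith_database R)).*2.+1.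
  move=> bp hQ.
  exact: (query_time (circ_generic n n) (gam_ident n n) (DeltaP n n) (PhiP n n)
    (leqnn n) bp hQ).
split=> [Pr _ bp|[Pr [_ bp [k [d ptime]]]]].
  exists 2, 2; split=> // n n2; apply: exp2_le_square n2 _.
  by apply: time bp _; exists n.
have Qn n : bounded_alternation_queries q (nb_params n n) n (Phi n n).
  by split=> //; case: (PhiP n n).
(* The constant absorbs 2t + 1 for t <= k l^d + k, where the length l is at most b (2n)^2 = 4 b
   n^2. *)
have [n [n0]] := exp2_beats_power (2 * k * (4 * b) ^ d + 2 * k + 1) (2 * d).
rewrite ltnNge => /negP; apply; apply: leq_trans (time _ _ _ bp (Qn n)) _.
have := ptime _ _ _ (Qn n) (query_rational_family (circ_generic n n)
  (gam_ident n n) (DeltaP n n) (PhiP n n)).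
set t := proc_time _ _ _ _ _ => ht.
have hlen : formula_length (Phi n n) ^ d <= (4 * b) ^ d * n ^ (2 * d).
  have h : formula_length (Phi n n) <= 4 * b * n ^ 2.
    by have := Phi_length n n; rewrite addn_gt0 n0 => /(_ isT); nia.
  rewrite expnM -expnMn; case: (d) => // e; by rewrite leq_exp2r.
have hn : 0 < n ^ (2 * d) by rewrite expn_gt0 n0.
nia.
Qed.
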